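(* Let $B$ be a real $n\times n$ matrix and let $L$ be one of the two transport operators $$L=\partial_t+Bx\cdot\nabla_x\quad\text{(acting on functions of }(t,x)\in\mathbb R\times\mathbb R^n)\qquad\text{or}\qquad L=Bx\cdot\nabla_x\quad\text{(acting on functions of }x\in\mathbb R^n).$$ Let $Q$ be a real symmetric positive semidefinite $n\times n$ matrix. Assume that $B$ and $Q$ satisfy the Kalman rank condition $$\operatorname{Rank}\big[Q,BQ,\ldots,B^{n-1}Q\big]=n,$$ and that the smallest integer $0\le r\le n-1$ satisfying $$\operatorname{Ker}(Q)\cap\operatorname{Ker}(QB^T)\cap\cdots\cap\operatorname{Ker}(Q(B^T)^r)=\{0\}$$ is positive. Let $\lambda_0>0$, $0\le q_{r-2}\le q_{r-1}\le 1$ and $s_{r-1}\ge s_{r-2}\ge 0$ be real numbers (when $r=1$, only $0\le q_0\le 1$ and $s_0\ge 0$ are relevant). Set $q_j=s_j=0$ for $0\le j\le r-3$, and define the positive real numbers $\lambda_1,\ldots,\lambda_r$ recursively by $$\forall j\in\{0,\ldots,r-1\},\quad \lambda_{j+1}\bigg(\frac{1-q_j}{\lambda_j}+1\bigg)=1+s_j.$$ Assume that the family $(\lambda_0,\ldots,\lambda_r)$ is decreasing, i.e. $\lambda_0>\lambda_1>\cdots>\lambda_r$, and, in the case $r\ge 2$, that $$\forall j\in\{2,\ldots,r\},\quad \frac{\lambda_{j-1}}{\lambda_{j-2}}+\frac{\lambda_{j-1}}{\lambda_j}\le 2.$$ Then there exists a positive constant $c>0$ such that for all $u\in\mathscr S$,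 $$\Vert u\Vert_{H^{\lambda_r}}\le c\Big(\big\Vert\langle QD_x\rangle^{\lambda_0}u\big\Vert_{L^2}+\sum_{j=0}^{r-1}\big\Vert\langle Q(B^T)^jD_x\rangle^{q_j}Lu\big\Vert_{H^{s_j}}\Big).$$
   Context: $Bx\cdot\nabla_x$ denotes the differential operator $\sum_{i,j=1}^n B_{i,j}x_j\partial_{x_i}$, where $B=(B_{i,j})_{1\le i,j\le n}$. $B^T$ is the transpose of $B$, and $[Q,BQ,\ldots,B^{n-1}Q]$ is the $n\times n^2$ matrix obtained by writing consecutively the columns of $Q,BQ,\ldots,B^{n-1}Q$. The Japanese bracket is $\langle\eta\rangle=\sqrt{1+|\eta|^2}$ with $|\cdot|$ the Euclidean norm. The Fourier transform is $\widehat u(\xi)=\int_{\mathbb R^n}e^{-2i\pi x\cdot\xi}u(x)\,dx$ (taken with respect to the variable $x$ only when $u$ also depends on $t$). For a continuous function $F:\mathbb R^n\to\mathbb C$, $F(D_x)$ is the Fourier multiplier in the variable $x$ with symbol $F(\xi)$; thus for a matrix $M$ and $\lambda\ge 0$, $\langle MD_x\rangle^{\lambda}$ is the Fourier multiplier with symbol $\langle M\xi\rangle^{\lambda}$. When $L=\partial_t+Bx\cdot\nabla_x$, $\mathscr S=\mathscr S(\mathbb R^{n+1}_{t,x})$ is the Schwartz space and $L^2=L^2(\mathbb R^{n+1}_{t,x})$; when $L=Bx\cdot\nabla_x$, $\mathscr S=\mathscr S(\mathbb R^n_x)$ and $L^2=L^2(\mathbb R^n_x)$. In both cases, for $s\ge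 0$, $\Vert u\Vert_{H^s}=\Vert\langle D_x\rangle^s u\Vert_{L^2}$. *)

(* Defs.v *)
From HB Require Import structures.
From mathcomp Require Import all_boot all_order all_algebra.
From mathcomp Require Import all_classical all_reals all_analysis.
From mathcomp Require Import complex.

Set Implicit Arguments.
Unset Strict Implicit.
Unset Printing Implicit Defensive.

Import Order.TTheory GRing.Theory Num.Theory.
Import numFieldNormedType.Exports.

Local Open Scope classical_set_scope.
Local Open Scope ring_scope.
Local Open Scope complex_scope.

(* R^n is represented by column vectors 'cV[R]_n, for its algebra and topology,
   and by n.-tuple (measurableTypeR R), for its Borel sigma-algebra; vec goes
   from the latter to the former. *)
Definition vec (R : realType) (n : nat) (x : n.-tuple (measurableTypeR R)) :
  'cV[R]_n := \col_i tnth x i.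

Section lebesgue_tuple.
Context (R : realType).
Local Open Scope ereal_scope.
Local Notation T := (measurableTypeR R).

Definition tuple_cons n (p : T * n.-tuple T) : n.+1.-tuple T :=
  [tuple of p.1 :: p.2].

Lemma measurable_tuple_cons n : measurable_fun [set: _] (@tuple_cons n).
Proof. exact: (measurable_cons measurable_fst measurable_snd). Qed.

Section step.
Variables (n : nat) (m : {sigma_finite_measure set (n.-tuple T) -> \bar R}).

Definition tuple_measureS : set (n.+1.-tuple T) -> \bar R :=
  pushforward (lebesgue_measure \x m) (@tuple_cons n).

Let measureS0 : tuple_measureS set0 = 0.
Proof. by rewrite /tuple_measureS /pushforward preimage_set0 measure0. Qed.

Let measureS_ge0 A : 0 <= tuple_measureS A.
Proof. by rewrite /tuple_measureS /pushforward measure_ge0. Qed.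

Let measureS_sigma_additive : semi_sigma_additive tuple_measureS.
Proof.
move=> F mF tF mUF; rewrite /tuple_measureS /pushforward preimage_bigcup.
have mc := @measurable_tuple_cons n.
apply: measure_semi_sigma_additive.
- by move=> k; rewrite -[X in measurable X]setTI; exact: mc.
- apply/trivIsetP => /= i j _ _ ij; rewrite -preimage_setI.
  by move/trivIsetP : tF => /(_ _ _ _ _ ij) ->//; rewrite preimage_set0.
- by rewrite -preimage_bigcup -[X in measurable X]setTI; exact: mc.
Qed.

HB.instance Definition _ := isMeasure.Build _ _ _ tuple_measureS
  measureS0 measureS_ge0 measureS_sigma_additive.

Let measureS_sigma_finite : sigma_finite setT tuple_measureS.
Proof.
have /sigma_finiteP[F [FT ndF Fy]] :=
  sigma_finiteT (lebesgue_measure : {sigma_finite_measure set T -> \bar R}).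
have /sigma_finiteP[G [GT ndG Gy]] := sigma_finiteT m.
pose uncons (x : n.+1.-tuple T) : T * n.-tuple T :=
  (thead x, [tuple of behead x]).
have consK : cancel (@tuple_cons n) uncons.
  by case=> a x; rewrite /uncons theadE; congr (_, _); exact/val_inj.
have munc : measurable_fun [set: _] uncons.
  apply: measurable_fun_pair; first exact: measurable_tnth.
  exact: measurable_behead.
exists (fun k => uncons @^-1` (F k `*` G k)).
  rewrite -preimage_bigcup; apply/esym/seteqP; split => // x _.
  have [i _ Fi] : (\bigcup_k F k) (thead x) by rewrite -FT.
  have [j _ Gj] : (\bigcup_k G k) [tuple of behead x] by rewrite -GT.
  exists (maxn i j) => //; split.
    by move: Fi; exact/subsetPset/ndF/leq_maxl.
  by move: Gj; exact/subsetPset/ndG/leq_maxr.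
move=> k; have [mF Fky] := Fy k; have [mG Gky] := Gy k; split.
  by rewrite -[X in measurable X]setTI; apply: munc => //; exact: measurableX.
rewrite /tuple_measureS /pushforward.
rewrite (_ : _ @^-1` _ = F k `*` G k); last first.
  by apply/seteqP; split => p; rewrite /preimage /mkset consK.
by rewrite product_measure1E// lte_mul_pinfty// ge0_fin_numE.
Qed.

HB.instance Definition _ := Measure_isSigmaFinite.Build _ _ _ tuple_measureS
  measureS_sigma_finite.

End step.

(* Lebesgue measure on R^n: the n-fold product of lebesgue_measure, that is, the
   unit mass on R^0 and lebesgue_measure \x lebesgue_tuple n, transported along
   (a, x) |-> a :: x, on R^(n+1). *)
Fixpoint lebesgue_tuple (n : nat) :
    {sigma_finite_measure set (n.-tuple T) -> \bar R} :=
  if n is n'.+1 then tuple_measureS (lebesgue_tuple n')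
  else dirac [tuple].

Lemma lebesgue_tuple_box n (A : 'I_n -> set T) :
  (forall i, measurable (A i)) ->
  lebesgue_tuple n [set x | forall i, A i (tnth x i)] =
  \prod_(i < n) lebesgue_measure (A i).
Proof.
elim: n A => [|n IHn] A mA /=.
  rewrite big_ord0 diracE mem_set//= => -[]//.
rewrite big_ord_recl -IHn //.
rewrite /tuple_measureS /pushforward -product_measure1E //.
  congr product_measure1; apply/seteqP; split => -[a x] /=.
    move=> H; split; first exact: (H ord0).
    by move=> i; have := H (lift ord0 i); rewrite tnthS.
  move=> [Aa Ax] i; case: (unliftP ord0 i) => [j|] -> //.
  by rewrite tnthS; exact: Ax.
rewrite (_ : mkset _ = \bigcap_(i in [set: 'I_n])
   ((fun x : n.-tuple T => tnth x (i : 'I_n)) @^-1` A (lift ord0 i))); last first.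
  apply/seteqP; split => x H i; first by move=> _; exact: (H i).
  exact: (H i Logic.I).
apply: fin_bigcap_measurable => //= i _.
rewrite -[X in measurable X]setTI; exact: measurable_tnth.
Qed.

End lebesgue_tuple.

Section schwartz.
Context (R : realType) (V : normedModType R).

Fixpoint iter_derive (vs : seq V) (f : V -> R) : V -> R :=
  if vs is v :: vs' then 'D_v (iter_derive vs' f) else f.

Definition rapidly_decreasing (f : V -> R) :=
  forall k : nat, exists C : R, forall x, `|x| ^+ k * `|f x| <= C.

(* For finite-dimensional V. Derivatives are taken along all vectors instead of
   along those of a basis. *)
Definition schwartz_real (f : V -> R) :=
  forall vs : seq V, (forall x, differentiable (iter_derive vs f) x) /\
                     rapidly_decreasing (iter_derive vs f).

Definition schwartz (u : V -> R[i]) :=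
  schwartz_real (fun x => complex.Re (u x)) /\
  schwartz_real (fun x => complex.Im (u x)).

Definition derivec (v : V) (u : V -> R[i]) (x : V) : R[i] :=
  'D_v (fun y => complex.Re (u y)) x +i* 'D_v (fun y => complex.Im (u y)) x.

End schwartz.

Section fourier.
Context (R : realType) (n : nat).
Implicit Types (u F : 'cV[R]_n -> R[i]) (x xi : 'cV[R]_n).

Definition integralc u : R[i] :=
  (\int[lebesgue_tuple R n]_y complex.Re (u (vec y)))%R +i*
  (\int[lebesgue_tuple R n]_y complex.Im (u (vec y)))%R.

Definition dotv x xi : R := \sum_i x i 0 * xi i 0.

Definition expi (a : R) : R[i] := cos a +i* sin a.

Definition fourier u xi : R[i] :=
  integralc (fun x => expi (- (2 * pi * dotv x xi)) * u x).

Definition inv_fourier u x : R[i] :=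
  integralc (fun xi => expi (2 * pi * dotv x xi) * u xi).

Definition fourier_mult F u : 'cV[R]_n -> R[i] :=
  inv_fourier (fun xi => F xi * fourier u xi).

(* The norm of the normed space 'cV[R]_n is the sup norm, not the Euclidean one
   used here. *)
Definition bracket (xi : 'cV[R]_n) : R := Num.sqrt (1 + dotv xi xi).

Definition bracket_pow (M : 'M[R]_n) (l : R) xi : R[i] :=
  (bracket (M *m xi) `^ l)%:C.

(* Extended-real valued. *)
Definition L2norm u : \bar R :=
  ('N[lebesgue_tuple R n]_2%:E[(fun y => (ComplexField.Normc.normc (u (vec y)))%:E)])%E.

Definition Hnorm (s : R) u : \bar R :=
  L2norm (fourier_mult (bracket_pow 1%:M s) u).

Definition transport (B : 'M[R]_n) u x : R[i] :=
  \sum_(i < n) \sum_(j < n)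
    (B i j * x j 0)%:C * derivec (delta_mx i 0) u x.

End fourier.

Section fourier_time.
Context (R : realType) (n : nat).
Implicit Types (u : R * 'cV[R]_n -> R[i]).

Definition fourier_mult_t (F : 'cV[R]_n -> R[i]) u (p : R * 'cV[R]_n) : R[i] :=
  fourier_mult F (fun x => u (p.1, x)) p.2.

Definition L2norm_t u : \bar R :=
  ('N[(lebesgue_measure \x lebesgue_tuple R n)%E]_2%:E[
     (fun p => (ComplexField.Normc.normc (u (p.1, vec p.2)))%:E)])%E.

Definition Hnorm_t (s : R) u : \bar R :=
  L2norm_t (fourier_mult_t (bracket_pow 1%:M s) u).

Definition transport_t (B : 'M[R]_n) u (p : R * 'cV[R]_n) : R[i] :=
  derivec ((1, 0) : R * 'cV[R]_n) u p +
  \sum_(i < n) \sum_(j < n)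
    (B i j * p.2 j 0)%:C * derivec ((0, delta_mx i 0) : R * 'cV[R]_n) u p.

End fourier_time.

Section kalman.
Context (R : realType) (n : nat).
Implicit Types B Q : 'M[R]_n.

Definition sym_psd Q :=
  Q^T = Q /\ forall x : 'cV[R]_n, 0 <= (x^T *m Q *m x) 0 0.

Definition kalman_mx B Q := \mxrow_(j < n) (B ^+ j *m Q).

Definition kernel_cond B Q (r : nat) :=
  \bigcap_(k in [set k : nat | (k <= r)%N])
    [set x : 'cV[R]_n | Q *m B^T ^+ k *m x = 0] = [set 0].

Definition smallest_kernel_index B Q (r : nat) :=
  [/\ (r < n)%N, kernel_cond B Q r &
      forall k : nat, (k < r)%N -> ~ kernel_cond B Q k].

End kalman.

(* Main.v *)
Require Import Defs.
From HB Require Import structures.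
From mathcomp Require Import all_boot all_order all_algebra.
From mathcomp Require Import all_classical all_reals all_analysis.
From mathcomp Require Import complex.
From mathcomp Require Import measurable_realfun ring lra.

Set Implicit Arguments.
Unset Strict Implicit.
Unset Printing Implicit Defensive.

Import Order.TTheory GRing.Theory Num.Theory.
Import numFieldNormedType.Exports.

Local Open Scope classical_set_scope.
Local Open Scope ring_scope.

(* On the Fourier side L is, up to sign and up to the reflection xi -> - xi, the
   operator d/dt - X - tr B with X = (B^T xi) . grad; the real-valued Hartley
   transform H absorbs the reflection. Let f = H u and h = H (L u), for u real.
   Integrating X (m f^2) expresses int (X m) f^2 by int 2 m f h, int (tr B) m f^2
   and a time derivative. Hence, if a function m satisfies
     N <= C N_0 + X m,    |tr B| |m| <= N / 4,    m^2 <= C N G,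
   then int N f^2 <= C' (int N_0 f^2 + int G h^2) by the arithmetic-geometric
   inequality, and it remains to find m when
     A_k = Q (B^T)^k xi,    nu_k = lam_r / lam_k,    P_k = <A_k>^(1 / nu_k),
     N = sum_k P_k^(2 lam_r),    N_0 = P_0^(2 lam_r) = <Q xi>^(2 lam_0),
     G = sum_j <A_j>^(2 q_j) <xi>^(2 s_j).
   As X A_j = A_(j+1), the derivative X (A_j . A_(j+1)) contains |A_(j+1)|^2. The
   function m_j = (A_j . A_(j+1)) <A_(j+1)>^(2 lam_(j+1) - 2), cut off to the
   region where P_j <= eps P_(j+1) and where P_(j+1) bounds the next P_i's, thus
   satisfies X m_j >= P_(j+1)^(2 lam_r) there, up to errors which are small with
   eps because nu is concave, that is, by the assumption on three consecutive
   lam's; the recursion defining lam gives m_j^2 <= C N G. Where P_j > eps P_(j+1),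
   P_(j+1) is controlled by P_j, and one concludes by induction on j down to N_0. *)

(** * Integration of dominated functions on R^n *)

(** The exponents come from one heuristic. Where P = P_(j+1) bounds the later gauges up to a
    constant, <A_i> is at most a constant times P^(nu_i) for i > j, so raising the index by X costs
    a factor P^(nu_(i+1) - nu_i), which concavity bounds by P^d with d = nu_(j+1) - nu_j. Smallness
    of P_j gives <A_j> P^d <= (2 eps)^(nu_j) <A_(j+1)>, and this product occurs in every error
    except the one due to the edge of the cutoff P_j <= eps P_(j+1). Multiplied by lam_r, the
    recursion reads nu_j (1 - q_j) + lam_r = nu_(j+1) (1 + s_j): it turns |m_j| <= <A_j> P^(2 lam_r
    - nu_(j+1)) into a bound by P^(lam_r) <A_j>^(q_j) <A_(j+1)>^(s_j). The analysis uses only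
    directional derivatives and pointwise domination: a derivative of an integral is obtained by
    integrating a quadratic Taylor remainder. Functions are families indexed by time, so that a
    function of x alone is a constant family and both operators share one energy estimate. *)

Section continuity.
Context (R : realType).

Lemma continuous_cV (X : topologicalType) n (phi : X -> 'cV[R]_n) :
  (forall i, continuous (fun x => phi x i 0)) -> continuous phi.
Proof.
move=> h x A [P PA sub].
have : \forall y \near x, forall i : 'I_n, P i 0 (phi y i 0).
  by apply: filter_forall => i; apply: (h i x); exact: PA.
apply: filterS => y Py; apply: sub => i j; rewrite (ord1 j); exact: Py.
Qed.

(** Here ['cV[R]_n] carries a topology, whereas measurability is known for the coordinates only.
    Rounding the coordinates of [phi] down to the grid of step 1/(k+1) gives maps with countably
    many values, and their images under [f] converge pointwise by continuity. *)
Lemma measurable_cV d (T : measurableType d) n (phi : T -> 'cV[R]_n)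
    (f : 'cV[R]_n -> R) :
  continuous f -> (forall i, measurable_fun [set: T] (fun x => phi x i 0)) ->
  measurable_fun [set: T] (f \o phi).
Proof.
move=> cf mphi.
pose rnd k (x : T) : {ffun 'I_n -> int} :=
  [ffun i => Num.floor (k.+1%:R * phi x i 0)].
pose g k (c : {ffun 'I_n -> int}) : 'cV[R]_n := \col_i ((c i)%:~R / k.+1%:R).
apply: (measurable_fun_cvg (h := fun k x => f (g k (rnd k x)))).
- move=> k _ Y mY; rewrite setTI.
  rewrite (_ : _ @^-1` Y = \bigcup_(c in [set: {ffun 'I_n -> int}])
     (if f (g k c) \in Y then rnd k @^-1` [set c] else set0)); last first.
    apply/seteqP; split => x /=.
      by move=> Yx; exists (rnd k x) => //; rewrite (mem_set Yx).
    by case=> c _; case: ifPn => // /set_mem ? /= ->.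
  apply: countable_bigcupT_measurable; first exact: countableP.
  move=> c; case: ifP => // _.
  rewrite (_ : _ @^-1` _ = \bigcap_(i in [set: 'I_n])
     ((fun x => k.+1%:R * phi x i 0) @^-1` `[(c i)%:~R, (c i + 1)%:~R[)); last first.
    apply/seteqP; split => x /=.
      by move=> <- i _ /=; rewrite in_itv/= ffunE floor_itv.
    move=> H; apply/ffunP => i; rewrite ffunE; apply: floor_def.
    by have := H i Logic.I; rewrite /= in_itv.
  apply: fin_bigcap_measurable => //= i _.
  rewrite -[X in measurable X]setTI.
  have mk : measurable_fun [set: T] (fun x => k.+1%:R * phi x i 0) by exact: measurable_funM.
  exact: mk.
- move=> x _; apply: (@cvg_comp _ _ _ (fun k => g k (rnd k x)) f _ (nbhs (phi x))); last exact: cf.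
  move=> A [P PA sub].
  have : \forall k \near \oo, forall i : 'I_n, P i 0 (g k (rnd k x) i 0).
    apply: filter_forall => i.
    suff: (fun k => g k (rnd k x) i 0) @ \oo --> phi x i 0 by move=> /(_ _ (PA i 0)).
    apply/cvgrPdist_le => e e0.
    have := @near_infty_natSinv_lt R (PosNum e0).
    apply: filterS => k /= ke; rewrite !mxE ffunE.
    have /andP[h1 h2] := floor_itv (k.+1%:R * phi x i 0).
    rewrite ger0_norm; last first.
      by rewrite subr_ge0 ler_pdivrMr// [leRHS]mulrC.
    rewrite (le_trans _ (ltW ke))// lerBlDr -[X in _ <= X + _]mul1r -mulrDl ler_pdivlMr//.
    by rewrite mulrC (le_trans (ltW h2))// intrD addrC.
  by apply: filterS => k Pk; apply: sub => i j; rewrite (ord1 j); exact: Pk.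
Qed.

End continuity.

Section product_integral.
Local Open Scope ereal_scope.
Context d1 d2 (T1 : measurableType d1) (T2 : measurableType d2) (R : realType).
Variable m1 : {sigma_finite_measure set T1 -> \bar R}.
Variable m2 : {sigma_finite_measure set T2 -> \bar R}.

(** By Tonelli the integral of |k| is at most the product of the integrals of |g1| and |g2|. *)
Lemma integrable_prod_dominated (k : T1 * T2 -> R) (g1 : T1 -> R) (g2 : T2 -> R) :
  measurable_fun [set: T1 * T2] k ->
  m1.-integrable [set: T1] (EFin \o g1) ->
  m2.-integrable [set: T2] (EFin \o g2) ->
  (forall x y, `|k (x, y)| <= g1 x * g2 y)%R ->
  (m1 \x m2).-integrable [set: T1 * T2] (EFin \o k).
Proof.
move=> mk ig1 ig2 kg; apply/integrable12ltyP; first exact/measurable_EFinP.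
have mg1 := measurable_int _ ig1; have mg2 := measurable_int _ ig2.
apply: (@le_lt_trans _ _ (\int[m1]_x (`|(g1 x)%:E| * \int[m2]_y `|(g2 y)%:E|))).
  apply: ge0_le_integral => //.
  - by move=> x _; exact: integral_ge0.
  - apply: (measurable_fun_fubini_tonelli_F (abse \o (EFin \o k))) => //.
      by apply/measurableT_comp => //; exact/measurable_EFinP.
    by move=> x /=.
  - by apply: emeasurable_funM => //; exact: measurableT_comp.
  move=> x _; rewrite -ge0_integralZl//; last exact: measurableT_comp.
  apply: ge0_le_integral => //.
  - apply: measurableT_comp => //; apply/measurable_EFinP.
    exact: (measurableT_comp mk (measurable_pair1 x)).
  - by apply: emeasurable_funM => //; exact: measurableT_comp.
  - move=> y _; rewrite /= -EFinM lee_fin -normrM.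
    by apply: (le_trans (kg x y)); exact: ler_norm.
have fin2 : \int[m2]_y `|(g2 y)%:E| < +oo by case/integrableP: ig2.
rewrite ge0_integralZr//; last 2 first.
- exact: measurableT_comp.
- exact: integral_ge0.
rewrite lte_mul_pinfty//.
- exact: integral_ge0.
- by rewrite ge0_fin_numE ?integral_ge0//; case/integrableP: ig1.
Qed.

(** Integrability is asked of every section, not of almost every one: the inner extended integral is
    then finite at each point and agrees with the real one, without exceptional null sets. *)
Lemma Rintegral12_prod (k : T1 * T2 -> R) :
  (m1 \x m2).-integrable [set: T1 * T2] (EFin \o k) ->
  (forall x, m2.-integrable [set: T2] (fun y => (k (x, y))%:E)) ->
  (\int[m1 \x m2]_z k z = \int[m1]_x \int[m2]_y k (x, y))%R.
Proof.
move=> ik ik2; rewrite {1}/Rintegral -integral12_prod_meas1//.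
congr fine; apply: eq_integral => x _.
by rewrite /Rintegral fineK//; exact: integrable_fin_num.
Qed.

Lemma Rintegral21_prod (k : T1 * T2 -> R) :
  (m1 \x m2).-integrable [set: T1 * T2] (EFin \o k) ->
  (forall y, m1.-integrable [set: T1] (fun x => (k (x, y))%:E)) ->
  (\int[m1 \x m2]_z k z = \int[m2]_y \int[m1]_x k (x, y))%R.
Proof.
move=> ik ik2; rewrite {1}/Rintegral -integral21_prod_meas1//.
congr fine; apply: eq_integral => x _.
by rewrite /Rintegral fineK//; exact: integrable_fin_num.
Qed.

End product_integral.

Lemma integrable_le d (T : measurableType d) (R : realType)
    (m : {measure set T -> \bar R}) (f g : T -> R) :
  measurable_fun [set: T] f -> m.-integrable [set: T] (EFin \o g) ->
  (forall x, `|f x| <= g x) -> m.-integrable [set: T] (EFin \o f).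
Proof.
move=> mf ig fg; apply: (le_integrable measurableT _ _ ig).
  exact/measurable_EFinP.
by move=> x _ /=; rewrite lee_fin (le_trans (fg x))// ler_norm.
Qed.

(** * Integrals over the real line *)

Section real_line.
Context (R : realType).
Local Notation mu := (@lebesgue_measure R).

Lemma continuous_oneDsqrV' : continuous (fun x : R => (1 + x ^+ 2)^-1).
Proof. exact: continuous_oneDsqrV. Qed.

Lemma oneDsqr_gt0 (x : R) : 0 < 1 + x ^+ 2.
Proof. by rewrite ltr_pwDl// sqr_ge0. Qed.

Lemma integrable_oneDsqrV :
  mu.-integrable [set: R] (fun x : R => ((1 + x ^+ 2)^-1)%:E).
Proof.
apply/integrableP; split.
  by apply/measurable_EFinP; exact: continuous_measurable_fun continuous_oneDsqrV'.
under eq_integral do rewrite /= ger0_norm ?invr_ge0 ?ltW ?oneDsqr_gt0//.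
rewrite ge0_symfun_integralT.
- by rewrite -set_itvcy integral0y_oneDsqr -EFinM ltry.
- by move=> x; rewrite invr_ge0 ltW// oneDsqr_gt0.
- exact: continuous_oneDsqrV'.
- by move=> x /=; rewrite sqrrN.
Qed.

Lemma integral_split0 (f : R -> R) : continuous f -> (forall x, 0 <= f x) ->
  (\int[mu]_x (f x)%:E = \int[mu]_(x in `[0%R, +oo[) (f x)%:E +
     \int[mu]_(x in `[0%R, +oo[) (f (- x))%:E)%E.
Proof.
move=> cf f0.
have mf : measurable_fun [set: R] f by exact: continuous_measurable_fun.
have mposnums : measurable [set x : R | 0 <= x]%R by rewrite -set_itvcy.
rewrite -(setUv [set x : R | 0 <= x]%R) ge0_integral_setU//= ; last 4 first.
  exact: measurableC.
  by apply/measurable_EFinP; rewrite setUv.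
  by move=> x _; rewrite lee_fin.
  exact/disj_setPCl.
rewrite -set_itvcy; congr (_ + _)%E.
rewrite setCitvr.
rewrite integral_itv_bndo_bndc; last exact/measurable_EFinP/measurable_funTS.
rewrite -{1}oppr0 ge0_integration_by_substitutionNy//.
exact: continuous_subspaceT.
Qed.

Lemma integralN (f : R -> R) : continuous f -> (forall x, 0 <= f x) ->
  (\int[mu]_x (f (- x))%:E = \int[mu]_x (f x)%:E)%E.
Proof.
move=> cf f0; rewrite (@integral_split0 f)// integral_split0//.
  by under [X in (_ + X)%E]eq_integral do rewrite opprK; rewrite addeC.
by move=> x; apply: continuous_comp; [exact: opp_continuous|exact: cf].
Qed.

Definition dom1 (f : R -> R) :=
  continuous f /\ exists C, forall x, `|f x| <= C * (1 + x ^+ 2)^-1.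

Lemma integrable_dom1 f : dom1 f -> mu.-integrable [set: R] (EFin \o f).
Proof.
move=> [cf [C fC]].
apply: (@integrable_le _ _ R mu f (fun x : R => C * (1 + x ^+ 2)^-1)) => //.
  exact: continuous_measurable_fun.
by apply: (integrableZl measurableT C integrable_oneDsqrV).
Qed.

Lemma RintegralN f : dom1 f ->
  (\int[mu]_x f (- x) = \int[mu]_x f x)%R.
Proof.
move=> df; have [cf [C fC]] := df.
have dp : dom1 (fun x => C * (1 + x ^+ 2)^-1).
  split; last by exists `|C| => x; rewrite normrM [X in _ * X]ger0_norm// invr_ge0 ltW ?oneDsqr_gt0.
  by move=> x; apply: cvgM; [exact: cvg_cst|exact: continuous_oneDsqrV'].
have cN : continuous (fun x => f (- x)).
  by move=> x; apply: continuous_comp; [exact: opp_continuous|exact: cf].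
have dN : dom1 (fun x => f (- x)).
  by split=> //; exists C => x; rewrite -(sqrrN x); exact: fC.
have cs : continuous (fun x => f x + C * (1 + x ^+ 2)^-1).
  by move=> x; apply: cvgD; [exact: cf|case: dp => + _; exact].
(* Adding the even function C / (1 + x^2) makes the integrand nonnegative, a case already settled;
   its integral cancels at the end. *)
have E : \int[mu]_x (f (- x) + C * (1 + x ^+ 2)^-1) =
         \int[mu]_x (f x + C * (1 + x ^+ 2)^-1).
  rewrite /Rintegral; congr fine.
  rewrite -(@integralN (fun x => f x + C * (1 + x ^+ 2)^-1))//.
    by apply: eq_integral => x _; rewrite sqrrN.
  by move=> x; have := fC x; rewrite ler_norml -subr_ge0 opprK => /andP[].
move: E; rewrite !RintegralD//; try exact: integrable_dom1.
exact: addIr.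
Qed.

End real_line.

Section integral_derivative.
Context (R : realType).
Local Notation mu := (@lebesgue_measure R).

Lemma dominated_cvgy0 (f : R -> R) (C : R) :
  (forall x, `|f x| <= C * (1 + x ^+ 2)^-1) -> f x @[x --> +oo%R] --> (0 : R).
Proof.
move=> fC; apply/cvgrPdist_le => e e0.
have C0 : 0 <= C.
  by have := fC 0; rewrite expr0n addr0 invr1 mulr1; exact: le_trans.
exists (C / e + 1); split; first exact: num_real.
move=> x hx; rewrite sub0r normrN (le_trans (fC x))// ler_pdivrMr ?oneDsqr_gt0//.
have x1 : 1 <= x by rewrite (le_trans _ (ltW hx))// lerDr divr_ge0// ltW.
have : C <= e * x by rewrite mulrC -ler_pdivrMr// (le_trans _ (ltW hx))// lerDl.
move/le_trans; apply; rewrite ler_pM2l// (le_trans (_ : x <= x ^+ 2))//.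
  by rewrite expr2 ler_peMl// (le_trans _ x1).
by rewrite lerDr.
Qed.

(** The fundamental theorem on a half-line asks for a nonnegative integrand, so C / (1 + x^2) is
    added to [df] and C atan to [f]. The total is C pi whatever [f] is, and comparison with the zero
    function gives the result. *)
Lemma Rintegral_deriv0 (f df : R -> R) :
  (forall x : R, is_derive x (1 : R) f (df x)) ->
  (exists C, forall x, `|f x| <= C * (1 + x ^+ 2)^-1) ->
  dom1 df -> \int[mu]_x df x = 0.
Proof.
move=> fdf [C0 fC0] ddf; have [cdf [C1 dfC1]] := ddf.
pose C := Num.max C0 C1.
have w0 x : 0 <= (1 + x ^+ 2)^-1 :> R by rewrite invr_ge0 ltW// oneDsqr_gt0.
have fC x : `|f x| <= C * (1 + x ^+ 2)^-1.
  by rewrite (le_trans (fC0 x))// ler_wpM2r// le_max lexx.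
have dfC x : `|df x| <= C * (1 + x ^+ 2)^-1.
  by rewrite (le_trans (dfC1 x))// ler_wpM2r// le_max lexx orbT.
have half (g dg : R -> R) : (forall x : R, is_derive x (1 : R) g (dg x)) -> continuous dg ->
    (forall x, `|g x| <= C * (1 + x ^+ 2)^-1) ->
    (forall x, `|dg x| <= C * (1 + x ^+ 2)^-1) ->
    (\int[mu]_(x in `[0%R, +oo[) (dg x + C * (1 + x ^+ 2)^-1)%:E =
     (C * (pi / 2))%:E - (g 0)%:E)%E.
  move=> gdg cdg gC dgC.
  have F0 : g 0 = g 0 + C * atan 0 by rewrite atan0 mulr0 addr0.
  have FD (x : R) : is_derive x (1 : R) (fun y => g y + C * atan y) (dg x + C * (1 + x ^+ 2)^-1).
    by apply: is_deriveD.
  have cF : continuous (fun y => g y + C * atan y).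
    move=> x; apply: differentiable_continuous; apply/derivable1_diffP.
    by case: (FD x).
  rewrite [in RHS]F0; apply: (@ge0_continuous_FTC2y _ _ (fun y => g y + C * atan y)).
  - by move=> x _; have := dgC x; rewrite ler_norml -subr_ge0 opprK => /andP[].
  - apply: continuous_subspaceT => x; apply: cvgD; first exact: cdg.
    by apply: cvgM; [exact: cvg_cst|exact: continuous_oneDsqrV'].
  - rewrite -[X in _ --> X]add0r; apply: cvgD; first exact: dominated_cvgy0 gC.
    by apply: cvgM; [exact: cvg_cst|exact: cvgy_atan].
  - by move=> x _; case: (FD x).
  - by apply: cvg_at_right_filter; exact: cF.
  - by move=> x _; rewrite derive1E derive_val.
have cs (g : R -> R) : continuous g -> continuous (fun x => g x + C * (1 + x ^+ 2)^-1).
  move=> cg x; apply: cvgD; first exact: cg.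
  by apply: cvgM; [exact: cvg_cst|exact: continuous_oneDsqrV'].
have full (g dg : R -> R) : (forall x : R, is_derive x (1 : R) g (dg x)) -> continuous dg ->
    (forall x, `|g x| <= C * (1 + x ^+ 2)^-1) ->
    (forall x, `|dg x| <= C * (1 + x ^+ 2)^-1) ->
    \int[mu]_x (dg x + C * (1 + x ^+ 2)^-1) = C * pi.
  move=> gdg cdg gC dgC; rewrite /Rintegral integral_split0; last 2 first.
  - exact: cs.
  - by move=> x; have := dgC x; rewrite ler_norml -subr_ge0 opprK => /andP[].
  rewrite (half g)//.
  under [X in (_ + X)%E]eq_integral do rewrite sqrrN.
  (* The negative half-line is the positive one for - g (- x); the two boundary values at 0
     cancel. *)
  have hD (x : R) : is_derive x (1 : R) (fun x : R => - g (- x)) (dg (- x)).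
    rewrite -[dg (- x)]opprK; apply: is_deriveN.
    have -> : - dg (- x) = dg (- x) * -1 by rewrite mulrN1.
    exact: (@is_derive1_comp _ g (fun x : R => - x)).
  rewrite (half (fun x : R => - g (- x)) (fun x : R => dg (- x)) hD) /=; last 3 first.
  - by move=> x; apply: continuous_comp; [exact: opp_continuous|exact: cdg].
  - by move=> x; rewrite normrN -(sqrrN x).
  - by move=> x; rewrite -(sqrrN x).
  by rewrite oppr0; field.
have d1w : dom1 (fun x => C * (1 + x ^+ 2)^-1).
  split; last by exists `|C| => x; rewrite normrM [X in _ * X]ger0_norm.
  by move=> x; apply: cvgM; [exact: cvg_cst|exact: continuous_oneDsqrV'].
have := full f df fdf cdf fC dfC.
rewrite RintegralD//; try exact: integrable_dom1.
(* The zero function evaluates the integral of C / (1 + x^2) alone. *)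
have := full (cst 0) (cst 0).
rewrite /cst normr0; under eq_Rintegral do rewrite add0r.
have C0' : 0 <= C.
  by have := fC 0; rewrite expr0n addr0 invr1 mulr1; exact: le_trans.
move=> -> //; last 3 first.
- exact: cst_continuous.
- by move=> x; rewrite mulr_ge0.
- by move=> x; rewrite mulr_ge0.
by move/(canRL (addrK _)); rewrite subrr.
Qed.

End integral_derivative.

(** * Dominated functions and their integrals over R^n *)

Section euclidean_integral.
Context (R : realType).
Local Notation mu := (@lebesgue_measure R).
Local Notation leb n := (lebesgue_tuple R n).

Definition Wt n (x : 'cV[R]_n) : R := \prod_i (1 + x i 0 ^+ 2)^-1.

(* Domination by Wt, a product of integrable functions of one variable, takes
   the place of integrability: it is inherited by the sections of f. *)
Definition dom n (f : 'cV[R]_n -> R) :=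
  continuous f /\ exists C, forall x, `|f x| <= C * Wt x.

Definition J n (f : 'cV[R]_n -> R) : R := \int[leb n]_y f (vec y).

Definition consv n (a : R) (v : 'cV[R]_n) : 'cV[R]_n.+1 :=
  \col_i (if unlift ord0 i is Some j then v j 0 else a).

Lemma consv0 n a (v : 'cV[R]_n) : consv a v ord0 0 = a.
Proof. by rewrite mxE unlift_none. Qed.

Lemma consvS n a (v : 'cV[R]_n) j : consv a v (lift ord0 j) 0 = v j 0.
Proof. by rewrite mxE liftK. Qed.

Lemma vec_cons n (a : R) (y : n.-tuple (measurableTypeR R)) :
  vec (tuple_cons (a, y)) = consv a (vec y).
Proof.
apply/colP => i; rewrite !mxE; case: unliftP => [j ->|->] //=.
by rewrite tnthS mxE.
Qed.

Lemma Wt_cons n a (v : 'cV[R]_n) : Wt (consv a v) = (1 + a ^+ 2)^-1 * Wt v.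
Proof.
rewrite /Wt big_ord_recl consv0; congr (_ * _).
by apply: eq_bigr => i _; rewrite consvS.
Qed.

Lemma Wt_gt0 n (v : 'cV[R]_n) : 0 < Wt v.
Proof. by apply: prodr_gt0 => i _; rewrite invr_gt0 oneDsqr_gt0. Qed.

Lemma Wt_le1 n (v : 'cV[R]_n) : Wt v <= 1.
Proof.
apply: (@prodr_ile1 R) => i; rewrite invr_ge0 ltW ?oneDsqr_gt0//=.
by rewrite invf_le1 ?oneDsqr_gt0// lerDl sqr_ge0.
Qed.

Lemma WtN n (v : 'cV[R]_n) : Wt (- v) = Wt v.
Proof. by apply: eq_bigr => i _; rewrite mxE sqrrN. Qed.

Lemma continuous_coord n (i : 'I_n) : continuous (fun x : 'cV[R]_n => x i 0).
Proof. exact: coord_continuous. Qed.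

Lemma continuous_compT (X Y Z : topologicalType) (f : X -> Y) (g : Y -> Z) :
  continuous f -> continuous g -> continuous (fun x => g (f x)).
Proof. by move=> cf cg x; apply: continuous_comp; [exact: cf|exact: cg]. Qed.

Lemma continuousTD (X : topologicalType) (f g : X -> R) :
  continuous f -> continuous g -> continuous (fun x => f x + g x).
Proof. by move=> cf cg x; apply: (@continuousD _ _ _ f g); [exact: cf|exact: cg]. Qed.

Lemma continuousTM (X : topologicalType) (f g : X -> R) :
  continuous f -> continuous g -> continuous (fun x => f x * g x).
Proof. by move=> cf cg x; apply: (@continuousM _ _ f g); [exact: cf|exact: cg]. Qed.

Lemma continuousTZ (X : topologicalType) (c : R) (f : X -> R) :
  continuous f -> continuous (fun x => c * f x).
Proof. by move=> cf; apply: continuousTM => //; exact: cst_continuous. Qed.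

Lemma continuous_prod (X : topologicalType) (I : Type) (r : seq I) (f : I -> X -> R) :
  (forall i, continuous (f i)) -> continuous (fun x => \prod_(i <- r) f i x).
Proof.
move=> cf; elim: r => [|i r IH].
  by under eq_fun do rewrite big_nil; exact: cst_continuous.
by under eq_fun do rewrite big_cons; move=> x; apply: cvgM; [exact: cf|exact: IH].
Qed.

Lemma continuous_sum (X : topologicalType) (I : Type) (r : seq I) (f : I -> X -> R) :
  (forall i, continuous (f i)) -> continuous (fun x => \sum_(i <- r) f i x).
Proof.
move=> cf; elim: r => [|i r IH].
  by under eq_fun do rewrite big_nil; exact: cst_continuous.
by under eq_fun do rewrite big_cons; move=> x; apply: cvgD; [exact: cf|exact: IH].
Qed.

Lemma continuous_Wt n : continuous (@Wt n).
Proof.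
apply: continuous_prod => i.
apply: (@continuous_compT _ _ _ (fun y : 'cV[R]_n => y i 0) (fun t : R => (1 + t ^+ 2)^-1)).
  exact: continuous_coord.
exact: continuous_oneDsqrV'.
Qed.

Lemma continuous_consvl n (v : 'cV[R]_n) : continuous (fun a => consv a v).
Proof.
apply: continuous_cV => i; case: (unliftP ord0 i) => [j ->|->] x.
- under [X in continuous_at _ X]eq_fun do rewrite consvS.
  exact: cst_continuous.
- by under [X in continuous_at _ X]eq_fun do rewrite consv0; exact: cvg_id.
Qed.

Lemma continuous_consvr n (a : R) : continuous (@consv n a).
Proof.
apply: continuous_cV => i; case: (unliftP ord0 i) => [j ->|->] x.
- under [X in continuous_at _ X]eq_fun do rewrite consvS.
  exact: continuous_coord.
- by under [X in continuous_at _ X]eq_fun do rewrite consv0; exact: cst_continuous.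
Qed.

Lemma measurable_vec n (f : 'cV[R]_n -> R) : continuous f ->
  measurable_fun [set: n.-tuple (measurableTypeR R)] (fun y => f (vec y)).
Proof.
move=> cf; apply: (measurable_cV (phi := @vec R n)) => // i.
by under eq_fun do rewrite mxE; exact: measurable_tnth.
Qed.

Lemma measurable_consv n (f : 'cV[R]_n.+1 -> R) : continuous f ->
  measurable_fun [set: measurableTypeR R * n.-tuple (measurableTypeR R)]
    (fun p => f (consv p.1 (vec p.2))).
Proof.
move=> cf; apply: (measurable_cV (phi := fun p : measurableTypeR R * n.-tuple (measurableTypeR R) => consv p.1 (vec p.2))) => // i.
case: (unliftP ord0 i) => [j ->|->].
- under eq_fun do rewrite consvS mxE.
  exact: (measurableT_comp (measurable_tnth j) measurable_snd).
- by under eq_fun do rewrite consv0; exact: measurable_fst.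
Qed.

Lemma ge0_integral_cons n (F : n.+1.-tuple (measurableTypeR R) -> \bar R) :
  measurable_fun [set: n.+1.-tuple (measurableTypeR R)] F ->
  (forall y, 0 <= F y)%E ->
  (\int[leb n.+1]_y F y = \int[mu]_a \int[leb n]_y F (tuple_cons (a, y)))%E.
Proof.
move=> mF F0.
have mc := @measurable_tuple_cons R n.
rewrite [LHS](ge0_integral_pushforward mc)//.
rewrite preimage_setT fubini_tonelli1//.
  exact: measurableT_comp.
by move=> p; exact: F0.
Qed.

Lemma integral_leb0 (F : 0.-tuple (measurableTypeR R) -> \bar R) :
  measurable_fun [set: 0.-tuple (measurableTypeR R)] F ->
  (\int[leb 0]_y F y = F [tuple])%E.
Proof.
move=> mF; rewrite [LHS](@integral_dirac _ _ [tuple] R setT measurableT _ mF).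
by rewrite diracT mul1e.
Qed.

Lemma integrable_Wt n : (leb n).-integrable setT (fun y => (Wt (vec y))%:E).
Proof.
elim: n => [|n IHn].
  apply/integrableP; split; first by apply/measurable_EFinP; exact: measurable_vec (@continuous_Wt 0).
  rewrite integral_leb0 ?ltry//; apply: measurableT_comp => //.
  by apply/measurable_EFinP; exact: measurable_vec (@continuous_Wt 0).
have mW : measurable_fun [set: n.+1.-tuple (measurableTypeR R)] (fun y => (Wt (vec y))%:E).
  by apply/measurable_EFinP; exact: measurable_vec (@continuous_Wt n.+1).
apply/integrableP; split => //.
rewrite ge0_integral_cons//; last exact: measurableT_comp.
have /integrableP[_ IH] := IHn.
have /integrableP[_ I1] := integrable_oneDsqrV R.
under eq_integral.
  move=> a _; under eq_integral do rewrite vec_cons Wt_cons EFinM abseM.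
  rewrite ge0_integralZl//; last first.
    by apply: measurableT_comp => //; apply/measurable_EFinP; exact: measurable_vec (@continuous_Wt n).
  over.
rewrite /= ge0_integralZr//.
- rewrite lte_mul_pinfty//; first exact: integral_ge0.
  by rewrite ge0_fin_numE ?integral_ge0.
- apply/measurable_EFinP; apply: continuous_measurable_fun => x.
  by apply: cvg_norm; exact: continuous_oneDsqrV'.
- exact: integral_ge0.
Qed.

Lemma integrable_dom n f : @dom n f -> (leb n).-integrable setT (fun y => (f (vec y))%:E).
Proof.
move=> [cf [C fC]].
apply: (@integrable_le _ _ R (leb n) (fun y => f (vec y)) (fun y => C * Wt (vec y))).
- exact: measurable_vec.
- exact: (integrableZl measurableT C (integrable_Wt n)).
- by [].
Qed.

Lemma domD n (f g : 'cV[R]_n -> R) : dom f -> dom g -> dom (fun x => f x + g x).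
Proof.
move=> [cf [C fC]] [cg [D gD]]; split.
  exact: continuousTD.
exists (C + D) => x; rewrite mulrDl (le_trans (ler_normD _ _))//.
exact: lerD.
Qed.

Lemma domZ n (c : R) (f : 'cV[R]_n -> R) : dom f -> dom (fun x => c * f x).
Proof.
move=> [cf [C fC]]; split.
  exact: continuousTZ.
by exists (`|c| * C) => x; rewrite normrM -mulrA ler_wpM2l.
Qed.

Lemma domN n (f : 'cV[R]_n -> R) : dom f -> dom (fun x => - f x).
Proof. by move=> /(domZ (-1)); under eq_fun do rewrite mulN1r. Qed.

Lemma dom_sum n (I : Type) (r : seq I) (f : I -> 'cV[R]_n -> R) :
  (forall i, dom (f i)) -> dom (fun x => \sum_(i <- r) f i x).
Proof.
move=> df; elim: r => [|i r IH].
  under eq_fun do rewrite big_nil.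
  by split; [exact: cst_continuous|exists 0 => x; rewrite normr0 mul0r].
by under eq_fun do rewrite big_cons; exact: domD.
Qed.

Lemma dom_le n (f g : 'cV[R]_n -> R) : continuous f -> dom g ->
  (forall x, `|f x| <= g x) -> dom f.
Proof.
move=> cf [_ [C gC]] fg; split => //; exists C => x.
by rewrite (le_trans (fg x))// (le_trans (ler_norm _)).
Qed.

Lemma domM n (b f : 'cV[R]_n -> R) C : continuous b -> (forall x, `|b x| <= C) ->
  dom f -> dom (fun x => b x * f x).
Proof.
move=> cb bC [cf [D fD]]; split.
  exact: continuousTM.
exists (C * D) => x; rewrite normrM -mulrA ler_pM//.
Qed.

Lemma dom_Wt n : dom (@Wt n).
Proof.
split; first exact: continuous_Wt.
by exists 1 => x; rewrite mul1r ger0_norm// ltW// Wt_gt0.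
Qed.

Lemma dom_norm n (f : 'cV[R]_n -> R) : dom f -> dom (fun x => `|f x|).
Proof.
move=> [cf [C fC]]; split; last by exists C => x; rewrite normr_id.
exact: (continuous_compT cf (@norm_continuous _ _)).
Qed.

Lemma domVN n (f : 'cV[R]_n -> R) : dom f -> dom (fun x => f (- x)).
Proof.
move=> [cf [C fC]]; split; last by exists C => x; rewrite -WtN.
apply: (@continuous_compT _ _ _ (fun x : 'cV[R]_n => - x) f) => //.
exact: opp_continuous.
Qed.

Lemma JD n (f g : 'cV[R]_n -> R) : dom f -> dom g ->
  J (fun x => f x + g x) = J f + J g.
Proof. by move=> df dg; apply: RintegralD => //; exact: integrable_dom. Qed.

Lemma JZ n (c : R) (f : 'cV[R]_n -> R) : dom f -> J (fun x => c * f x) = c * J f.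
Proof. by move=> df; apply: RintegralZl => //; exact: integrable_dom. Qed.

Lemma JN n (f : 'cV[R]_n -> R) : dom f -> J (fun x => - f x) = - J f.
Proof. by move=> /(JZ (-1)); rewrite mulN1r => <-; congr J; apply/funext => x; rewrite mulN1r. Qed.

Lemma JB n (f g : 'cV[R]_n -> R) : dom f -> dom g ->
  J (fun x => f x - g x) = J f - J g.
Proof. by move=> df dg; rewrite JD ?JN//; exact: domN. Qed.

Lemma J_le n (f g : 'cV[R]_n -> R) : dom f -> dom g -> (forall x, f x <= g x) ->
  J f <= J g.
Proof. by move=> df dg fg; apply: le_Rintegral => //; exact: integrable_dom. Qed.

Lemma J_ge0 n (f : 'cV[R]_n -> R) : (forall x, 0 <= f x) -> 0 <= J f.
Proof. by move=> f0; apply: Rintegral_ge0. Qed.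

Lemma J_norm n (f : 'cV[R]_n -> R) : dom f -> `|J f| <= J (fun x => `|f x|).
Proof. by move=> df; apply: le_normr_Rintegral => //; exact: integrable_dom. Qed.

Lemma J_sum n (I : Type) (r : seq I) (f : I -> 'cV[R]_n -> R) :
  (forall i, dom (f i)) -> J (fun x => \sum_(i <- r) f i x) = \sum_(i <- r) J (f i).
Proof.
move=> df; elim: r => [|i r IH].
  rewrite big_nil /J; under eq_Rintegral do rewrite big_nil.
  by rewrite /Rintegral integral0.
by rewrite big_cons -IH -JD//; [congr J; apply/funext => x; rewrite big_cons|exact: dom_sum].
Qed.

Lemma EFin_J n (f : 'cV[R]_n -> R) : dom f ->
  (J f)%:E = (\int[leb n]_y (f (vec y))%:E)%E.
Proof.
move=> df; rewrite /J /Rintegral fineK//.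
exact: integrable_fin_num (integrable_dom df).
Qed.

End euclidean_integral.

Section derivative_along.
Context (R : realType).

(** A directional derivative sees [f] on one line only, so [phi] needs to be affine along that line
    only. Slices, translations and reflections are all instances, with no total
    differentiability. *)
Lemma is_derive_affine (U V : normedModType R) (phi : U -> V) (f : V -> R)
    (y w : U) (v : V) (d : R) :
  (forall h : R, phi (h *: w + y) = h *: v + phi y) ->
  is_derive (phi y) v f d -> is_derive y w (fun x => f (phi x)) d.
Proof.
move=> E [df fd].
have H : (fun h : R => h^-1 *: (((fun x => f (phi x)) \o shift y) (h *: w) - f (phi y))) =
         (fun h : R => h^-1 *: ((f \o shift (phi y)) (h *: v) - f (phi y))).
  by apply/funext => h /=; rewrite E.
have df' : derivable (fun x => f (phi x)) y w.
  by rewrite /derivable; move: df; rewrite /derivable; under eq_fun do rewrite /= -E.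
by split => //; rewrite -fd /derive H.
Qed.

End derivative_along.

Section euclidean_fubini.
Context (R : realType).
Local Notation mu := (@lebesgue_measure R).
Local Notation leb n := (lebesgue_tuple R n).
Local Notation T := (measurableTypeR R).

Lemma dom_consr n (f : 'cV[R]_n.+1 -> R) (a : R) :
  dom f -> dom (fun v => f (consv a v)).
Proof.
move=> [cf [C fC]]; split; first exact: (continuous_compT (@continuous_consvr R n a) cf).
exists (C * (1 + a ^+ 2)^-1) => v; by rewrite -mulrA -Wt_cons.
Qed.

Lemma dom_consl n (f : 'cV[R]_n.+1 -> R) (v : 'cV[R]_n) :
  dom f -> dom1 (fun a => f (consv a v)).
Proof.
move=> [cf [C fC]]; split; first exact: (continuous_compT (@continuous_consvl R n v) cf).
by exists (C * Wt v) => a; rewrite -mulrA [_ * (_)^-1]mulrC -Wt_cons.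
Qed.

Lemma integrable_cons n (f : 'cV[R]_n.+1 -> R) : dom f ->
  (mu \x leb n)%E.-integrable [set: T * n.-tuple T]
    (fun p => (f (consv p.1 (vec p.2)))%:E).
Proof.
move=> [cf [C fC]].
apply: (@integrable_prod_dominated _ _ _ _ R mu (leb n) (fun p => f (consv p.1 (vec p.2)))
  (fun a : R => C * (1 + a ^+ 2)^-1) (fun y => Wt (vec y))).
- exact: measurable_consv.
- exact: (integrableZl measurableT C (integrable_oneDsqrV R)).
- exact: integrable_Wt.
- by move=> a y; rewrite -mulrA -Wt_cons.
Qed.

Lemma J_cons_prod n (f : 'cV[R]_n.+1 -> R) : dom f ->
  J f = \int[(mu \x leb n)%E]_p f (consv p.1 (vec p.2)).
Proof.
move=> df; have [cf _] := df.
have mc := @measurable_tuple_cons R n.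
have E : (fun p => (f (consv p.1 (vec p.2)))%:E) =
         (fun y => (f (vec y))%:E) \o @tuple_cons R n.
  by apply/funext => -[a y] /=; rewrite vec_cons.
rewrite /J /Rintegral; congr fine.
rewrite [LHS](integral_pushforward mc)//.
- by rewrite preimage_setT E.
- by apply/measurable_EFinP; exact: measurable_vec.
- by rewrite preimage_setT -E; exact: integrable_cons.
Qed.

Lemma J_cons n (f : 'cV[R]_n.+1 -> R) : dom f ->
  J f = \int[mu]_a J (fun v => f (consv a v)).
Proof.
move=> df; rewrite J_cons_prod//.
rewrite (Rintegral12_prod (k := fun p : T * n.-tuple T => f (consv p.1 (vec p.2))))//.
- exact: integrable_cons.
- by move=> a; exact: (integrable_dom (dom_consr a df)).
Qed.

Lemma J_snoc n (f : 'cV[R]_n.+1 -> R) : dom f ->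
  J f = \int[leb n]_y \int[mu]_a f (consv a (vec y)).
Proof.
move=> df; rewrite J_cons_prod//.
rewrite (Rintegral21_prod (k := fun p : T * n.-tuple T => f (consv p.1 (vec p.2))))//.
- exact: integrable_cons.
- by move=> y; exact: (integrable_dom1 (dom_consl (vec y) df)).
Qed.

Lemma Rintegral_eq0 d (X : measurableType d) (m : {measure set X -> \bar R}) (f : X -> R) :
  (forall x, f x = 0) -> \int[m]_x f x = 0.
Proof.
move=> f0; under eq_Rintegral do rewrite f0.
by rewrite /Rintegral integral0.
Qed.

Lemma consv_affine0 n (a h : R) (v : 'cV[R]_n) :
  consv (h *: (1 : R) + a) v = h *: delta_mx ord0 0 + consv a v.
Proof.
apply/colP => i; rewrite !mxE; case: unliftP => [j ->|->] /=.
  by rewrite mulr0 add0r.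
by [].
Qed.

Lemma consv_affineS n (a h : R) (v : 'cV[R]_n) j :
  consv a (h *: delta_mx j 0 + v) = h *: delta_mx (lift ord0 j) 0 + consv a v.
Proof.
apply/colP => i; rewrite !mxE; case: unliftP => [k ->|->] /=.
  by rewrite !mxE (inj_eq lift_inj).
by rewrite mulr0 add0r.
Qed.

(** Coordinates before i are peeled off as outer integrals; once i comes first, Fubini in the other
    order makes it the inner variable, where the statement on the line applies. *)
Lemma J_deriv0 n (i : 'I_n) (f df : 'cV[R]_n -> R) :
  (forall x, is_derive x (delta_mx i 0) f (df x)) -> dom f -> dom df -> J df = 0.
Proof.
elim: n i f df => [|n IHn] i f df fdf domf domdf; first by case: i {fdf}.
case: (unliftP ord0 i) fdf => [j ->|->] fdf.
- rewrite J_cons//; apply: Rintegral_eq0 => a.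
  apply: (IHn j (fun v => f (consv a v))); try exact: dom_consr.
  move=> v; apply: (is_derive_affine (phi := consv a) (v := delta_mx (lift ord0 j) 0)) => //.
  by move=> h; exact: consv_affineS.
- rewrite J_snoc//; apply: Rintegral_eq0 => y.
  apply: (@Rintegral_deriv0 _ (fun a => f (consv a (vec y)))).
  + move=> a; apply: (is_derive_affine (phi := fun a => consv a (vec y)) (v := delta_mx ord0 0)) => //.
    by move=> h; exact: consv_affine0.
  + by have [] := dom_consl (vec y) domf.
  + exact: dom_consl.
Qed.

Lemma consvN n (a : R) (v : 'cV[R]_n) : consv (- a) (- v) = - consv a v.
Proof. by apply/colP => i; rewrite !mxE; case: unliftP => [j _|_] //=; rewrite mxE. Qed.

Lemma JVN n (f : 'cV[R]_n -> R) : dom f -> J (fun x => f (- x)) = J f.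
Proof.
elim: n f => [|n IHn] f df.
  by congr J; apply/funext => x; congr f; apply/colP => -[].
(* [g] reflects the first coordinate of [f] only; the other coordinates are reflected by induction
   on the slices of [g]. *)
pose g (x : 'cV[R]_n.+1) := f (consv (- x ord0 0) (\col_i x (lift ord0 i) 0)).
have gE a v : g (consv a v) = f (consv (- a) v).
  by rewrite /g consv0; congr (f (consv _ _)); apply/colP => i; rewrite mxE consvS.
have dg : dom g.
  have [cf [C fC]] := df; split; last first.
    exists C => x; rewrite (le_trans (fC _))// Wt_cons sqrrN /Wt [in leRHS]big_ord_recl.
    by under eq_bigr do rewrite mxE.
  apply: (@continuous_compT _ _ _ (fun x : 'cV[R]_n.+1 => consv (- x ord0 0) (\col_i x (lift ord0 i) 0)) f) => //.
  apply: continuous_cV => i; case: (unliftP ord0 i) => [j ->|->].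
    by under eq_fun do rewrite consvS mxE; exact: continuous_coord.
  under eq_fun do rewrite consv0 -mulN1r.
  by apply: continuousTZ; exact: continuous_coord.
transitivity (J g).
  rewrite (J_cons (domVN df)) (J_cons dg); apply: eq_Rintegral => a _.
  rewrite -(IHn (fun v => g (consv a v))); last exact: dom_consr.
  by congr J; apply/funext => v; rewrite gE -consvN.
rewrite (J_snoc dg) (J_snoc df); apply: eq_Rintegral => y _.
under eq_Rintegral do rewrite gE.
by rewrite (RintegralN (f := fun a => f (consv a (vec y))))//; exact: dom_consl.
Qed.

Lemma J_fubini m n (k : 'cV[R]_m -> 'cV[R]_n -> R) (f : 'cV[R]_m -> R) (g : 'cV[R]_n -> R) :
  dom f -> dom g -> (forall x y, `|k x y| <= f x * g y) ->
  (forall x, continuous (k x)) -> (forall y, continuous (k ^~ y)) ->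
  measurable_fun [set: m.-tuple T * n.-tuple T] (fun p => k (vec p.1) (vec p.2)) ->
  J (fun x => J (k x)) = J (fun y => J (k ^~ y)).
Proof.
move=> df dg kfg ck1 ck2 mk.
have ik : (leb m \x leb n)%E.-integrable [set: m.-tuple T * n.-tuple T]
    (fun p => (k (vec p.1) (vec p.2))%:E).
  apply: (@integrable_prod_dominated _ _ _ _ R (leb m) (leb n) (fun p => k (vec p.1) (vec p.2))
    (fun x => f (vec x)) (fun y => g (vec y))) => //; exact: integrable_dom.
have d1 x : dom (k x) by apply: (dom_le (g := fun y => f x * g y)) => //; exact: domZ.
have d2 y : dom (k ^~ y).
  by apply: (dom_le (g := fun x => g y * f x)) => // [|x]; [exact: domZ|rewrite mulrC].
rewrite /J -(Rintegral12_prod (k := fun p : m.-tuple T * n.-tuple T => k (vec p.1) (vec p.2)))//.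
  by rewrite (Rintegral21_prod ik)// => y; exact: (integrable_dom (d2 (vec y))).
by move=> x; exact: (integrable_dom (d1 (vec x))).
Qed.

End euclidean_fubini.

(** * Mean value estimates and derivatives from quadratic remainders *)

Section mean_value.
Context (R : realType).

Lemma norm_mean_value (f df : R -> R) (M : R) :
  (forall x : R, is_derive x (1 : R) f (df x)) -> (forall x, `|df x| <= M) ->
  forall a b, `|f b - f a| <= M * `|b - a|.
Proof.
move=> fdf dfM.
have cf : continuous f.
  move=> x; apply: differentiable_continuous; apply/derivable1_diffP.
  by case: (fdf x).
suff H a b : a <= b -> `|f b - f a| <= M * `|b - a|.
  move=> a b; have [/H//|/ltW/H] := leP a b.
  by rewrite distrC [`|a - b|]distrC.
move=> ab.
have [c _ ->] := MVT_segment ab (fun x _ => fdf x) (continuous_subspaceT cf).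
by rewrite normrM ler_wpM2r.
Qed.

(** The mean value theorem, applied to f (x + a) - x df (a) and then to [df], gives the constant M
    in place of M / 2, which is all that the quadratic criterion below asks for. *)
Lemma taylor2 (f df ddf : R -> R) (M : R) :
  (forall x : R, is_derive x (1 : R) f (df x)) ->
  (forall x : R, is_derive x (1 : R) df (ddf x)) ->
  (forall x, `|ddf x| <= M) ->
  forall a h, `|f (h + a) - f a - h * df a| <= M * h ^+ 2.
Proof.
move=> fdf dfddf ddfM a h.
pose g x := f (x + a) - x * df a.
have gd (x : R) : is_derive x (1 : R) g (df (x + a) - df a).
  apply: is_deriveB; last first.
    rewrite [X in is_derive _ _ _ X](_ : _ = df a *: (1 : R)); last by rewrite /GRing.scale /= mulr1.
    have -> : (fun x => x * df a) = df a \*: id by apply/funext => y; rewrite /= mulrC.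
    exact: is_deriveZ.
  apply: (is_derive_affine (phi := fun x => x + a) (v := 1 : R)) => // k.
  by rewrite addrA.
have M0 : 0 <= M by exact: le_trans (ddfM 0).
have E : f (h + a) - f a - h * df a = g h - g 0.
  by rewrite /g add0r mul0r subr0; ring.
rewrite E.
pose b := `|h|.
suff H x : `|x| <= b -> `|df (x + a) - df a| <= M * b.
  have cg : continuous g.
    move=> x; apply: differentiable_continuous; apply/derivable1_diffP.
    by case: (gd x).
  have h2 : h ^+ 2 = b * `|h| by rewrite -expr2 real_normK// num_real.
  rewrite h2 mulrA.
  have [h0|/ltW h0] := leP 0 h.
    have [c] := MVT_segment h0 (fun x _ => gd x) (continuous_subspaceT cg).
    rewrite in_itv/= => /andP[c0 ch] ->.
    rewrite normrM subr0 ler_wpM2r// H// ger0_norm//.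
    by rewrite (le_trans ch)// ler_norm.
  have [c] := MVT_segment h0 (fun x _ => gd x) (continuous_subspaceT cg).
  rewrite in_itv/= distrC => /andP[hc c0] ->.
  rewrite normrM sub0r normrN ler_wpM2r// H// ler0_norm//.
  by rewrite /b ler0_norm// lerN2.
move=> xb; rewrite (le_trans (norm_mean_value dfddf ddfM a (x + a)))//.
by rewrite addrK ler_wpM2l.
Qed.

(** This criterion takes the place of differentiation under the integral sign: a pointwise Taylor
    bound is integrated, and the result certifies the derivative of the integral. *)
Lemma is_derive_quadratic (V : normedModType R) (f : V -> R) (x v : V) (d C : R) :
  (forall h : R, `|f (h *: v + x) - f x - h * d| <= C * h ^+ 2) ->
  is_derive x v f d.
Proof.
move=> H.
have C0 : 0 <= C by have := le_trans (normr_ge0 _) (H 1); rewrite expr1n mulr1.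
have cv : h^-1 *: ((f \o shift x) (h *: v) - f x) @[h --> (0 : R)^'] --> d.
  apply/cvgrPdist_le => e e0.
  near=> h.
  have h0 : h != 0 by near: h; exact: nbhs_dnbhs_neq.
  rewrite /=.
  have -> : d - h^-1 *: (f (h *: v + x) - f x) = - (h^-1 * (f (h *: v + x) - f x - h * d)).
    by rewrite /GRing.scale /=; field.
  rewrite normrN normrM normfV ler_pdivrMl ?normr_gt0//.
  rewrite (le_trans (H h))// -[h ^+ 2]real_normK ?num_real// expr2 mulrA.
  rewrite [_ * e]mulrC ler_wpM2r//.
  have : (C + 1) * `|h| <= e.
    rewrite mulrC -ler_pdivlMr ?ltr_pwDr//.
    near: h; apply: nbhs_dnbhs; exists (e / (C + 1)); first by rewrite /= divr_gt0// ltr_pwDr.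
    by move=> y /=; rewrite sub0r normrN => /ltW.
  by apply: le_trans; rewrite ler_wpM2r// lerDl.
split; first by apply/cvg_ex; exists d.
exact: cvg_lim.
Unshelve. all: by end_near. Qed.

End mean_value.

Section coordinates.
Context (R : realType) (n : nat).
Implicit Types (x y : 'cV[R]_n) (f : 'cV[R]_n -> R).
Local Notation e i := (delta_mx i 0 : 'cV[R]_n).

Lemma cV_delta x : x = \sum_i x i 0 *: e i.
Proof.
apply/colP => k; rewrite summxE (bigD1 k)//= !mxE !eqxx mulr1 big1 ?addr0// => i ik.
by rewrite !mxE eq_sym (negbTE ik) mulr0.
Qed.

Lemma line_derive f (df : 'cV[R]_n -> R) i x :
  (forall x, is_derive x (e i) f (df x)) ->
  forall t : R, is_derive t (1 : R) (fun s : R => f (s *: e i + x)) (df (t *: e i + x)).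
Proof.
move=> fdf t; apply: (is_derive_affine (phi := fun s : R => s *: e i + x) (v := e i)) => // h.
by rewrite scalerDl addrA /GRing.scale /= mulr1.
Qed.

(** Passing from x to y one coordinate at a time uses partial derivatives only. With M = 0 it says
    that a function with vanishing partial derivatives is constant. *)
Lemma coord_lipschitz f (df : 'I_n -> 'cV[R]_n -> R) M :
  (forall i x, is_derive x (e i) f (df i x)) -> (forall i x, `|df i x| <= M) ->
  forall x y, `|f y - f x| <= M * \sum_i `|y i 0 - x i 0|.
Proof.
move=> fdf dfM x y.
suff H (r : seq 'I_n) (h : 'I_n -> R) z :
    `|f (\sum_(i <- r) h i *: e i + z) - f z| <= M * \sum_(i <- r) `|h i|.
  have := H (index_enum 'I_n) (fun i => y i 0 - x i 0) x.
  have -> // : \sum_i (y i 0 - x i 0) *: e i + x = y.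
  under eq_bigr do rewrite scalerBl.
  by rewrite sumrB -!cV_delta subrK.
elim: r => [|i r IH]; first by rewrite !big_nil add0r subrr normr0 mulr0.
rewrite !big_cons mulrDr -addrA.
set w := \sum_(i <- r) _ + z.
have -> : f (h i *: e i + w) - f z = (f (h i *: e i + w) - f w) + (f w - f z) by ring.
rewrite (le_trans (ler_normD _ _))// lerD//.
have := norm_mean_value (line_derive w (fdf i)) (fun t => dfM i _) 0 (h i).
by rewrite scale0r add0r subr0.
Qed.

Lemma lipschitz_continuous (X : topologicalType) (F g : X -> R) (p : X) :
  (forall q, `|F q - F p| <= g q) -> g p = 0 -> {for p, continuous g} ->
  {for p, continuous F}.
Proof.
move=> H gp cg; apply/cvgrPdist_le => eps e0.
have /cvgrPdist_le /(_ _ e0) := cg.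
apply: filterS => q; rewrite gp sub0r normrN => gq.
by rewrite distrC (le_trans (H q))// (le_trans (ler_norm _)).
Qed.

Lemma dotvC x y : dotv x y = dotv y x.
Proof. by apply: eq_bigr => i _; rewrite mulrC. Qed.

Lemma dotvDl x y z : dotv (x + y) z = dotv x z + dotv y z.
Proof. by rewrite /dotv -big_split; apply: eq_bigr => i _; rewrite mxE mulrDl. Qed.

Lemma dotvZl c x z : dotv (c *: x) z = c * dotv x z.
Proof. by rewrite /dotv mulr_sumr; apply: eq_bigr => i _; rewrite mxE mulrA. Qed.

Lemma dotvNl x z : dotv (- x) z = - dotv x z.
Proof. by rewrite -scaleN1r dotvZl mulN1r. Qed.

Lemma dotvDr x y z : dotv z (x + y) = dotv z x + dotv z y.
Proof. by rewrite dotvC dotvDl !(dotvC z). Qed.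

Lemma dotvZr c x z : dotv z (c *: x) = c * dotv z x.
Proof. by rewrite dotvC dotvZl dotvC. Qed.

Lemma dotvNr x z : dotv z (- x) = - dotv z x.
Proof. by rewrite dotvC dotvNl dotvC. Qed.

Lemma dotv_delta i x : dotv (e i) x = x i 0.
Proof.
rewrite /dotv (bigD1 i)//= mxE !eqxx mul1r big1 ?addr0// => j ji.
by rewrite mxE (negbTE ji) mul0r.
Qed.

Lemma dotvv_ge0 x : 0 <= dotv x x.
Proof. by apply: sumr_ge0 => i _; rewrite -expr2 sqr_ge0. Qed.

Lemma continuous_dotvr x : continuous (dotv x).
Proof. by apply: continuous_sum => i; apply: continuousTZ; exact: continuous_coord. Qed.

Lemma continuous_dotvl x : continuous (fun y => dotv y x).
Proof. by under eq_fun do rewrite dotvC; exact: continuous_dotvr. Qed.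

End coordinates.

(** * Schwartz functions and the Hartley transform *)

Section derivative_reverse.
Context (R : realType).

Lemma is_derive_affine_inv (U V : normedModType R) (phi : U -> V) (f : V -> R)
    (y w : U) (v : V) (d : R) :
  (forall h : R, phi (h *: w + y) = h *: v + phi y) ->
  is_derive y w (fun x => f (phi x)) d -> is_derive (phi y) v f d.
Proof.
move=> E [df fd].
have H : (fun h : R => h^-1 *: (((fun x => f (phi x)) \o shift y) (h *: w) - f (phi y))) =
         (fun h : R => h^-1 *: ((f \o shift (phi y)) (h *: v) - f (phi y))).
  by apply/funext => h /=; rewrite E.
have df' : derivable f (phi y) v.
  by rewrite /derivable; move: df; rewrite /derivable H.
by split => //; rewrite -fd /derive H.
Qed.

Lemma is_derive_Nv (V : normedModType R) (f : V -> R) (x v : V) (d : R) :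
  is_derive x v f d -> is_derive x (- v) f (- d).
Proof.
move=> fd.
pose L (w : V) (s : R) := s *: w + x.
have E0 w : L w 0 = x by rewrite /L scale0r add0r.
have E w (h : R) : L w (h *: (1 : R) + 0) = h *: w + L w 0.
  by rewrite /L addr0 scale0r add0r /GRing.scale /= mulr1.
rewrite -(E0 (- v)); apply: (is_derive_affine_inv (phi := L (- v)) (w := (1 : R)) (E _)).
have H : is_derive (- 0 : R) (1 : R) (fun s : R => f (L v s)) d.
  by rewrite oppr0; apply: (is_derive_affine (v := v) (E v)); rewrite E0.
have := @is_derive1_comp _ (fun s : R => f (L v s)) (fun s : R => - s) 0 _ _ H (is_deriveNid _ _).
rewrite mulrN1.
have -> // : (fun s : R => f (L v s)) \o (fun s : R => - s) = (fun s => f (L (- v) s)).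
by apply/funext => s /=; rewrite /L scalerN scaleNr.
Qed.

End derivative_reverse.

(** * Schwartz families with a time parameter *)

Section schwartz_families.
Context (R : realType) (n : nat).
Local Notation V := 'cV[R]_n.
Local Notation e i := (delta_mx i 0 : V).
Implicit Types (f g : R -> V -> R) (C : (R -> V -> R) -> Prop).

Definition tderiv f : R -> V -> R := fun t x => 'D_1 (fun s => f s x) t.
Definition pderiv i f : R -> V -> R := fun t x => 'D_(e i) (f t) x.
Definition xmul i f : R -> V -> R := fun t x => x i 0 * f t x.

Definition bounded_family f := exists M, forall t x, `|f t x| <= M.

Definition sw_class C := forall f, C f ->
  [/\ bounded_family f,
      forall t x, derivable (fun s => f s x) t (1 : R),
      forall i t x, derivable (f t) x (e i) &
      [/\ C (tderiv f), forall i, C (pderiv i f) & forall i, C (xmul i f)]].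

(* The largest class of families closed under differentiation and
   multiplication by the coordinates and consisting of bounded functions:
   Schwartz functions of x, uniformly in the parameter t. *)
Definition sw f := exists2 C, sw_class C & C f.

Lemma sw_bounded f : sw f -> bounded_family f.
Proof. by move=> [C CC /CC []]. Qed.

Lemma sw_tderiv f : sw f -> sw (tderiv f).
Proof. by move=> [C CC Cf]; exists C => //; case: (CC _ Cf) => _ _ _ []. Qed.

Lemma sw_pderiv i f : sw f -> sw (pderiv i f).
Proof. by move=> [C CC Cf]; exists C => //; case: (CC _ Cf) => _ _ _ []. Qed.

Lemma sw_xmul i f : sw f -> sw (xmul i f).
Proof. by move=> [C CC Cf]; exists C => //; case: (CC _ Cf) => _ _ _ []. Qed.

Lemma sw_is_tderive f : sw f ->
  forall t x, is_derive t (1 : R) (fun s => f s x) (tderiv f t x).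
Proof. by move=> [C CC /CC [_ h _ _]] t x; exact/derivableP/h. Qed.

Lemma sw_is_pderive f : sw f ->
  forall i t x, is_derive x (e i) (f t) (pderiv i f t x).
Proof. by move=> [C CC /CC [_ _ h _]] i t x; exact/derivableP/h. Qed.

(** Coinduction for [sw]. Derivatives are supplied through [is_derive], so that a candidate class
    can be described by formulas; uniqueness of derivatives identifies them with [tderiv] and
    [pderiv]. *)
Lemma sw_ind C : (forall f, C f ->
  [/\ bounded_family f,
      exists2 g, C g & forall t x, is_derive t (1 : R) (fun s => f s x) (g t x),
      forall i, exists2 g, C g & forall t x, is_derive x (e i) (f t) (g t x) &
      forall i, C (xmul i f)]) -> forall f, C f -> sw f.
Proof.
move=> H f Cf; exists C => // {Cf}f Cf; have [bf [g Cg fg] hp hx] := H _ Cf.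
split => //.
- by move=> i t x; have [k _ fk] := hp i; case: (fk t x).
split => //.
- suff -> : tderiv f = g by [].
  by apply/funext => t; apply/funext => x; have [_] := fg t x.
- move=> i; have [k Ck fk] := hp i; suff -> : pderiv i f = k by [].
  by apply/funext => t; apply/funext => x; have [_] := fk t x.
Qed.

Lemma swD f g : sw f -> sw g -> sw (fun t x => f t x + g t x).
Proof.
move=> sf sg.
apply: (@sw_ind (fun h => exists f g, [/\ sw f, sw g & h = fun t x => f t x + g t x])); last by exists f, g.
move=> {f g sf sg}_ [f [g [sf sg ->]]]; split.
- have [M fM] := sw_bounded sf; have [N gN] := sw_bounded sg.
  by exists (M + N) => t x; rewrite (le_trans (ler_normD _ _))// lerD.
- exists (fun t x => tderiv f t x + tderiv g t x).
    by exists (tderiv f), (tderiv g); split => //; exact: sw_tderiv.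
  by move=> t x; apply: is_deriveD; exact: sw_is_tderive.
- move=> i; exists (fun t x => pderiv i f t x + pderiv i g t x).
    by exists (pderiv i f), (pderiv i g); split => //; exact: sw_pderiv.
  by move=> t x; apply: is_deriveD; exact: sw_is_pderive.
- move=> i; exists (xmul i f), (xmul i g); split; [exact: sw_xmul|exact: sw_xmul|].
  by apply/funext => t; apply/funext => x; rewrite /xmul mulrDr.
Qed.

Lemma swZ c f : sw f -> sw (fun t x => c * f t x).
Proof.
move=> sf.
apply: (@sw_ind (fun h => exists f, sw f /\ h = fun t x => c * f t x)); last by exists f.
move=> {f sf}_ [f [sf ->]]; split.
- have [M fM] := sw_bounded sf.
  by exists (`|c| * M) => t x; rewrite normrM ler_wpM2l.
- exists (fun t x => c * tderiv f t x).
    by exists (tderiv f); split => //; exact: sw_tderiv.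
  by move=> t x; apply: is_deriveZ; exact: sw_is_tderive.
- move=> i; exists (fun t x => c * pderiv i f t x).
    by exists (pderiv i f); split => //; exact: sw_pderiv.
  by move=> t x; apply: is_deriveZ; exact: sw_is_pderive.
- move=> i; exists (xmul i f); split; first exact: sw_xmul.
  by apply/funext => t; apply/funext => x; rewrite /xmul mulrCA.
Qed.

Lemma sw_sum (I : Type) (r : seq I) (f : I -> R -> V -> R) :
  sw (fun _ _ => 0) -> (forall i, sw (f i)) -> sw (fun t x => \sum_(i <- r) f i t x).
Proof.
move=> s0 sf; elim: r => [|i r IH].
  by under eq_fun do under eq_fun do rewrite big_nil.
by under eq_fun do under eq_fun do rewrite big_cons; exact: swD.
Qed.

Lemma sw0 : sw (fun _ _ => 0).
Proof.
apply: (@sw_ind (fun h => h = fun _ _ => 0)) => // _ ->; split.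
- by exists 0 => *; rewrite normr0.
- by exists (fun _ _ => 0) => // t x; exact: is_derive_cst.
- by move=> i; exists (fun _ _ => 0) => // t x; exact: is_derive_cst.
- by move=> i; apply/funext => t; apply/funext => x; rewrite /xmul mulr0.
Qed.

Lemma sw_weight (r : seq 'I_n) f : sw f ->
  sw (fun t x => (\prod_(i <- r) (1 + x i 0 ^+ 2)) * f t x).
Proof.
move=> sf; elim: r => [|i r IH].
  by under eq_fun do under eq_fun do rewrite big_nil mul1r.
under eq_fun do under eq_fun do rewrite big_cons -mulrA mulrDl mul1r.
apply: swD => //; have := sw_xmul i (sw_xmul i IH).
by rewrite /xmul; under eq_fun do under eq_fun do rewrite mulrA -expr2.
Qed.

(** The product of the factors 1 + x_i^2 with [f] is again in the class, hence bounded; the bound is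
    uniform in t. *)
Lemma sw_Wt f : sw f -> exists M, forall t x, `|f t x| <= M * Wt x.
Proof.
move=> /(sw_weight (index_enum 'I_n)) /sw_bounded [M fM]; exists M => t x.
have p0 : 0 < \prod_(i < n) (1 + x i 0 ^+ 2) by apply: prodr_gt0 => i _; exact: oneDsqr_gt0.
have := fM t x; rewrite normrM gtr0_norm// => H.
by rewrite /Wt prodfV ler_pdivlMr// mulrC.
Qed.

(** The source of joint continuity in (t, x), which separate derivatives yield only because they are
    bounded. *)
Lemma sw_lipschitz f : sw f -> exists M, forall t t' x x',
  `|f t' x' - f t x| <= M * (`|t' - t| + \sum_i `|x' i 0 - x i 0|).
Proof.
move=> sf.
have [M fM] := sw_bounded (sw_tderiv sf).
have [N fN] : exists N, forall i t x, `|pderiv i f t x| <= N.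
  have /choice [N fN] := fun i => sw_bounded (sw_pderiv i sf).
  exists (\sum_i `|N i|) => i t x; rewrite (le_trans (fN i t x))//.
  by rewrite (le_trans (ler_norm _))// (bigD1 i)//= lerDl sumr_ge0.
exists (`|M| + `|N|) => t t' x x'.
have -> : f t' x' - f t x = (f t' x' - f t x') + (f t x' - f t x) by ring.
rewrite (le_trans (ler_normD _ _))// mulrDr lerD//.
  rewrite (le_trans (norm_mean_value (sw_is_tderive sf ^~ x') (fM ^~ x') t t'))//.
  by rewrite ler_wpM2r// (le_trans (ler_norm _))// lerDl.
rewrite (le_trans (coord_lipschitz (fun i x => sw_is_pderive sf i t x) (fun i x => fN i t x) x x'))//.
by rewrite ler_wpM2r ?sumr_ge0// (le_trans (ler_norm _))// lerDr.
Qed.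

Lemma sw_continuous2 (X : topologicalType) (tau : X -> R) (phi : X -> V) f : sw f ->
  continuous tau -> continuous phi -> continuous (fun p => f (tau p) (phi p)).
Proof.
move=> /sw_lipschitz [M fM] ct cp p.
apply: (lipschitz_continuous (g := fun q => M * (`|tau q - tau p| + \sum_i `|phi q i 0 - phi p i 0|))) => //.
  by rewrite subrr normr0 add0r big1 ?mulr0// => i _; rewrite subrr normr0.
have cB (h : X -> R) : continuous h -> continuous (fun q => `|h q - h p|).
  move=> ch; apply: (continuous_compT (f := fun q => h q - h p)); last exact: norm_continuous.
  by apply: continuousTD => //; exact: cst_continuous.
apply: continuousTZ; apply: continuousTD; first exact: cB.
apply: continuous_sum => i; apply: (cB (fun q => phi q i 0)).
exact: (continuous_compT (g := fun x : V => x i 0) cp (@continuous_coord _ _ _)).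
Qed.

Lemma sw_continuous f t : sw f -> continuous (f t).
Proof.
move=> sf; apply: (sw_continuous2 (tau := fun=> t) (phi := id)) => //.
- exact: cst_continuous.
- by move=> x; exact: cvg_id.
Qed.

Lemma sw_dom f t : sw f -> dom (f t).
Proof.
move=> sf; split; first exact: sw_continuous.
by have [M fM] := sw_Wt sf; exists M.
Qed.

End schwartz_families.

(** * The Hartley transform *)

Section hartley.
Context (R : realType).

(** The Hartley kernel. Its derivative at a is cas (- a), the source of every reflection below. *)
Definition cas (a : R) : R := cos a + sin a.

Lemma casN a : cas (- a) = cos a - sin a.
Proof. by rewrite /cas cosN sinN. Qed.

Lemma is_derive_cas (a : R) : is_derive a (1 : R) cas (cas (- a)).
Proof.
rewrite casN addrC; apply: is_deriveD.
Qed.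

Lemma is_derive_casN (a : R) : is_derive a (1 : R) (fun x => cas (- x)) (- cas a).
Proof.
have -> : (fun x => cas (- x)) = (fun x => cos x - sin x) by apply/funext => x; exact: casN.
by rewrite /cas opprD addrC; apply: is_deriveB.
Qed.

Lemma cas_le2 a : `|cas a| <= 2.
Proof.
have -> : 2 = 1 + 1 :> R by ring.
rewrite (le_trans (ler_normD _ _))// lerD//.
  by rewrite ler_norml cos_geN1 cos_le1.
by rewrite ler_norml sin_geN1 sin_le1.
Qed.

Lemma continuous_cas : continuous cas.
Proof. by apply: continuousTD; [exact: continuous_cos|exact: continuous_sin]. Qed.

Lemma casD a b : cas a * cas b = cos (a - b) + sin (a + b).
Proof. by rewrite /cas cosB sinD; ring. Qed.

Context (n : nat).
Local Notation V := 'cV[R]_n.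
Local Notation e i := (delta_mx i 0 : V).
Implicit Types (g dg : V -> R) (x xi : V).

(* Like the Fourier transform, it conjugates the multipliers with real even
   symbols to multiplications, but it is real and it is its own inverse. *)
Definition hartley g xi : R := J (fun x => cas (2 * pi * dotv x xi) * g x).

Lemma dom_cas g xi : dom g -> dom (fun x => cas (2 * pi * dotv x xi) * g x).
Proof.
move=> dg; apply: (domM (C := 2)) => // [|x]; last exact: cas_le2.
apply: (@continuous_compT _ _ _ (fun x => 2 * pi * dotv x xi) cas); last exact: continuous_cas.
by apply: continuousTZ; exact: continuous_dotvl.
Qed.

Lemma hartley_norm g xi : dom g -> `|hartley g xi| <= 2 * J (fun x => `|g x|).
Proof.
move=> dg; rewrite (le_trans (J_norm (dom_cas xi dg)))// -JZ; last exact: dom_norm.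
apply: J_le; [exact/dom_norm/dom_cas|exact/domZ/dom_norm|].
by move=> x; rewrite normrM ler_wpM2r// cas_le2.
Qed.

Lemma hartleyD f g xi : dom f -> dom g ->
  hartley (fun x => f x + g x) xi = hartley f xi + hartley g xi.
Proof.
move=> df dg; rewrite /hartley -JD; [|exact: dom_cas|exact: dom_cas].
by congr J; apply/funext => x; rewrite mulrDr.
Qed.

Lemma hartleyZ c g xi : dom g -> hartley (fun x => c * g x) xi = c * hartley g xi.
Proof.
move=> dg; rewrite /hartley -JZ; last exact: dom_cas.
by congr J; apply/funext => x; rewrite mulrCA.
Qed.

Lemma hartley_sum (I : Type) (r : seq I) (f : I -> V -> R) xi :
  (forall i, dom (f i)) ->
  hartley (fun x => \sum_(i <- r) f i x) xi = \sum_(i <- r) hartley (f i) xi.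
Proof.
move=> df; rewrite /hartley -J_sum; last by move=> i; exact: dom_cas.
by congr J; apply/funext => x; rewrite mulr_sumr.
Qed.

(** The kernel is expanded to second order under the integral. The remainder is at most 2 (2 pi h
    x_i)^2 |g|, whence the hypothesis on x_i^2 g. *)
Lemma hartley_is_pderive g i xi : dom g -> dom (fun x => x i 0 * g x) ->
  dom (fun x => x i 0 * (x i 0 * g x)) ->
  is_derive xi (e i) (hartley g) (2 * pi * hartley (fun x => x i 0 * g x) (- xi)).
Proof.
move=> dg dxg dxxg.
pose W x := `|x i 0 * (x i 0 * g x)|.
have dW : dom W by exact: dom_norm.
apply: (@is_derive_quadratic _ _ _ _ _ _ (2 * (2 * pi) ^+ 2 * J W)) => h.
have d0 := dom_cas; set a := 2 * pi.
have -> : hartley g (h *: e i + xi) - hartley g xi - h * (a * hartley (fun x => x i 0 * g x) (- xi)) =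
  J (fun x => cas (a * dotv x (h *: e i + xi)) * g x - cas (a * dotv x xi) * g x
     - (h * a) * (cas (a * dotv x (- xi)) * (x i 0 * g x))).
  rewrite JB ?JB ?JZ -/(hartley _ _); try by [exact: d0|exact/domZ/d0|apply: domD; [exact: d0|apply/domN; exact: d0]].
  by rewrite !mulrA.
have dL : dom (fun x => cas (a * dotv x (h *: e i + xi)) * g x - cas (a * dotv x xi) * g x
     - (h * a) * (cas (a * dotv x (- xi)) * (x i 0 * g x))).
  by apply: domD; [apply: domD; [exact: d0|apply: domN; exact: d0]|apply/domN/domZ/d0].
rewrite (le_trans (J_norm dL))//.
have -> : 2 * (2 * pi) ^+ 2 * J W * h ^+ 2 = J (fun x => 2 * a ^+ 2 * h ^+ 2 * W x).
  by rewrite JZ// mulrAC.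
apply: J_le; [exact: dom_norm|exact/domZ|move=> x].
have T := taylor2 is_derive_cas is_derive_casN (fun b => _ : `|- cas b| <= 2)
  (a * dotv x xi) (a * (h * x i 0)).
rewrite dotvDr dotvZr [dotv x (e i)]dotvC dotv_delta mulrDr dotvNr mulrN.
have -> : cas (a * (h * x i 0) + a * dotv x xi) * g x - cas (a * dotv x xi) * g x -
    h * a * (cas (- (a * dotv x xi)) * (x i 0 * g x)) =
  (cas (a * (h * x i 0) + a * dotv x xi) - cas (a * dotv x xi) -
    a * (h * x i 0) * cas (- (a * dotv x xi))) * g x by ring.
rewrite normrM (le_trans (ler_wpM2r _ (T _)))//.
  by move=> b; rewrite normrN cas_le2.
rewrite /W !normrM le_eqVlt; apply/orP; left; apply/eqP.
have -> : (a * (h * x i 0)) ^+ 2 = a ^+ 2 * h ^+ 2 * `|x i 0| ^+ 2.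
  by rewrite real_normK ?num_real//; ring.
ring.
Qed.

(** The integral of the derivative of cas (2 pi x . xi) g (x) along e_i vanishes. *)
Lemma hartley_deriv g dg i xi : dom g -> dom dg ->
  (forall x, is_derive x (e i) g (dg x)) ->
  hartley dg xi = - (2 * pi * xi i 0) * hartley g (- xi).
Proof.
move=> domg domdg gdg; set a := 2 * pi.
have E : (fun x => cas (a * dotv x xi) * dg x + a * xi i 0 * (cas (a * dotv x (- xi)) * g x)) =
         (fun x => cas (a * dotv x xi) * dg x + g x * (a * xi i 0 * cas (- (a * dotv x xi)))).
  by apply/funext => x; rewrite dotvNr mulrN; ring.
have : J (fun x => cas (a * dotv x xi) * dg x + a * xi i 0 * (cas (a * dotv x (- xi)) * g x)) = 0.
  apply: (@J_deriv0 _ _ i (fun x => cas (a * dotv x xi) * g x)); last 2 first.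
  - exact: dom_cas.
  - by apply: domD; [exact: dom_cas|apply/domZ/dom_cas].
  move=> x; have /= -> := congr1 (@^~ x) E.
  have H : is_derive x (e i) (fun x => cas (a * dotv x xi)) (a * xi i 0 * cas (- (a * dotv x xi))).
    pose M := 2 * (a * xi i 0) ^+ 2.
    apply: (@is_derive_quadratic _ _ _ _ _ _ M) => h.
    have T := taylor2 is_derive_cas is_derive_casN (fun b => _ : `|- cas b| <= 2)
      (a * dotv x xi) (a * (h * xi i 0)).
    rewrite dotvDl dotvZl dotv_delta mulrDr.
    have -> : h * (a * xi i 0 * cas (- (a * dotv x xi))) = a * (h * xi i 0) * cas (- (a * dotv x xi)) by ring.
    rewrite (le_trans (T _))//; first by move=> b; rewrite normrN cas_le2.
    by rewrite le_eqVlt /M; apply/orP; left; apply/eqP; ring.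
  exact: (is_deriveM H (gdg x)).
rewrite JD; [|exact: dom_cas|exact/domZ/dom_cas].
rewrite JZ; last exact: dom_cas.
by rewrite -!/(hartley _ _) => /eqP; rewrite addr_eq0 => /eqP ->; rewrite mulNr.
Qed.

End hartley.

Section hartley_families.
Context (R : realType) (n : nat).
Local Notation V := 'cV[R]_n.
Local Notation e i := (delta_mx i 0 : V).
Local Notation T := (measurableTypeR R).
Implicit Types (f : R -> V -> R) (g h : V -> R) (x xi : V).

(** Taylor expansion in t: the second time derivative is dominated by M [Wt] uniformly in t, so the
    remainder can be integrated in x. *)
Lemma hartley_is_tderive f t xi : sw f ->
  is_derive t (1 : R) (fun s => hartley (f s) xi) (hartley (tderiv f t) xi).
Proof.
move=> sf; have sdf := sw_tderiv sf; have [M fM] := sw_Wt (sw_tderiv sdf).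
apply: (@is_derive_quadratic _ _ _ _ _ _ (2 * J (fun x : V => M * Wt x))) => h.
have df s := sw_dom s sf; have ddf s := sw_dom s sdf.
have -> : hartley (f (h *: (1 : R) + t)) xi - hartley (f t) xi - h * hartley (tderiv f t) xi =
   hartley (fun x => f (h *: (1 : R) + t) x + (- 1 * f t x + - h * tderiv f t x)) xi.
  rewrite hartleyD ?hartleyD ?hartleyZ//; first ring.
  - exact: domZ.
  - exact: domZ.
  - by apply: domD; exact: domZ.
have dL : dom (fun x => f (h *: (1 : R) + t) x + (- 1 * f t x + - h * tderiv f t x)).
  by apply: domD => //; apply: domD; exact: domZ.
rewrite (le_trans (hartley_norm xi dL))// -mulrA ler_pM2l// mulrC -JZ; last exact/domZ/dom_Wt.
apply: J_le; [exact: dom_norm|exact/domZ/domZ/dom_Wt|move=> x].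
have -> : h *: (1 : R) = h by rewrite /GRing.scale /= mulr1.
have := taylor2 (sw_is_tderive sf ^~ x) (sw_is_tderive sdf ^~ x) (fM ^~ x) t h.
by rewrite [h ^+ 2 * _]mulrC !mulNr mul1r addrA.
Qed.

(** The transform exchanges derivatives and multiplications by coordinates, each time with a scalar
    factor and a reflection. The stable class therefore consists of scalar multiples of transforms,
    reflected or not according to the boolean [b]. *)
Lemma sw_hartley f : sw f -> sw (fun t => hartley (f t)).
Proof.
move=> sf.
pose C (h : R -> V -> R) := exists (c : R) (b : bool) (f : R -> V -> R),
  sw f /\ h = fun t xi => c * hartley (f t) ((-1) ^+ b *: xi).
apply: (@sw_ind _ _ C); last first.
  by exists 1, false, f; split => //; apply/funext => t; apply/funext => xi; rewrite mul1r scale1r.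
have sgE (b : bool) : (-1) ^+ (~~ b) = - (-1) ^+ b :> R by case: b; rewrite ?expr0 ?expr1 ?opprK.
move=> {f sf}_ [c [b [f [sf ->]]]]; split.
- have [M fM] := sw_Wt sf; exists (`|c| * (2 * J (fun x : V => M * Wt x))) => t xi.
  rewrite normrM ler_wpM2l// (le_trans (hartley_norm _ (sw_dom t sf)))// ler_pM2l//.
  by apply: J_le => //; [exact/dom_norm/sw_dom|exact/domZ/dom_Wt].
- exists (fun t xi => c * hartley (tderiv f t) ((-1) ^+ b *: xi)).
    by exists c, b, (tderiv f); split => //; exact: sw_tderiv.
  by move=> t xi; apply: is_deriveZ; exact: hartley_is_tderive.
- move=> i; exists (fun t xi => c * ((-1) ^+ b * (2 * pi)) * hartley (xmul i f t) ((-1) ^+ (~~ b) *: xi)).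
    by exists (c * ((-1) ^+ b * (2 * pi))), (~~ b), (xmul i f); split => //; exact: sw_xmul.
  move=> t xi; rewrite -mulrA; apply: is_deriveZ.
  apply: (is_derive_affine (phi := fun xi : V => (-1) ^+ b *: xi) (v := (-1) ^+ b *: e i)).
    by move=> k; rewrite scalerDr !scalerA mulrC.
  have H := hartley_is_pderive ((-1) ^+ b *: xi) (sw_dom t sf)
     (sw_dom t (sw_xmul i sf)) (sw_dom t (sw_xmul i (sw_xmul i sf))).
  rewrite sgE scaleNr; case: b H => /=; rewrite ?expr0 ?expr1 ?mul1r ?scale1r// => H.
  by rewrite !scaleN1r mulN1r mulNr; move/is_derive_Nv: H; rewrite scaleN1r.
- move=> i; exists (c * ((-1) ^+ b / (2 * pi))), (~~ b), (pderiv i f).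
  split; first exact: sw_pderiv.
  apply/funext => t; apply/funext => xi; rewrite /xmul.
  rewrite (hartley_deriv _ (sw_dom t sf) (sw_dom t (sw_pderiv i sf)) (sw_is_pderive sf i t)).
  have : 2 * pi != 0 :> R by rewrite mulf_neq0// lt0r_neq0// pi_gt0.
  rewrite sgE scaleNr opprK !mxE; move: (2 * pi) => a a0.
  by case: b; rewrite ?expr0 ?expr1; field.
Qed.

Lemma measurable_cas_kernel m g h : continuous g -> continuous h ->
  measurable_fun [set: n.-tuple T * n.-tuple T]
    (fun p => cas (m * dotv (vec p.1) (vec p.2)) * g (vec p.1) * h (vec p.2)).
Proof.
move=> cg ch; apply: measurable_funM; last first.
  exact: (measurableT_comp (measurable_vec ch) measurable_snd).
apply: measurable_funM; last first.
  exact: (measurableT_comp (measurable_vec cg) measurable_fst).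
apply: (measurableT_comp (f := @cas R)).
  exact: continuous_measurable_fun (@continuous_cas R).
apply: measurable_funM => //; rewrite /dotv.
apply: measurable_sum => i; apply: measurable_funM; under eq_fun do rewrite mxE.
  exact: (measurableT_comp (measurable_tnth i) measurable_fst).
exact: (measurableT_comp (measurable_tnth i) measurable_snd).
Qed.

(** Fubini for a kernel that is symmetric in x and xi. *)
Lemma hartley_sym g h : dom g -> dom h ->
  J (fun xi => hartley g xi * h xi) = J (fun x => g x * hartley h x).
Proof.
move=> dg dh; have [cg _] := dg; have [ch _] := dh.
pose k x xi := cas (2 * pi * dotv x xi) * g x * h xi.
transitivity (J (fun xi => J (k ^~ xi))).
  congr J; apply/funext => xi; rewrite mulrC /hartley -JZ; last exact: dom_cas.
  by congr J; apply/funext => x; rewrite /k mulrC.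
transitivity (J (fun x => J (k x))); last first.
  congr J; apply/funext => x; rewrite /hartley -JZ; last exact: dom_cas.
  by congr J; apply/funext => xi; rewrite /k dotvC mulrCA mulrA.
apply/esym; apply: (@J_fubini _ _ _ k (fun x => 2 * `|g x|) (fun x => `|h x|)).
- exact/domZ/dom_norm.
- exact: dom_norm.
- by move=> x y; rewrite /k !normrM ler_wpM2r// ler_wpM2r// cas_le2.
- move=> x; apply: continuousTM => //; under eq_fun do rewrite dotvC mulrC; apply: continuousTZ.
  apply: (@continuous_compT _ _ _ (fun y => 2 * pi * dotv y x) (@cas R)); last exact: continuous_cas.
  by apply: continuousTZ; exact: continuous_dotvl.
- move=> y; under eq_fun do rewrite /k mulrC; apply: continuousTZ.
  apply: continuousTM => //.
  apply: (@continuous_compT _ _ _ (fun x => 2 * pi * dotv x y) (@cas R)); last exact: continuous_cas.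
  by apply: continuousTZ; exact: continuous_dotvl.
- exact: measurable_cas_kernel.
Qed.

End hartley_families.

(** * Gaussian integrals *)

Section gaussian.
Context (R : realType).
Local Notation mu := (@lebesgue_measure R).
Local Notation leb n := (lebesgue_tuple R n).

Lemma dom_prod n (p : 'I_n -> R -> R) : (forall i, dom1 (p i)) ->
  dom (fun x : 'cV[R]_n => \prod_i p i (x i 0)).
Proof.
move=> dp; split.
  apply: continuous_prod => i.
  by apply: (@continuous_compT _ _ _ (fun x : 'cV[R]_n => x i 0) (p i)); [exact: continuous_coord|case: (dp i)].
have /choice[C pC] : forall i, exists C, forall x, `|p i x| <= C * (1 + x ^+ 2)^-1.
  by move=> i; case: (dp i).
exists (\prod_i C i) => x; rewrite normr_prod /Wt -big_split /=.
by apply: ler_prod => i _; rewrite normr_ge0/=.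
Qed.

Lemma J_prod n (p : 'I_n -> R -> R) : (forall i, dom1 (p i)) ->
  J (fun x : 'cV[R]_n => \prod_i p i (x i 0)) = \prod_i \int[mu]_x p i x.
Proof.
elim: n p => [|n IHn] p dp.
  rewrite big_ord0 /J /Rintegral integral_leb0.
    by rewrite big_ord0.
  by apply/measurable_EFinP; exact: (measurable_vec (proj1 (dom_prod dp))).
rewrite (J_cons (dom_prod dp)) big_ord_recl -IHn//.
rewrite -RintegralZr//; last exact: integrable_dom1.
apply: eq_Rintegral => a _; rewrite -JZ; last exact: (dom_prod (fun i => dp (lift ord0 i))).
congr J; apply/funext => v; rewrite big_ord_recl consv0; congr (_ * _).
by apply: eq_bigr => i _; rewrite consvS.
Qed.

Lemma dom1_gauss (c m : R) : 0 < c -> dom1 (fun y => expR (- (c * (y - m) ^+ 2))).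
Proof.
move=> c0; split.
  move=> y; apply: (@continuous_comp _ _ _ (fun y => - (c * (y - m) ^+ 2)) (@expR R)).
    apply: (@continuousN _ _ _ (fun y => c * (y - m) ^+ 2)).
    apply: (@continuousM _ _ (cst c) (fun y => (y - m) ^+ 2)); first exact: cst_continuous.
    apply: (@continuous_comp _ _ _ (fun y => y - m) (fun y => y ^+ 2)); last exact: exprn_continuous.
    by apply: (@continuousB _ _ _ id (cst m)); [exact: cvg_id|exact: cst_continuous].
  exact: continuous_expR.
(* With d = y - m, one has expR (c d^2) >= 1 + c d^2 and y^2 <= 2 m^2 + 2 d^2; the product of this
   constant and 1 + c d^2 then exceeds 1 + y^2. *)
exists (1 + 2 * m ^+ 2 + 2 / c) => y.
rewrite ger0_norm ?expR_ge0// expRN ler_pdivlMr ?oneDsqr_gt0// mulrC ler_pdivrMr ?expR_gt0//.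
set d := y - m; have yE : y = d + m by rewrite subrK.
apply: (@le_trans _ _ ((1 + 2 * m ^+ 2 + 2 / c) * (1 + c * d ^+ 2))).
  have -> : (1 + 2 * m ^+ 2 + 2 / c) * (1 + c * d ^+ 2) =
     1 + 2 * m ^+ 2 + 2 * d ^+ 2 + (2 / c + (1 + 2 * m ^+ 2) * (c * d ^+ 2)).
    by field; rewrite lt0r_neq0.
  have h1 : 0 <= 2 / c + (1 + 2 * m ^+ 2) * (c * d ^+ 2).
    apply: addr_ge0; first by rewrite divr_ge0// ltW.
    by rewrite mulr_ge0// ?addr_ge0// mulr_ge0// ?sqr_ge0// ltW.
  have h2 : 0 <= (d - m) ^+ 2 by exact: sqr_ge0.
  have -> : 1 + y ^+ 2 = 1 + 2 * m ^+ 2 + 2 * d ^+ 2 - (d - m) ^+ 2 by rewrite yE; ring.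
  by rewrite -subr_ge0 opprB addrC addrA; move: h1 h2; lra.
apply: ler_wpM2l; last exact: expR_ge1Dx.
by apply: addr_ge0; [rewrite addr_ge0// mulr_ge0// sqr_ge0|rewrite divr_ge0// ltW].
Qed.

Lemma Rintegral_gauss (c m : R) : 0 < c ->
  \int[mu]_y expR (- (c * (y - m) ^+ 2)) = Num.sqrt (pi / c).
Proof.
(* Up to normalization this is the normal density of mean m and variance 1 / (2 c). *)
move=> c0; pose s := Num.sqrt ((2 * c)^-1).
have c20 : 0 < (2 * c)^-1 by rewrite invr_gt0 mulr_gt0.
have s0 : s != 0 by rewrite sqrtr_eq0 -ltNge.
have s2 : s ^+ 2 = (2 * c)^-1 by rewrite sqr_sqrtr// ltW.
have p0 := normal_peak_gt0 s0.
have := @integral_normal_pdf R m s; rewrite normal_pdfE// => H.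
have : \int[mu]_y (normal_peak s * expR (- (c * (y - m) ^+ 2))) = 1.
  rewrite /Rintegral -[RHS]/(fine 1%:E) -H; congr fine; apply: eq_integral => y _.
  rewrite /normal_fun; congr (_ * expR _)%:E.
  by rewrite s2; field; rewrite lt0r_neq0.
rewrite RintegralZl//; last exact: integrable_dom1 (dom1_gauss m c0).
move=> E; apply: (mulfI (lt0r_neq0 p0)); rewrite E /normal_peak s2.
have -> : (2 * c)^-1 * pi *+ 2 = pi / c by rewrite -mulr_natr; field; rewrite lt0r_neq0.
by rewrite mulVf// sqrtr_eq0 -ltNge divr_gt0// pi_gt0.
Qed.

Definition gauss n (c : R) (z x : 'cV[R]_n) := expR (- (c * dotv (x - z) (x - z))).

Lemma gauss_prod n c (z x : 'cV[R]_n) :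
  gauss c z x = \prod_i expR (- (c * (x i 0 - z i 0) ^+ 2)).
Proof.
rewrite -expR_sum /gauss /dotv mulr_sumr -sumrN; congr expR.
by apply: eq_bigr => i _; rewrite !mxE expr2.
Qed.

Lemma dom_gauss n c (z : 'cV[R]_n) : 0 < c -> dom (gauss c z).
Proof.
move=> c0; have -> : gauss c z = fun x => \prod_i expR (- (c * (x i 0 - z i 0) ^+ 2)).
  by apply/funext => x; exact: gauss_prod.
exact: (dom_prod (fun i => dom1_gauss (z i 0) c0)).
Qed.

Lemma J_gauss n c (z : 'cV[R]_n) : 0 < c -> J (gauss c z) = Num.sqrt (pi / c) ^+ n.
Proof.
move=> c0; have -> : gauss c z = fun x => \prod_i expR (- (c * (x i 0 - z i 0) ^+ 2)).
  by apply/funext => x; exact: gauss_prod.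
rewrite (J_prod (fun i => dom1_gauss (z i 0) c0)).
under eq_bigr do rewrite Rintegral_gauss//.
by rewrite prodr_const card_ord.
Qed.

(** Half of the exponent pays for the linear factor: with w = k |x_i - z_i| and q = k^2 |x - z|^2,
    one has w / 2 <= 1 + q / 2 <= expR (q / 2). The factor 1 / k is the rate of convergence in the
    inversion formula. *)
Lemma gauss_first_moment n k (z x : 'cV[R]_n) i : 0 < k ->
  `|x i 0 - z i 0| * gauss (k ^+ 2) z x <= 2 / k * gauss (k ^+ 2 / 2) z x.
Proof.
move=> k0; rewrite /gauss; set D := dotv _ _.
have DE : (x i 0 - z i 0) ^+ 2 <= D.
  rewrite /D /dotv (bigD1 i)//= !mxE -expr2 lerDl sumr_ge0// => j _.
  by rewrite -expr2 sqr_ge0.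
set t := x i 0 - z i 0 in DE *.
have -> : - (k ^+ 2 * D) = - (k ^+ 2 / 2 * D) + - (k ^+ 2 / 2 * D) by field.
rewrite expRD mulrA ler_wpM2r ?expR_ge0// expRN ler_pdivrMr ?expR_gt0//.
have E := expR_ge1Dx (k ^+ 2 / 2 * D).
rewrite -ler_pdivrMl; last by rewrite divr_gt0.
rewrite (le_trans _ E)// invf_div.
have h : (k * `|t|) ^+ 2 <= k ^+ 2 * D.
  by rewrite exprMn real_normK ?num_real// ler_wpM2l// sqr_ge0.
have h2 : 0 <= (k * `|t| - 1) ^+ 2 by exact: sqr_ge0.
have -> : k / 2 * `|t| = (k * `|t|) / 2 by ring.
move: h h2; set w := k * `|t|; set q := k ^+ 2 * D => h h2.
have -> : k ^+ 2 / 2 * D = q / 2 by rewrite /q; ring.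
have h3 : 0 <= w ^+ 2 by exact: sqr_ge0.
have -> : w = ((w ^+ 2 + 1) - (w - 1) ^+ 2) / 2 by field.
lra.
Qed.

End gaussian.

(** * Inversion and Plancherel formulas *)

Section hartley_inversion.
Context (R : realType) (n : nat).
Local Notation V := 'cV[R]_n.
Local Notation e i := (delta_mx i 0 : V).
Implicit Types (f : R -> V -> R) (g h : V -> R) (x y xi : V).

Lemma J_odd g : dom g -> (forall x, g (- x) = - g x) -> J g = 0.
Proof.
move=> dg og; have := JVN dg; under [X in J X]eq_fun do rewrite og.
by rewrite JN// => /eqP; rewrite eqNr => /eqP.
Qed.

Lemma dotv0l x : dotv 0 x = 0.
Proof. by rewrite /dotv big1// => i _; rewrite mxE mul0r. Qed.

Lemma dotv0r x : dotv x 0 = 0.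
Proof. by rewrite dotvC dotv0l. Qed.

Lemma sw_dotv f i j t : sw f -> dom (fun x => x i 0 * (x j 0 * f t x)).
Proof. by move=> sf; exact: (sw_dom t (sw_xmul i (sw_xmul j sf))). Qed.

Lemma is_pderive_gauss c i x :
  is_derive x (e i) (gauss c 0) (- (2 * c) * (x i 0 * gauss c 0 x)).
Proof.
pose D (y : V) : R := - (c * dotv (y - 0) (y - 0)).
have E (h : R) : D (h *: e i + x) = D x - (2 * c * x i 0) * h - c * h ^+ 2.
  rewrite /D !subr0 dotvDl !dotvDr !dotvZl !dotvZr !dotv_delta.
  have xe : dotv x (e i) = x i 0 by rewrite dotvC dotv_delta.
  have ee : (e i) i 0 = 1 by rewrite mxE !eqxx.
  by rewrite xe ee; ring.
pose L (h : R) : V := h *: e i + x.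
have LE (h : R) : L (h *: (1 : R) + 0) = h *: e i + L 0.
  by rewrite /L addr0 scale0r add0r /GRing.scale /= mulr1.
have L0 : L 0 = x by rewrite /L scale0r add0r.
rewrite -{1}L0; apply: (is_derive_affine_inv (phi := L) (w := (1 : R)) LE).
have -> : (fun h : R => gauss c 0 (L h)) = expR \o (fun h : R => D x - (2 * c * x i 0) * h - c * h ^+ 2).
  by apply/funext => h /=; rewrite /gauss -/(D _) E.
have H : is_derive (0 : R) (1 : R) (fun h : R => D x - (2 * c * x i 0) * h - c * h ^+ 2) (- (2 * c * x i 0)).
  apply: (@is_derive_quadratic _ _ _ _ _ _ `|c|) => h.
  rewrite [h *: _]/GRing.scale /= mulr1 !addr0 mulr0 expr0n mulr0 !subr0.
  rewrite [X in `|X|](_ : _ = - (c * h ^+ 2)); last by ring.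
  by rewrite normrN normrM [`|h ^+ 2|]ger0_norm// sqr_ge0.
have := @is_derive1_comp _ (@expR R) (fun h : R => D x - (2 * c * x i 0) * h - c * h ^+ 2) 0 _ _ (is_derive_expR _) H.
rewrite mulr0 expr0n mulr0 !subr0.
have -> // : expR (D x) * - (2 * c * x i 0) = - (2 * c) * (x i 0 * gauss c 0 x).
by rewrite /gauss -/(D x); ring.
Qed.

Lemma dom_poly_gauss c : 0 < c ->
  (forall i, dom (fun x : V => x i 0 * gauss c 0 x)) /\
  (forall i, dom (fun x : V => x i 0 * (x i 0 * gauss c 0 x))).
Proof.
move=> c0; pose k := Num.sqrt c; have k0 : 0 < k by rewrite sqrtr_gt0.
have ck : c = k ^+ 2 by rewrite sqr_sqrtr// ltW.
have cg c' : 0 < c' -> continuous (gauss c' 0 : V -> R) by move=> ?; case: (@dom_gauss R n c' 0).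
have c1 i : continuous (fun x : V => x i 0 * gauss c 0 x).
  by apply: continuousTM; [exact: continuous_coord|exact: cg].
split=> i.
  apply: (dom_le (g := fun x => 2 / k * gauss (k ^+ 2 / 2) 0 x)) => // [|x].
    by apply/domZ/dom_gauss; rewrite divr_gt0// exprn_gt0.
  rewrite normrM [X in _ * X]ger0_norm ?expR_ge0// ck.
  by have := gauss_first_moment 0 x i k0; rewrite mxE subr0.
(* The second factor x_i is absorbed by halving the exponent once more. *)
pose k2 := Num.sqrt (k ^+ 2 / 2).
have k20 : 0 < k2 by rewrite sqrtr_gt0 divr_gt0// exprn_gt0.
have k2E : k ^+ 2 / 2 = k2 ^+ 2 by rewrite [RHS]sqr_sqrtr// divr_ge0// sqr_ge0.
apply: (dom_le (g := fun x => 2 / k * (2 / k2 * gauss (k2 ^+ 2 / 2) 0 x))) => [||x].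
- by apply: continuousTM => //; exact: continuous_coord.
- by apply/domZ/domZ/dom_gauss; rewrite divr_gt0// exprn_gt0.
- rewrite !normrM [X in _ * (_ * X)]ger0_norm ?expR_ge0// ck.
  have H := gauss_first_moment 0 x i k0; rewrite mxE subr0 in H.
  rewrite (le_trans (ler_wpM2l (normr_ge0 _) H))// mulrCA.
  apply: ler_wpM2l; first by rewrite divr_ge0// ltW.
  by rewrite k2E; have := gauss_first_moment 0 x i k20; rewrite mxE subr0.
Qed.

(** The rules for derivatives and for coordinates together show that the transform H satisfies d_i H
    = - 2 (pi^2 / c) eta_i H. Multiplied by the inverse Gaussian it has zero partial derivatives, so
    it is constant, and its value at 0 is the Gaussian integral. *)
Lemma hartley_gauss c xi : 0 < c ->
  hartley (gauss c 0) xi = Num.sqrt (pi / c) ^+ n * gauss (pi ^+ 2 / c) 0 xi.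
Proof.
move=> c0; have dg := @dom_gauss R n c 0 c0; have [d1 d2] := dom_poly_gauss c0.
pose H := hartley (gauss c 0 : V -> R).
have HD i eta : is_derive eta (e i) H (- (2 * (pi ^+ 2 / c) * eta i 0) * H eta).
  have := hartley_is_pderive eta dg (d1 i) (d2 i).
  have := @hartley_deriv _ _ (gauss c 0) _ i (- eta) dg (domZ (- (2 * c)) (d1 i)) (is_pderive_gauss c i).
  rewrite hartleyZ// opprK mxE -/H => E.
  have -> // : 2 * pi * hartley (fun x => x i 0 * gauss c 0 x) (- eta) =
    - (2 * (pi ^+ 2 / c) * eta i 0) * H eta.
  have c0' := lt0r_neq0 c0.
  move: E; move: (hartley _ _) (H eta) (pi : R) => A B p E.
  apply: (mulfI (_ : - (2 * c) != 0)); first by rewrite oppr_eq0 mulf_neq0.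
  by rewrite mulrCA E; field.
pose G eta := gauss (- (pi ^+ 2 / c)) 0 eta * H eta.
have GD i eta : is_derive eta (e i) G 0.
  have := is_deriveM (is_pderive_gauss (- (pi ^+ 2 / c)) i eta) (HD i eta).
  by congr is_derive; rewrite /GRing.scale /=; ring.
have G0 : G xi = G 0.
  apply/eqP; rewrite -subr_eq0 -normr_le0.
  have := @coord_lipschitz _ _ G (fun _ _ => 0) 0 GD (fun _ _ => _) 0 xi.
  by rewrite mul0r; apply => *; rewrite normr0.
have GE : G 0 = Num.sqrt (pi / c) ^+ n.
  rewrite /G /gauss /H /hartley subrr dotv0l mulr0 oppr0 expR0 mul1r.
  rewrite -(J_gauss (0 : V) c0); congr J; apply/funext => x.
  by rewrite dotv0r mulr0 /cas cos0 sin0 addr0 mul1r.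
rewrite -GE -G0 /G -/(H xi) mulrAC /gauss -expRD mulNr opprK subrr.
by rewrite expR0 mul1r.
Qed.

(** By [casD] the product of two kernels is the cosine of a difference plus the sine of a sum.
    Against an even function sines integrate to zero, so only the transform of the Gaussian at y - x
    remains. *)
Lemma hartley_cas_gauss c x y : 0 < c ->
  hartley (fun xi => cas (2 * pi * dotv x xi) * gauss c 0 xi) y =
  Num.sqrt (pi / c) ^+ n * gauss (pi ^+ 2 / c) x y.
Proof.
move=> c0; have dg := @dom_gauss R n c 0 c0.
have gN xi : gauss c 0 (- xi : V) = gauss c 0 xi.
  by rewrite /gauss !subr0 dotvNl dotvNr opprK.
have dtr (tr : R -> R) z : continuous tr -> (forall a, `|tr a| <= 1) ->
    dom (fun xi : V => tr (2 * pi * dotv xi z) * gauss c 0 xi).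
  move=> ctr tr1; apply: (domM (C := 1)) => //.
  apply: (@continuous_compT _ _ _ (fun xi : V => 2 * pi * dotv xi z) tr) => //.
  by apply: continuousTZ; exact: continuous_dotvl.
have dsin z := dtr _ z (@continuous_sin R) (fun a => _ : `|sin a| <= 1).
have dcos z := dtr _ z (@continuous_cos R) (fun a => _ : `|cos a| <= 1).
have sin1 (a : R) : `|sin a| <= 1 by rewrite ler_norml sin_geN1 sin_le1.
have cos1 (a : R) : `|cos a| <= 1 by rewrite ler_norml cos_geN1 cos_le1.
have Jsin z : J (fun xi : V => sin (2 * pi * dotv xi z) * gauss c 0 xi) = 0.
  apply: J_odd => [|xi]; first exact: dsin.
  by rewrite gN dotvNl mulrN sinN mulNr.
have Jcos z : J (fun xi : V => cos (2 * pi * dotv xi z) * gauss c 0 xi) = hartley (gauss c 0) z.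
  rewrite /hartley -[LHS]addr0 -(Jsin z) -JD; [|exact: dcos|exact: dsin].
  by congr J; apply/funext => xi; rewrite [RHS]mulrDl.
transitivity (hartley (gauss c 0 : V -> R) (y - x)).
  rewrite -Jcos -[RHS]addr0 -(Jsin (y + x)) -JD; [|exact: dcos|exact: dsin].
  congr J; apply/funext => xi.
  by rewrite mulrA casD [LHS]mulrDl [dotv x xi]dotvC -mulrBr -mulrDr dotvDr dotvDr dotvNr.
by rewrite hartley_gauss// /gauss subr0.
Qed.

Lemma linear_bound_eq0 (a K : R) : (forall r, 0 < r <= 1 -> a <= K * r) -> a <= 0.
Proof.
move=> H; rewrite leNgt; apply/negP => a0.
have K0 : 0 < K by have := H 1; rewrite ltr01 lexx mulr1 => /(_ isT); exact: lt_le_trans.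
pose r := Num.min 1 (a / (2 * K)).
have aK : 0 < a / (2 * K) by rewrite divr_gt0// mulr_gt0.
have r0 : 0 < r by rewrite lt_min ltr01.
have := H r; rewrite r0 ge_min lexx => /(_ isT).
apply/negP; rewrite -ltNge (@le_lt_trans _ _ (K * (a / (2 * K))))//.
  by rewrite ler_pM2l// ge_min lexx orbT.
have -> : K * (a / (2 * K)) = a / 2 by field; rewrite lt0r_neq0.
by rewrite ltr_pdivrMr// ltr_pMr// ltr1n.
Qed.

(** A factor expR (- r^2 |xi|^2) is inserted in the outer transform, and symmetry moves the inner
    transform onto the kernel. The double transform at x becomes the mean of g against a Gaussian of
    mass one centred at x. Both errors are O(r): one by 1 - expR (- r^2 |xi|^2) <= r |xi|^2 for r <=
    1, the other by the Lipschitz bound on g. *)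
Lemma hartleyK f t : sw f -> hartley (hartley (f t)) = f t.
Proof.
move=> sf; apply/funext => x.
have sH := sw_hartley sf.
have dG := sw_dom t sf; have dH := sw_dom t sH; have [M fM] := sw_lipschitz sf.
have M0 : 0 <= M.
  have := fM t (t + 1) x x; rewrite big1 => [|i _]; last by rewrite subrr normr0.
  rewrite addr0 addrAC subrr add0r normr1 mulr1; exact: le_trans.
pose g := f t; rewrite -/g in dG dH *.
pose D xi := dotv xi xi * hartley g xi.
have dD : dom D.
  have -> : D = fun xi => \sum_i xi i 0 * (xi i 0 * hartley g xi).
    apply/funext => xi; rewrite /D /dotv mulr_suml.
    by apply: eq_bigr => i _; rewrite mulrA.
  by apply: dom_sum => i; exact: (sw_dotv i i t sH).
(* [A] and [B] bound the two errors divided by r: [A] that of the inserted factor, [B] the Lipschitz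
   constant times a first moment, where [Num.sqrt 2 ^+ n] comes from the halved exponent. *)
pose A := 2 * J (fun xi => `|D xi|).
pose B := M * (n%:R * (2 / pi * Num.sqrt 2 ^+ n)).
apply/eqP; rewrite -subr_eq0 -normr_le0.
apply: (@linear_bound_eq0 _ (A + B)) => r /andP[r0 r1].
have p0 : (pi : R) != 0 by rewrite lt0r_neq0// pi_gt0.
have [k kdef] : exists k, k = pi / r by exists (pi / r).
have k0 : 0 < k by rewrite kdef divr_gt0// pi_gt0.
have k20 : 0 < k ^+ 2 by exact: exprn_gt0.
have s0 : 0 < r ^+ 2 by exact: exprn_gt0.
pose E xi := cas (2 * pi * dotv x xi) * gauss (r ^+ 2) 0 xi.
have dE : dom E.
  have -> : E = fun xi => cas (2 * pi * dotv xi x) * gauss (r ^+ 2) 0 xi.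
    by apply/funext => xi; rewrite /E dotvC.
  by apply/dom_cas/dom_gauss.
pose c := Num.sqrt (pi / r ^+ 2) ^+ n.
have kE : pi ^+ 2 / r ^+ 2 = k ^+ 2 by rewrite kdef expr_div_n.
have HE y : hartley E y = c * gauss (k ^+ 2) x y by rewrite hartley_cas_gauss// kE.
(* As k = pi / r, the two normalizing factors are inverse to each other. *)
have cJ : c * J (gauss (k ^+ 2) x) = 1.
  rewrite J_gauss// /c -exprMn -sqrtrM; last by rewrite divr_ge0 ?pi_ge0// sqr_ge0.
  have -> : pi / r ^+ 2 * (pi / k ^+ 2) = 1 :> R.
    by move: p0; rewrite kdef; move: (pi : R) => p p0; field; rewrite p0 lt0r_neq0.
  by rewrite sqrtr1 expr1n.
have c0 : 0 <= c by rewrite exprn_ge0// sqrtr_ge0.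
have dgs := @dom_gauss R n (k ^+ 2) x k20.
have dgs2 : dom (gauss (k ^+ 2 / 2) x) by apply: dom_gauss; rewrite divr_gt0.
have bG : exists C, forall y, `|g y| <= C by have [C fC] := sw_bounded sf; exists C => y; exact: fC.
have cg : continuous g by case: dG.
have dgE : dom (fun y => g y * gauss (k ^+ 2) x y) by have [C gC] := bG; exact: (domM cg gC).
have bcas y : dom (fun xi => cas (2 * pi * dotv xi y) * hartley g xi) by exact: dom_cas.
have [CH HC] := sw_bounded sH.
have dHE : dom (fun xi => hartley g xi * E xi) by apply: (domM (C := CH)) => // [|xi]; [case: dH|exact: HC].
have sym := hartley_sym dG dE.
have -> : hartley (hartley g) x - g x =
    (J (fun xi => cas (2 * pi * dotv xi x) * hartley g xi) - J (fun xi => hartley g xi * E xi))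
  + (J (fun y => g y * hartley E y) - g x).
  by rewrite sym addrA subrK.
rewrite (le_trans (ler_normD _ _))// [leRHS]mulrDl; apply: lerD.
  rewrite -JB//.
  have dL : dom (fun xi => cas (2 * pi * dotv xi x) * hartley g xi - hartley g xi * E xi).
    by apply: domD => //; exact: domN.
  rewrite (le_trans (J_norm dL))// /A mulrAC -JZ; last exact: dom_norm.
  apply: J_le; [exact: dom_norm|exact/domZ/dom_norm|move=> xi].
  have -> : cas (2 * pi * dotv xi x) * hartley g xi - hartley g xi * E xi =
     cas (2 * pi * dotv x xi) * (1 - gauss (r ^+ 2) 0 xi) * hartley g xi.
    by rewrite /E dotvC; ring.
  rewrite /D !normrM [`|dotv _ _|]ger0_norm ?dotvv_ge0// mulrA ler_wpM2r//.
  rewrite -[leRHS]mulrA; apply: ler_pM => //; first exact: cas_le2.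
  have h0 : 0 <= r ^+ 2 * dotv xi xi by rewrite mulr_ge0 ?dotvv_ge0// ltW.
  have h1 : 1 - gauss (r ^+ 2) 0 xi <= r ^+ 2 * dotv xi xi.
    rewrite /gauss !subr0; have := expR_ge1Dx (- (r ^+ 2 * dotv xi xi)); lra.
  have h2 : gauss (r ^+ 2) 0 xi <= 1 by rewrite /gauss !subr0 -expR0 ler_expR oppr_le0.
  rewrite ger0_norm ?subr_ge0// (le_trans h1)// ler_wpM2r ?dotvv_ge0//.
  by rewrite expr2 ler_piMr// ltW.
have -> : J (fun y => g y * hartley E y) - g x =
    c * J (fun y => g y * gauss (k ^+ 2) x y - g x * gauss (k ^+ 2) x y).
  rewrite JB//; last exact: domZ.
  rewrite [J (fun y => g x * _)]JZ// mulrBr -[c * J (fun y => g y * _)]JZ//.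
  rewrite [c * (g x * _)]mulrCA cJ mulr1; congr (J _ - _).
  by apply/funext => y; rewrite HE mulrCA.
have dL : dom (fun y => g y * gauss (k ^+ 2) x y - g x * gauss (k ^+ 2) x y).
  by apply: domD => //; apply/domN/domZ.
rewrite normrM ger0_norm//.
apply: (@le_trans _ _ (c * J (fun y => (M * (n%:R * (2 / k))) * gauss (k ^+ 2 / 2) x y))).
  apply: ler_wpM2l => //; rewrite (le_trans (J_norm dL))//.
  apply: J_le; [exact: dom_norm|exact: domZ|move=> y].
  rewrite -mulrBl normrM [X in _ * X]ger0_norm ?expR_ge0//.
  have := fM t t x y; rewrite subrr normr0 add0r -/g => H.
  rewrite (le_trans (ler_wpM2r (expR_ge0 _) H))//.
  rewrite -[leLHS]mulrA -[leRHS]mulrA; apply: ler_wpM2l => //.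
  rewrite mulr_suml; apply: (@le_trans _ _ (\sum_(i < n) 2 / k * gauss (k ^+ 2 / 2) x y)).
    by apply: ler_sum => i _; exact: gauss_first_moment.
  by rewrite sumr_const card_ord -[leLHS]mulr_natl [leLHS]mulrA.
rewrite JZ// J_gauss ?divr_gt0// /B.
have -> : c * (M * (n%:R * (2 / k)) * Num.sqrt (pi / (k ^+ 2 / 2)) ^+ n) =
    M * (n%:R * (2 / k)) * (c * Num.sqrt (pi / (k ^+ 2 / 2)) ^+ n) by ring.
have -> : c * Num.sqrt (pi / (k ^+ 2 / 2)) ^+ n = Num.sqrt 2 ^+ n.
  rewrite /c -exprMn -sqrtrM; last by rewrite divr_ge0 ?pi_ge0// sqr_ge0.
  congr (Num.sqrt _ ^+ n).
  by move: p0; rewrite kdef; move: (pi : R) => p p0; field; rewrite p0 lt0r_neq0.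
rewrite le_eqVlt; apply/orP; left; apply/eqP.
by move: p0; rewrite kdef; move: (pi : R) => p p0; field; rewrite p0 lt0r_neq0.
Qed.

Lemma hartley_plancherel f t : sw f ->
  J (fun xi => hartley (f t) xi ^+ 2) = J (fun x => f t x ^+ 2).
Proof.
move=> sf; have sH := sw_hartley sf.
under [X in J X]eq_fun do rewrite expr2.
rewrite (hartley_sym (sw_dom t sf) (sw_dom t sH)) (hartleyK t sf).
by congr J; apply/funext => x; rewrite expr2.
Qed.

End hartley_inversion.

(** * Weights differentiated along the drift *)

Section weights.
Context (R : realType) (n : nat).
Local Notation V := 'cV[R]_n.
Local Notation e i := (delta_mx i 0 : V).
Implicit Types (m h : V -> R) (x : V).

Definition poly_bounded h := exists C k, forall x, `|h x| <= C * (1 + dotv x x) ^+ k.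

Lemma oneDdotv_ge1 x : 1 <= 1 + dotv x x.
Proof. by rewrite lerDl dotvv_ge0. Qed.

Lemma poly_bounded_mono h : poly_bounded h ->
  exists2 C, 0 <= C & exists k0, forall k x, (k0 <= k)%N -> `|h x| <= C * (1 + dotv x x) ^+ k.
Proof.
move=> [C [k hC]]; exists `|C| => //; exists k => l x kl.
rewrite (le_trans (hC x))// (@le_trans _ _ (`|C| * (1 + dotv x x) ^+ k))//.
  by rewrite ler_wpM2r ?ler_norm// exprn_ge0// (le_trans _ (oneDdotv_ge1 x)).
by rewrite ler_wpM2l// ler_weXn2l// oneDdotv_ge1.
Qed.

Lemma poly_boundedD h1 h2 : poly_bounded h1 -> poly_bounded h2 ->
  poly_bounded (fun x => h1 x + h2 x).
Proof.
move=> /poly_bounded_mono[C1 C10 [k1 h1C]] /poly_bounded_mono[C2 C20 [k2 h2C]].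
exists (C1 + C2), (maxn k1 k2) => x; rewrite mulrDl (le_trans (ler_normD _ _))//.
by apply: lerD; [apply: h1C; exact: leq_maxl|apply: h2C; exact: leq_maxr].
Qed.

Lemma poly_boundedM h1 h2 : poly_bounded h1 -> poly_bounded h2 ->
  poly_bounded (fun x => h1 x * h2 x).
Proof.
move=> [C1 [k1 h1C]] [C2 [k2 h2C]]; exists (C1 * C2), (k1 + k2)%N => x.
by rewrite normrM exprD mulrACA ler_pM.
Qed.

Lemma poly_bounded_cst c : poly_bounded (fun=> c).
Proof. by exists `|c|, 0%N => x; rewrite expr0 mulr1. Qed.

Lemma poly_bounded_le h1 h2 : poly_bounded h2 -> (forall x, `|h1 x| <= `|h2 x|) ->
  poly_bounded h1.
Proof. by move=> [C [k hC]] h12; exists C, k => x; rewrite (le_trans (h12 x)). Qed.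

Lemma poly_bounded_coord i : poly_bounded (fun x => x i 0).
Proof.
exists 1, 1%N => x; rewrite expr1 mul1r.
have h : (x i 0) ^+ 2 <= dotv x x.
  by rewrite /dotv (bigD1 i)//= -expr2 lerDl sumr_ge0// => j _; rewrite -expr2 sqr_ge0.
have : 0 <= (`|x i 0| - 1) ^+ 2 by exact: sqr_ge0.
rewrite -[(x i 0) ^+ 2]real_normK ?num_real// in h.
have h0 := normr_ge0 (x i 0).
move: h h0; move: (`|x i 0|) (dotv x x) => u v; nra.
Qed.

Lemma poly_bounded_sum (I : Type) (r : seq I) (h : I -> V -> R) :
  (forall i, poly_bounded (h i)) -> poly_bounded (fun x => \sum_(i <- r) h i x).
Proof.
move=> ph; elim: r => [|i r IH].
  by under eq_fun do rewrite big_nil; exact: poly_bounded_cst.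
by under eq_fun do rewrite big_cons; exact: poly_boundedD.
Qed.

Lemma poly_bounded_linear (M : 'M[R]_n) i : poly_bounded (fun x => (M *m x) i 0).
Proof.
under eq_fun do rewrite mxE; apply: poly_bounded_sum => j.
by apply: poly_boundedM; [exact: poly_bounded_cst|exact: poly_bounded_coord].
Qed.

Lemma poly_bounded_sw h (f : R -> V -> R) : poly_bounded h -> sw f ->
  exists C, forall t x, `|h x * f t x| <= C * Wt x.
Proof.
move=> [C [k hC]] sf.
have sk : sw (fun t x => (1 + dotv x x) ^+ k * f t x).
  elim: k {hC} => [|k IH].
    by under eq_fun do under eq_fun do rewrite expr0 mul1r.
  under eq_fun do under eq_fun do rewrite exprS -mulrA mulrDl mul1r.
  apply: swD => //; rewrite /dotv.
  under eq_fun do under eq_fun do rewrite mulr_suml.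
  apply: sw_sum => [|i]; first exact: sw0.
  have := sw_xmul i (sw_xmul i IH).
  by congr sw; apply/funext => t; apply/funext => x; rewrite /xmul mulrA.
have [D fD] := sw_Wt sk; exists (`|C| * D) => t x.
rewrite normrM -mulrA (le_trans _ (ler_wpM2l (normr_ge0 C) (fD t x)))// normrM mulrA.
rewrite ler_wpM2r// (le_trans (hC x))// [`|_ ^+ k|]ger0_norm; last first.
  by rewrite exprn_ge0// (le_trans _ (oneDdotv_ge1 x)).
rewrite ler_wpM2r ?ler_norm//.
by rewrite exprn_ge0// (le_trans _ (oneDdotv_ge1 x)).
Qed.

Lemma dom_poly_sw h f t : continuous h -> poly_bounded h -> sw f ->
  dom (fun x => h x * f t x).
Proof.
move=> ch ph sf; split; last first.
  by have [C hC] := poly_bounded_sw ph sf; exists C.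
by apply: continuousTM => //; exact: sw_continuous.
Qed.

Lemma continuous_linear_form (M : 'M[R]_n) i : continuous (fun x : V => (M *m x) i 0).
Proof.
under eq_fun do rewrite mxE; apply: continuous_sum => j.
by apply: continuousTZ; exact: continuous_coord.
Qed.

Definition weight m (dm : 'I_n -> V -> R) :=
  [/\ continuous m, forall i, continuous (dm i),
      forall i x, is_derive x (e i) m (dm i x),
      poly_bounded m & forall i, poly_bounded (dm i)].

Definition drift (B : 'M[R]_n) (dm : 'I_n -> V -> R) x :=
  \sum_i (B^T *m x) i 0 * dm i x.

(** A relation between a weight and its derivative along (B^T x) . grad. Composite weights get their
    derivative from the closure rules below, together with the continuity and the polynomial growth
    needed to integrate them. *)
Definition drift_weight B m Xm :=
  exists2 dm, weight m dm & forall x, Xm x = drift B dm x.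

Variable B : 'M[R]_n.
Local Notation wX := (drift_weight B).

Lemma wX_cst c : wX (fun=> c) (fun=> 0).
Proof.
exists (fun _ _ => 0); last by move=> x; rewrite /drift big1// => i _; rewrite mulr0.
split.
- exact: cst_continuous.
- by move=> i; exact: cst_continuous.
- by move=> i x; exact: is_derive_cst.
- exact: poly_bounded_cst.
- by move=> i; exact: poly_bounded_cst.
Qed.

Lemma is_derive_linear (M : 'M[R]_n) k i x :
  is_derive x (e i) (fun x => (M *m x) k 0) (M k i).
Proof.
apply: (@is_derive_quadratic _ _ _ _ _ _ 0) => h.
rewrite mul0r mulmxDr -scalemxAr !mxE addrK.
rewrite (bigD1 i)//= big1 => [|j ji]; last by rewrite !mxE (negbTE ji) mulr0.
by rewrite !mxE !eqxx mulr1 addr0 subrr normr0.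
Qed.

Lemma wX_linear (M : 'M[R]_n) k :
  wX (fun x => (M *m x) k 0) (fun x => (M *m (B^T *m x)) k 0).
Proof.
exists (fun i _ => M k i); last first.
  by move=> x; rewrite /drift mxE; apply: eq_bigr => i _; rewrite mulrC.
split.
- exact: continuous_linear_form.
- by move=> i; exact: cst_continuous.
- by move=> i x; exact: is_derive_linear.
- exact: poly_bounded_linear.
- by move=> i; exact: poly_bounded_cst.
Qed.

Lemma wXD m1 X1 m2 X2 : wX m1 X1 -> wX m2 X2 ->
  wX (fun x => m1 x + m2 x) (fun x => X1 x + X2 x).
Proof.
move=> [d1 [c1 cd1 D1 p1 pd1] E1] [d2 [c2 cd2 D2 p2 pd2] E2].
exists (fun i x => d1 i x + d2 i x); last first.
  move=> x; rewrite E1 E2 /drift -big_split /=.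
  by apply: eq_bigr => i _; rewrite mulrDr.
split.
- exact: continuousTD.
- by move=> i; exact: continuousTD.
- by move=> i x; exact: is_deriveD.
- exact: poly_boundedD.
- by move=> i; exact: poly_boundedD.
Qed.

Lemma wXM m1 X1 m2 X2 : wX m1 X1 -> wX m2 X2 ->
  wX (fun x => m1 x * m2 x) (fun x => X1 x * m2 x + m1 x * X2 x).
Proof.
move=> [d1 [c1 cd1 D1 p1 pd1] E1] [d2 [c2 cd2 D2 p2 pd2] E2].
exists (fun i x => d1 i x * m2 x + m1 x * d2 i x); last first.
  move=> x; rewrite E1 E2 /drift mulr_suml mulr_sumr -big_split /=.
  by apply: eq_bigr => i _; ring.
split.
- exact: continuousTM.
- by move=> i; apply: continuousTD; exact: continuousTM.
- move=> i x; have := is_deriveM (D1 i x) (D2 i x).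
  by congr is_derive; rewrite /GRing.scale /=; ring.
- exact: poly_boundedM.
- by move=> i; apply: poly_boundedD; exact: poly_boundedM.
Qed.

Lemma wX_ext m1 X1 m2 X2 : wX m1 X1 -> m1 =1 m2 -> X1 =1 X2 -> wX m2 X2.
Proof. by move=> H /funext <- /funext <-. Qed.

Lemma wXZ c m X : wX m X -> wX (fun x => c * m x) (fun x => c * X x).
Proof.
move=> w; apply: (wX_ext (wXM (wX_cst c) w)) => // x.
by rewrite mul0r add0r.
Qed.

Lemma wX_sum (I : Type) (r : seq I) (m X : I -> V -> R) :
  (forall i, wX (m i) (X i)) ->
  wX (fun x => \sum_(i <- r) m i x) (fun x => \sum_(i <- r) X i x).
Proof.
move=> w; elim: r => [|i r IH].
  by apply: (wX_ext (wX_cst 0)) => x; rewrite big_nil.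
by apply: (wX_ext (wXD (w i) IH)) => x; rewrite big_cons.
Qed.

Lemma wX_comp (h dh : R -> R) m X : wX m X ->
  (forall x, is_derive (m x) (1 : R) h (dh (m x))) ->
  (forall x, {for m x, continuous dh}) ->
  poly_bounded (fun x => h (m x)) -> poly_bounded (fun x => dh (m x)) ->
  wX (fun x => h (m x)) (fun x => dh (m x) * X x).
Proof.
move=> [d [c cd D p pd] E] hd cdh ph pdh.
exists (fun i x => dh (m x) * d i x); last first.
  move=> x; rewrite E /drift mulr_sumr.
  by apply: eq_bigr => i _; rewrite mulrCA.
have cdhm : continuous (fun x => dh (m x)).
  by move=> x; apply: continuous_comp; [exact: c|exact: cdh].
split.
- move=> x; apply: continuous_comp; first exact: c.
  by apply: differentiable_continuous; apply/derivable1_diffP; case: (hd x).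
- by move=> i; exact: continuousTM.
- move=> i x.
  pose L (s : R) : V := s *: e i + x.
  have LE (s : R) : L (s *: (1 : R) + 0) = s *: e i + L 0.
    by rewrite /L addr0 scale0r add0r /GRing.scale /= mulr1.
  have L0 : L 0 = x by rewrite /L scale0r add0r.
  rewrite -{1}L0; apply: (is_derive_affine_inv (phi := L) (w := (1 : R)) LE).
  have H1 : is_derive (0 : R) (1 : R) (fun s : R => m (L s)) (d i x).
    by apply: (is_derive_affine (phi := L) (v := e i) LE); rewrite L0.
  have H2 : is_derive (m (L 0)) (1 : R) h (dh (m x)) by rewrite L0.
  exact: (@is_derive1_comp _ h (fun s => m (L s)) 0 _ _ H2 H1).
- exact: ph.
- by move=> i; exact: poly_boundedM.
Qed.

End weights.

(** * Powers of Japanese brackets as weights *)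

Section brackets.
Context (R : realType) (n : nat).
Local Notation V := 'cV[R]_n.
Local Notation e i := (delta_mx i 0 : V).
Implicit Types (x y : V) (M N : 'M[R]_n).

Lemma dotvE x y : dotv x y = (x^T *m y) 0 0.
Proof. by rewrite mxE; apply: eq_bigr => i _; rewrite mxE. Qed.

Lemma dotv_mulmxl M x y : dotv (M *m x) y = dotv x (M^T *m y).
Proof. by rewrite !dotvE trmx_mul mulmxA. Qed.

(** Cauchy-Schwarz, from the nonnegativity of the square of (y . y) x - (x . y) y; the case y = 0 is
    apart. *)
Lemma dotv_sqr_le x y : dotv x y ^+ 2 <= dotv x x * dotv y y.
Proof.
have [y0|yn0] := eqVneq (dotv y y) 0.
  have yi i : y i 0 = 0.
    apply/eqP; rewrite -sqrf_eq0; apply/eqP/le_anti; rewrite sqr_ge0 andbT -y0.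
    by rewrite /dotv (bigD1 i)//= -expr2 lerDl sumr_ge0// => j _; rewrite -expr2 sqr_ge0.
  by rewrite y0 mulr0 /dotv big1 ?expr0n// => i _; rewrite yi mulr0.
have yp : 0 < dotv y y by rewrite lt_neqAle eq_sym yn0 dotvv_ge0.
have := dotvv_ge0 (dotv y y *: x + (- dotv x y) *: y).
rewrite dotvDl !dotvDr !dotvZl !dotvZr [dotv y x]dotvC.
move: (dotv x x) (dotv x y) (dotv y y) yp => a b c c0 h.
have : 0 <= c * (a * c - b ^+ 2) by rewrite (le_trans h)// le_eqVlt; apply/orP; left; apply/eqP; ring.
by rewrite pmulr_rge0// subr_ge0.
Qed.

Lemma bracket_ge1 x : 1 <= bracket x.
Proof. by rewrite /bracket -[leLHS]sqrtr1 ler_wsqrtr// oneDdotv_ge1. Qed.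

Lemma bracket_gt0 x : 0 < bracket x.
Proof. exact: lt_le_trans (bracket_ge1 x). Qed.

Lemma bracket_sqr x : bracket x ^+ 2 = 1 + dotv x x.
Proof. by rewrite sqr_sqrtr// (le_trans _ (oneDdotv_ge1 x)). Qed.

Lemma bracketN x : bracket (- x) = bracket x.
Proof. by rewrite /bracket dotvNl dotvNr opprK. Qed.

Lemma dotv_le_bracket x y : `|dotv x y| <= bracket x * bracket y.
Proof.
rewrite -(@ler_pXn2r R 2)// ?nnegrE ?mulr_ge0 ?(ltW (bracket_gt0 _))//.
rewrite real_normK ?num_real// exprMn !bracket_sqr (le_trans (dotv_sqr_le x y))//.
by apply: ler_pM; rewrite ?dotvv_ge0// lerDr.
Qed.

Lemma mulmx_norm_le M : exists2 C, 0 <= C &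
  forall x, dotv (M *m x) (M *m x) <= C * dotv x x.
Proof.
pose C := \sum_i \sum_j M i j ^+ 2.
exists C; first by apply: sumr_ge0 => i _; apply: sumr_ge0 => j _; exact: sqr_ge0.
move=> x; rewrite {1}/dotv /C mulr_suml; apply: ler_sum => i _.
pose v : V := \col_j M i j.
have -> : (M *m x) i 0 = dotv v x by rewrite mxE; apply: eq_bigr => j _; rewrite mxE.
rewrite -expr2 (le_trans (dotv_sqr_le _ _))// ler_wpM2r ?dotvv_ge0//.
by rewrite /dotv; under eq_bigr do rewrite mxE -expr2.
Qed.

Lemma bracket_mulmx_le M : exists2 C, 1 <= C & forall x, bracket (M *m x) <= C * bracket x.
Proof.
have [C C0 MC] := mulmx_norm_le M; exists (1 + C); first by rewrite lerDl.
move=> x; have C1 : 0 <= 1 + C by rewrite addr_ge0.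
rewrite -(@ler_pXn2r R 2)// ?nnegrE ?mulr_ge0 ?(ltW (bracket_gt0 _))//.
rewrite exprMn !bracket_sqr.
have := MC x; have := dotvv_ge0 x.
move: (dotv x x) (dotv _ _) => u v u0 h; nra.
Qed.

Lemma poly_bounded_bracket_pow M c : poly_bounded (fun x => bracket (M *m x) `^ c).
Proof.
have [C C1 MC] := bracket_mulmx_le M.
have [k ck] : exists k : nat, c <= k%:R.
  by exists (Num.bound `|c|); rewrite (le_trans (ler_norm _))// ltW// archi_boundP.
exists (C ^+ k), k => x.
have b1 := bracket_ge1 (M *m x).
rewrite ger0_norm ?powR_ge0// (le_trans (ler_powR b1 ck))//.
rewrite powR_mulrn ?(ltW (bracket_gt0 _))// -exprMn lerXn2r ?nnegrE//.
- exact: ltW (bracket_gt0 _).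
- by apply: mulr_ge0; [exact: le_trans C1|exact: le_trans (oneDdotv_ge1 x)].
- rewrite (le_trans (MC x))// ler_wpM2l ?(le_trans _ C1)// -bracket_sqr.
  by rewrite expr2 ler_peMl ?bracket_ge1// ltW// bracket_gt0.
Qed.

Lemma bracket_powE x c : bracket x `^ c = (1 + dotv x x) `^ (c / 2).
Proof. by rewrite /bracket -powR12_sqrt ?(le_trans _ (oneDdotv_ge1 x))// -powRrM mulrC. Qed.

Lemma is_derive_compV (W : normedModType R) (m : W -> R) (h : R -> R) (z v : W) (d dh : R) :
  is_derive z v m d -> is_derive (m z) (1 : R) h dh ->
  is_derive z v (fun w => h (m w)) (dh * d).
Proof.
move=> md hd.
pose L (s : R) : W := s *: v + z.
have LE (s : R) : L (s *: (1 : R) + 0) = s *: v + L 0.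
  by rewrite /L addr0 scale0r add0r /GRing.scale /= mulr1.
have L0 : L 0 = z by rewrite /L scale0r add0r.
rewrite -L0; apply: (is_derive_affine_inv (phi := L) (w := (1 : R)) LE).
have H1 : is_derive (0 : R) (1 : R) (fun s : R => m (L s)) d.
  by apply: (is_derive_affine (phi := L) (v := v) LE); rewrite L0.
have H2 : is_derive (m (L 0)) (1 : R) h dh by rewrite L0.
exact: (@is_derive1_comp _ h (fun s => m (L s)) 0 _ _ H2 H1).
Qed.

Lemma is_derive_dotv M i x :
  is_derive x (e i) (fun x => 1 + dotv (M *m x) (M *m x)) (2 * ((M^T *m M) *m x) i 0).
Proof.
apply: (@is_derive_quadratic _ _ _ _ _ _ (dotv (M *m e i) (M *m e i))) => h.
have E : dotv (M *m e i) (M *m x) = ((M^T *m M) *m x) i 0.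
  by rewrite dotv_mulmxl dotv_delta mulmxA.
rewrite mulmxDr -scalemxAr dotvDl !dotvDr !dotvZl !dotvZr [dotv (M *m x) (M *m e i)]dotvC E.
have d0 := dotvv_ge0 (M *m e i).
rewrite [X in `|X|](_ : _ = dotv (M *m e i) (M *m e i) * h ^+ 2); last by ring.
by rewrite ger0_norm// mulr_ge0// sqr_ge0.
Qed.

Lemma is_derive_bracket_pow M c i x :
  is_derive x (e i) (fun x => bracket (M *m x) `^ c)
    (c * bracket (M *m x) `^ (c - 2) * ((M^T *m M) *m x) i 0).
Proof.
have u0 : 0 < 1 + dotv (M *m x) (M *m x) by exact: lt_le_trans (oneDdotv_ge1 _).
under eq_fun do rewrite bracket_powE; rewrite bracket_powE.
have := is_derive_compV (is_derive_dotv M i x) (is_derive1_powR (c / 2) u0).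
have -> : (c - 2) / 2 = c / 2 - 1 by field.
by congr is_derive; field.
Qed.

Lemma continuous_bracket_pow M c : continuous (fun x : V => bracket (M *m x) `^ c).
Proof.
under eq_fun do rewrite bracket_powE.
have cu : continuous (fun x : V => 1 + dotv (M *m x) (M *m x)).
  apply: continuousTD; first exact: cst_continuous.
  by apply: continuous_sum => i; apply: continuousTM; exact: continuous_linear_form.
move=> x; apply: (@continuous_comp V R R (fun x : V => 1 + dotv (M *m x) (M *m x)) (fun y : R => y `^ (c / 2))).
  exact: cu.
have u0 : 0 < 1 + dotv (M *m x) (M *m x) by exact: lt_le_trans (oneDdotv_ge1 _).
apply: differentiable_continuous; apply/derivable1_diffP.
by case: (is_derive1_powR (c / 2) u0).
Qed.

Lemma wX_bracket_pow (B M : 'M[R]_n) c :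
  drift_weight B (fun x => bracket (M *m x) `^ c)
    (fun x => c * bracket (M *m x) `^ (c - 2) * dotv (M *m x) (M *m (B^T *m x))).
Proof.
exists (fun i x => c * bracket (M *m x) `^ (c - 2) * ((M^T *m M) *m x) i 0); last first.
  move=> x; rewrite /drift [dotv _ _]dotvC dotv_mulmxl mulmxA /dotv mulr_sumr.
  by apply: eq_bigr => i _; rewrite mulrCA.
split.
- exact: continuous_bracket_pow.
- move=> i; apply: continuousTM; last exact: continuous_linear_form.
  by apply: continuousTZ; exact: continuous_bracket_pow.
- by move=> i x; exact: is_derive_bracket_pow.
- exact: poly_bounded_bracket_pow.
- move=> i; apply: poly_boundedM; last exact: poly_bounded_linear.
  by apply: poly_boundedM; [exact: poly_bounded_cst|exact: poly_bounded_bracket_pow].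
Qed.

Lemma wX_dotv (B M N : 'M[R]_n) :
  drift_weight B (fun x => dotv (M *m x) (N *m x))
    (fun x => dotv (M *m (B^T *m x)) (N *m x) + dotv (M *m x) (N *m (B^T *m x))).
Proof.
apply: (wX_ext (wX_sum (index_enum 'I_n) (fun i => wXM (wX_linear B M i) (wX_linear B N i)))) => // x.
by rewrite big_split.
Qed.

Lemma sw_linear (f : R -> V -> R) M i : sw f -> sw (fun t x => (M *m x) i 0 * f t x).
Proof.
move=> sf; under eq_fun do under eq_fun do rewrite mxE mulr_suml.
apply: sw_sum => [|j]; first exact: sw0.
under eq_fun do under eq_fun do rewrite -mulrA.
exact/swZ/sw_xmul.
Qed.

(** The Leibniz rule turns <M x>^c f into a sum of two terms of the same form, with the exponents c
    and c - 2. Closing under sums makes the class stable under derivatives, as coinduction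
    requires. *)
Inductive bracket_class (M : 'M[R]_n) : (R -> V -> R) -> Prop :=
| bracket_class_base c f : sw f ->
    bracket_class M (fun t x => bracket (M *m x) `^ c * f t x)
| bracket_class_add f g : bracket_class M f -> bracket_class M g ->
    bracket_class M (fun t x => f t x + g t x).

Lemma sw_bracket_pow M c (f : R -> V -> R) : sw f ->
  sw (fun t x => bracket (M *m x) `^ c * f t x).
Proof.
move=> sf; apply: (@sw_ind _ _ (bracket_class M)); last exact: bracket_class_base.
move=> {c f sf}h; elim=> {h} [c f sf|f g _ [bf [tf tfC tfD] pf xf] _ [bg [tg tgC tgD] pg xg]].
  split.
  - have [C fC] := poly_bounded_sw (poly_bounded_bracket_pow M c) sf.
    exists `|C| => t x; rewrite (le_trans (fC t x))// (le_trans (ler_norm _))// normrM.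
    by rewrite ler_piMr// ger0_norm ?Wt_le1// ltW// Wt_gt0.
  - exists (fun t x => bracket (M *m x) `^ c * tderiv f t x).
      exact/bracket_class_base/sw_tderiv.
    by move=> t x; apply: is_deriveZ; exact: sw_is_tderive.
  - move=> i; exists (fun t x => bracket (M *m x) `^ c * pderiv i f t x +
      bracket (M *m x) `^ (c - 2) * (c * (((M^T *m M) *m x) i 0 * f t x))).
      apply: bracket_class_add; first exact/bracket_class_base/sw_pderiv.
      exact/bracket_class_base/swZ/sw_linear.
    move=> t x; have := is_deriveM (is_derive_bracket_pow M c i x) (sw_is_pderive sf i t x).
    by congr is_derive; rewrite /GRing.scale /=; ring.
  - move=> i; have := bracket_class_base M c (sw_xmul i sf).
    by congr bracket_class; apply/funext => t; apply/funext => x; rewrite /xmul mulrCA.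
split.
- have [C fC] := bf; have [D gD] := bg.
  by exists (C + D) => t x; rewrite (le_trans (ler_normD _ _))// lerD.
- exists (fun t x => tf t x + tg t x); first exact: bracket_class_add.
  by move=> t x; exact: is_deriveD.
- move=> i; have [p pC pD] := pf i; have [q qC qD] := pg i.
  exists (fun t x => p t x + q t x); first exact: bracket_class_add.
  by move=> t x; exact: is_deriveD.
- move=> i; have := bracket_class_add (xf i) (xg i).
  by congr bracket_class; apply/funext => t; apply/funext => x; rewrite /xmul mulrDr.
Qed.

End brackets.

(** * Construction of the multiplier *)

Section cutoff.
Context (R : realType).
Implicit Types t : R.

Definition pos_part t : R := Num.max 0 t.

Lemma pos_part_ge0 t : 0 <= pos_part t.
Proof. by rewrite /pos_part le_max lexx. Qed.

Lemma is_derive_pos_part_sqr t :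
  is_derive t (1 : R) (fun s => pos_part s ^+ 2) (2 * pos_part t).
Proof.
apply: (@is_derive_quadratic _ _ _ _ _ _ 1) => h.
have -> : h *: (1 : R) = h by rewrite /GRing.scale /= mulr1.
rewrite /pos_part mul1r ler_norml.
have [h0|h0] := leP 0 (h + t); have [t0|t0] := leP 0 t; apply/andP; split; nra.
Qed.

Lemma continuous_pos_part : continuous pos_part.
Proof.
have E t : pos_part t = (t + `|t|) / 2.
  by rewrite /pos_part; have [t0|t0] := leP 0 t; [rewrite ger0_norm//|rewrite ltr0_norm//]; field.
rewrite (_ : pos_part = fun t => 2^-1 * (t + `|t|)); last by apply/funext => t; rewrite E mulrC.
apply: continuousTZ; apply: continuousTD; last exact: norm_continuous.
by move=> t; exact: cvg_id.
Qed.

(* A C^1 cutoff, equal to 1 on ]-oo, 1] and to 0 on [2, +oo[. *)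
Definition chi t := pos_part (1 - pos_part (t - 1) ^+ 2) ^+ 2.
Definition dchi t := - (4 * pos_part (1 - pos_part (t - 1) ^+ 2) * pos_part (t - 1)).

Lemma is_derive_chi t : is_derive t (1 : R) chi (dchi t).
Proof.
have H1 : is_derive t (1 : R) (fun s => pos_part (s - 1) ^+ 2) (2 * pos_part (t - 1)).
  apply: (is_derive_affine (phi := fun s : R => s - 1) (v := (1 : R)) _ (is_derive_pos_part_sqr (t - 1))) => h.
  by rewrite addrA.
have H2 : is_derive t (1 : R) (fun s => 1 - pos_part (s - 1) ^+ 2) (0 - 2 * pos_part (t - 1)).
  by apply: is_deriveB.
have := is_derive_compV H2 (is_derive_pos_part_sqr (1 - pos_part (t - 1) ^+ 2)).
by congr is_derive; rewrite /dchi; ring.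
Qed.

Lemma continuous_dchi : continuous dchi.
Proof.
have c1 : continuous (fun t : R => pos_part (t - 1)).
  apply: (@continuous_compT R R R (fun t => t - 1) pos_part); last exact: continuous_pos_part.
  by apply: continuousTD; [move=> t; exact: cvg_id|exact: cst_continuous].
have c2 : continuous (fun t : R => pos_part (1 - pos_part (t - 1) ^+ 2)).
  apply: (@continuous_compT R R R (fun t => 1 - pos_part (t - 1) ^+ 2) pos_part); last exact: continuous_pos_part.
  apply: continuousTD; first exact: cst_continuous.
  rewrite (_ : (fun _ => _) = fun t => -1 * (pos_part (t - 1) * pos_part (t - 1))).
    by apply: continuousTZ; exact: continuousTM.
  by apply/funext => t; rewrite mulN1r expr2.
rewrite (_ : dchi = fun t => -4 * (pos_part (1 - pos_part (t - 1) ^+ 2) * pos_part (t - 1))).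
  by apply: continuousTZ; exact: continuousTM.
by apply/funext => t; rewrite /dchi; ring.
Qed.

Lemma chi_ge0 t : 0 <= chi t. Proof. exact: sqr_ge0. Qed.

Lemma chi_le1 t : chi t <= 1.
Proof.
rewrite /chi expr_le1// ?pos_part_ge0// {1}/pos_part ge_max ler01/= gerBl//.
exact: sqr_ge0.
Qed.

Lemma chi_eq1 t : t <= 1 -> chi t = 1.
Proof.
move=> t1; rewrite /chi (_ : pos_part (t - 1) = 0).
  by rewrite expr0n subr0 /pos_part max_r// expr1n.
by rewrite /pos_part max_l// subr_le0.
Qed.

Lemma chi_eq0 t : 2 <= t -> chi t = 0.
Proof.
move=> t2; rewrite /chi /pos_part max_l ?expr0n// max_r; last lra.
by rewrite subr_le0 expr_ge1//; lra.
Qed.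

Lemma dchi_eq0 t : (t < 1) || (2 <= t) -> dchi t = 0.
Proof.
case/orP => ht; rewrite /dchi.
  by rewrite [pos_part (t - 1)]max_l ?mulr0 ?oppr0//; lra.
rewrite [pos_part (1 - _)]max_l ?mulr0 ?mul0r ?oppr0// [pos_part _]max_r; last lra.
by rewrite subr_le0 expr_ge1//; lra.
Qed.

Lemma dchi_le4 t : `|dchi t| <= 4.
Proof.
have [h|] := boolP ((t < 1) || (2 <= t)); first by rewrite dchi_eq0// normr0.
rewrite negb_or -leNgt -ltNge => /andP[t1 t2].
rewrite /dchi normrN !normrM [`|4|]ger0_norm// -mulrA ler_piMr//.
rewrite !ger0_norm ?pos_part_ge0//; apply: mulr_ile1; rewrite ?pos_part_ge0//.
  by rewrite {1}/pos_part ge_max ler01/= gerBl// sqr_ge0.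
by rewrite /pos_part ge_max ler01/=; lra.
Qed.

End cutoff.

(** * The pointwise inequality behind one step *)

Section numeric_step.
Context (R : realType).

(* The lower bound for X m in multiplier_step, at one point: a0, a1, a2 stand for
   <A_j>, <A_(j+1)>, <A_(j+2)>, and b, D1, De for A_j . A_(j+1), A_(j+1) . A_(j+2),
   A_j . A_(j+2). *)
Lemma numeric_step (a0 a1 a2 b c D1 De XS W w z P del K Th th0 th1 kap t1 t2 : R) :
  1 <= a0 -> 1 <= a1 -> 0 < z -> 0 < P -> 0 <= w -> 1 <= kap ->
  0 <= th0 -> 0 <= th1 -> 0 <= K -> 0 <= Th -> 0 <= del <= 1 -> 1 <= z ->
  w * a1 ^+ 2 = W -> `|b| <= a0 * a1 -> a0 * z <= del * a1 ->
  `|De| <= a0 * a2 -> a2 <= K * z * a1 -> `|D1| <= a1 * a2 -> `|XS| <= Th * z * P ->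
  0 <= t1 <= 2 -> 0 <= t2 <= 2 ->
  W * (chi t1 * chi t2) <=
    ((a1 ^+ 2 - 1 + De) * w + b * (c * w * (D1 / a1 ^+ 2))) * (chi t1 * chi t2)
    + b * w * (dchi t1 * (th0 * t1 * (b / a0 ^+ 2) - th1 * t1 * (D1 / a1 ^+ 2)) * chi t2
             + chi t1 * (dchi t2 * (XS / (kap * P) - th1 * t2 * (D1 / a1 ^+ 2))))
    + del * (1 + K + `|c| * K + 16 * th1 * K + 4 * Th) * W
    + (if 1 <= t1 then 8 * th0 * W else 0).
Proof.
move=> a01 a11 z0 P0 w0 kap1 th00 th10 K0 Th0 /andP[del0 del1] z1 wW bl az Del a2l D1l XSl /andP[t10 t12] /andP[t20 t22].
have a0p : 0 < a0 by exact: lt_le_trans a01.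
have a1p : 0 < a1 by exact: lt_le_trans a11.
(* The logarithmic derivative of <A_(j+1)> along X, of size z. *)
pose y := D1 / a1 ^+ 2.
have yl : `|y| <= K * z.
  rewrite /y normrM normfV [`|a1 ^+ 2|]ger0_norm ?sqr_ge0// ler_pdivrMr ?exprn_gt0//.
  rewrite (le_trans D1l)// expr2 mulrA [leRHS]mulrC; apply: ler_wpM2l; first exact: ltW.
  exact: a2l.
(* The basic smallness: b w times anything of size z is at most del W. The bounds E2 to E5 reduce to
   it. *)
have bw : `|b * w| * z <= del * W.
  rewrite normrM [`|w|]ger0_norm//.
  have h : `|b| * z <= del * a1 ^+ 2.
    apply: (@le_trans _ _ (a0 * a1 * z)); first by rewrite ler_wpM2r// ltW.
    by rewrite mulrAC expr2 mulrA ler_wpM2r// ltW.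
  by rewrite mulrAC -wW [w * _]mulrC mulrA; exact: ler_wpM2r.
have wl : w <= del * W.
  rewrite -wW mulrCA ler_peMr//.
  have h : 1 <= del * a1 by rewrite (le_trans _ az)// mulr_ege1.
  by rewrite expr2 mulrA mulr_ege1.
have bwy u : `|u| <= K * z -> `|b * w * u| <= del * K * W.
  move=> hu; rewrite normrM (le_trans (ler_wpM2l (normr_ge0 _) hu))//.
  have -> : `|b * w| * (K * z) = K * (`|b * w| * z) by ring.
  have -> : del * K * W = K * (del * W) by ring.
  exact: ler_wpM2l.
have c1 := chi_ge0 t1; have c1' := chi_le1 t1.
have c2 := chi_ge0 t2; have c2' := chi_le1 t2.
pose X := chi t1 * chi t2.
have X0 : 0 <= X by rewrite mulr_ge0.
have X1 : X <= 1 by rewrite mulr_ile1.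
have prod3 u v t : 0 <= u -> 0 <= v -> v <= 2 -> 0 <= t -> t <= 1 -> `|u * v * t| <= u * 2 * 1.
  move=> u0 v0 v2 t0 t1'; have uv0 : 0 <= u * v by exact: mulr_ge0.
  by rewrite ger0_norm ?(mulr_ge0 uv0 t0)//; apply: ler_pM => //; exact: ler_wpM2l.
have E1 : `|De * w * X| <= del * K * W.
  rewrite normrM [`|X|]ger0_norm// (@le_trans _ _ (`|De * w|))// ?ler_piMr//.
  rewrite normrM [`|w|]ger0_norm// -wW.
  have h : `|De| <= del * K * a1 ^+ 2.
    rewrite (le_trans Del)// (le_trans (ler_wpM2l (ltW a0p) a2l))//.
    have -> : a0 * (K * z * a1) = K * (a0 * z) * a1 by ring.
    have -> : del * K * a1 ^+ 2 = K * (del * a1) * a1 by ring.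
    by rewrite ler_wpM2r ?ler_wpM2l// ltW.
  by rewrite [w * _]mulrC mulrA ler_wpM2r.
have E0 : w * X <= del * W by rewrite (le_trans _ wl)// ler_piMr.
have E2 : `|b * (c * w * y) * X| <= `|c| * (del * K * W).
  rewrite normrM [`|X|]ger0_norm// (@le_trans _ _ (`|b * (c * w * y)|))// ?ler_piMr//.
  have -> : b * (c * w * y) = c * (b * w * y) by ring.
  by rewrite normrM ler_wpM2l// bwy.
(* Here 8 is 4 times 2, from |dchi| <= 4 and t1 <= 2; together with E4 this makes the 16 of the
   statement. *)
have E3 : `|b * w * (dchi t1 * (th1 * t1 * y) * chi t2)| <= 8 * th1 * (del * K * W).
  have -> : b * w * (dchi t1 * (th1 * t1 * y) * chi t2) = dchi t1 * (th1 * t1 * chi t2) * (b * w * y) by ring.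
  rewrite normrM; apply: ler_pM => //; last exact: bwy.
  have -> : 8 * th1 = 4 * (th1 * 2 * 1) by ring.
  rewrite normrM; apply: ler_pM => //; first exact: dchi_le4.
  exact: prod3.
have E4 : `|b * w * (chi t1 * (dchi t2 * (th1 * t2 * y)))| <= 8 * th1 * (del * K * W).
  have -> : b * w * (chi t1 * (dchi t2 * (th1 * t2 * y))) = dchi t2 * (th1 * t2 * chi t1) * (b * w * y) by ring.
  rewrite normrM; apply: ler_pM => //; last exact: bwy.
  have -> : 8 * th1 = 4 * (th1 * 2 * 1) by ring.
  rewrite normrM; apply: ler_pM => //; first exact: dchi_le4.
  exact: prod3.
have E5 : `|b * w * (chi t1 * (dchi t2 * (XS / (kap * P))))| <= 4 * (del * Th * W).
  have -> : b * w * (chi t1 * (dchi t2 * (XS / (kap * P)))) = dchi t2 * (chi t1 * (b * w * (XS / (kap * P)))) by ring.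
  rewrite normrM; apply: ler_pM => //; first exact: dchi_le4.
  rewrite normrM [`|chi t1|]ger0_norm// (@le_trans _ _ (`|b * w * (XS / (kap * P))|))// ?ler_piMl//.
  have h : `|XS / (kap * P)| <= Th * z.
    rewrite normrM normfV [`|kap * P|]ger0_norm; last by rewrite mulr_ge0// ltW// (lt_le_trans _ kap1).
    rewrite ler_pdivrMr; last by rewrite mulr_gt0// (lt_le_trans _ kap1).
    rewrite (le_trans XSl)//; apply: ler_wpM2l; first by rewrite mulr_ge0// ltW.
    by rewrite ler_peMl// ltW.
  rewrite normrM (le_trans (ler_wpM2l (normr_ge0 _) h))//.
  have -> : `|b * w| * (Th * z) = Th * (`|b * w| * z) by ring.
  have -> : del * Th * W = Th * (del * W) by ring.
  exact: ler_wpM2l.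
(* The one term without a factor del: X falls on <A_j> inside the cutoff. It vanishes with dchi t1
   for t1 < 1, so it occurs only where P_j is not small relative to P_(j+1). *)
have E6 : `|b * w * (dchi t1 * (th0 * t1 * (b / a0 ^+ 2)) * chi t2)| <= (if 1 <= t1 then 8 * th0 * W else 0).
  case: ifPn => [_|]; last first.
    by rewrite -ltNge => t11; rewrite dchi_eq0 ?t11// !mul0r mulr0 normr0.
  have -> : b * w * (dchi t1 * (th0 * t1 * (b / a0 ^+ 2)) * chi t2) =
     dchi t1 * (th0 * t1 * chi t2) * (b ^+ 2 / a0 ^+ 2 * w) by ring.
  rewrite normrM; apply: ler_pM => //.
    have -> : 8 * th0 = 4 * (th0 * 2 * 1) by ring.
    rewrite normrM; apply: ler_pM => //; first exact: dchi_le4.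
    exact: prod3.
  rewrite ger0_norm; last by rewrite mulr_ge0// divr_ge0// sqr_ge0.
  rewrite -wW [leRHS]mulrC ler_wpM2r// ler_pdivrMr ?exprn_gt0//.
  rewrite -[b ^+ 2]real_normK ?num_real// -exprMn lerXn2r ?nnegrE//.
    by rewrite mulr_ge0// ltW.
  by rewrite mulrC.
rewrite -/X -/y.
move: E0 E1 E2 E3 E4 E5 E6; rewrite !ler_norml.
move=> E0 /andP[E1 _] /andP[E2 _] /andP[_ E3] /andP[_ E4] /andP[E5 _] /andP[E6 _].
have -> : W * X = w * a1 ^+ 2 * X by rewrite wW.
move: E6; set I := (if _ then _ else _) => E6.
rewrite -subr_ge0.
set F := (X in 0 <= X).
(* The difference of the two sides is the sum of the seven slacks in E0 to E6. *)
have -> : F = (del * W - w * X) + (De * w * X + del * K * W)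
  + (b * (c * w * y) * X + `|c| * (del * K * W))
  + (8 * th1 * (del * K * W) - b * w * (dchi t1 * (th1 * t1 * y) * chi t2))
  + (8 * th1 * (del * K * W) - b * w * (chi t1 * (dchi t2 * (th1 * t2 * y))))
  + (b * w * (chi t1 * (dchi t2 * (XS / (kap * P)))) + 4 * (del * Th * W))
  + (b * w * (dchi t1 * (th0 * t1 * (b / a0 ^+ 2)) * chi t2) + I).
  by rewrite /F; ring.
have N (u v : R) : - v <= u -> 0 <= u + v by rewrite -subr_ge0 opprK.
have Sb (u v : R) : u <= v -> 0 <= v - u by rewrite subr_ge0.
exact: (addr_ge0 (addr_ge0 (addr_ge0 (addr_ge0 (addr_ge0 (addr_ge0 (Sb _ _ E0) (N _ _ E1)) (N _ _ E2)) (Sb _ _ E3)) (Sb _ _ E4)) (N _ _ E5)) (N _ _ E6)).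
Qed.

End numeric_step.

(** * The multiplier for abstract concave exponents *)

Section multiplier.
Context (R : realType) (n : nat).
Local Notation V := 'cV[R]_n.
Implicit Types (x y : V).
Variables (B Q : 'M[R]_n) (r : nat) (nu q s : nat -> R) (lam : R).
Local Notation wX := (drift_weight B).

Definition kalman_row k : 'M[R]_n := Q *m B^T ^+ k.
Definition kbracket k x := bracket (kalman_row k *m x).
Definition gauge k x := kbracket k x `^ (nu k)^-1.
(** The summand [bracket x] closes the chain: X maps A_r to A_(r+1), which has no gauge and is
    bounded through <xi>, with exponent nu_(r+1) = 1. *)
Definition gauge_tail j x := bracket x + \sum_(j <= i < r.+1) gauge i x.
Definition gauge_sum x := \sum_(i < r.+1) gauge i x `^ (2 * lam).
Definition source_weight x := \sum_(j < r) (kbracket j x `^ q j * bracket x `^ s j) ^+ 2.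
(* P_j^(2 lam) restricted to the region where P_j bounds the next P_i's. *)
Definition dominant j kap x :=
  if gauge_tail j x <= kap * gauge j x then gauge j x `^ (2 * lam) else 0.

Hypothesis lam_gt0 : 0 < lam.
Hypothesis nu_gt0 : forall i, 0 < nu i.
Hypothesis nu_le1 : forall i, nu i <= 1.
Hypothesis nu_r1 : nu r.+1 = 1.
Hypothesis nu_concave : forall i j, (j <= i <= r)%N -> nu i.+1 - nu i <= nu j.+1 - nu j.
Hypothesis nu_rec : forall j, (j < r)%N -> nu j * (1 - q j) + lam = nu j.+1 * (1 + s j).
Hypothesis q01 : forall j, (j < r)%N -> 0 <= q j <= 1.
Hypothesis s_ge0 : forall j, (j < r)%N -> 0 <= s j.
Hypothesis coercive : exists2 C, 1 <= C & forall x, bracket x <= C * \sum_(i < r.+1) kbracket i x.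

(** All [kap] and [eta] are allowed, because the induction on j calls the previous level with a
    larger [kap] and a smaller [eta]. *)
Definition dominated_by_multiplier j := forall kap eta, 1 <= kap -> 0 < eta ->
  exists C m Xm, [/\ 0 <= C, wX m Xm & forall x,
    [/\ dominant j kap x <= eta * gauge_sum x + C * gauge 0 x `^ (2 * lam) + Xm x,
        `|m x| <= eta * gauge_sum x &
        m x ^+ 2 <= C * gauge_sum x * source_weight x]].

Lemma kbracket_ge1 k x : 1 <= kbracket k x.
Proof. exact: bracket_ge1. Qed.

Lemma kbracket_gt0 k x : 0 < kbracket k x.
Proof. exact: bracket_gt0. Qed.

Lemma gauge_gt0 k x : 0 < gauge k x.
Proof. by rewrite powR_gt0// kbracket_gt0. Qed.

Lemma powR_ge1 (a c : R) : 1 <= a -> 0 <= c -> 1 <= a `^ c.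
Proof. by move=> a1 c0; rewrite -(powRr0 a); exact: ler_powR. Qed.

Lemma gauge_ge1 k x : 1 <= gauge k x.
Proof. by rewrite powR_ge1 ?kbracket_ge1// invr_ge0 ltW. Qed.

Lemma kbracketE k x : kbracket k x = gauge k x `^ nu k.
Proof. by rewrite /gauge -powRrM mulVf ?lt0r_neq0// powRr1// ltW// kbracket_gt0. Qed.

Lemma kalman_rowS k x : kalman_row k *m (B^T *m x) = kalman_row k.+1 *m x.
Proof.
rewrite /kalman_row; have -> : B^T ^+ k.+1 = B^T ^+ k *m B^T by rewrite exprSr.
by rewrite !mulmxA.
Qed.

Definition kdot k x := dotv (kalman_row k *m x) (kalman_row k.+1 *m x).

Lemma wX_kbracket k c :
  wX (fun x => kbracket k x `^ c) (fun x => c * kbracket k x `^ (c - 2) * kdot k x).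
Proof.
apply: (wX_ext (wX_bracket_pow B (kalman_row k) c)) => // x.
by rewrite /kdot kalman_rowS.
Qed.

Lemma kdot_le k x : `|kdot k x| <= kbracket k x * kbracket k.+1 x.
Proof. exact: dotv_le_bracket. Qed.

Lemma powR_sub2 (a c : R) : 0 < a -> a `^ (c - 2) = a `^ c / a ^+ 2.
Proof.
move=> a0; rewrite powRB; last by rewrite lt0r_neq0// implybT.
by rewrite powR_mulrn// ltW.
Qed.

Lemma wX_kdot k :
  wX (kdot k) (fun x => kbracket k.+1 x ^+ 2 - 1 + dotv (kalman_row k *m x) (kalman_row k.+2 *m x)).
Proof.
apply: (wX_ext (wX_dotv B (kalman_row k) (kalman_row k.+1))) => // x.
by rewrite !kalman_rowS /kbracket bracket_sqr; ring.
Qed.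

Lemma bracket_drift : exists2 C, 1 <= C & exists2 D, wX (@bracket R n) D &
  forall x, `|D x| <= C * bracket x.
Proof.
have [C C1 BC] := bracket_mulmx_le B^T.
exists C => //.
exists (fun x => dotv x (B^T *m x) / bracket x).
  apply: (wX_ext (wX_bracket_pow B 1%:M 1)) => x; first by rewrite mul1mx powRr1// ltW// bracket_gt0.
  rewrite !mul1mx powR_sub2 ?bracket_gt0// mul1r powRr1 ?ltW ?bracket_gt0//.
  by field; rewrite lt0r_neq0// bracket_gt0.
move=> x; rewrite normrM normfV [`|bracket x|]gtr0_norm ?bracket_gt0//.
rewrite ler_pdivrMr ?bracket_gt0// (le_trans (dotv_le_bracket _ _))//.
by rewrite mulrC ler_wpM2r// ltW// bracket_gt0.
Qed.

Lemma kbracket_le_bracket : exists2 C, 1 <= C &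
  forall k x, (k <= r.+1)%N -> kbracket k x <= C * bracket x.
Proof.
have /choice[C CP] : forall k, exists C, 1 <= C /\ forall x, kbracket k x <= C * bracket x.
  by move=> k; have [C C1 h] := bracket_mulmx_le (kalman_row k); exists C.
have C0 k : 0 <= C k by have [h _] := CP k; exact: le_trans h.
exists (\sum_(k < r.+2) C k).
  rewrite big_ord_recl (le_trans (CP 0%N).1)//= lerDl.
  by apply: sumr_ge0.
move=> k x kr; rewrite (le_trans ((CP k).2 x))// ler_wpM2r//.
  by rewrite ltW// bracket_gt0.
have kr' : (k < r.+2)%N by [].
by rewrite (bigD1 (Ordinal kr'))//= lerDl sumr_ge0.
Qed.

Lemma gauge_sum_ge j x : (j <= r)%N -> gauge j x `^ (2 * lam) <= gauge_sum x.
Proof.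
move=> jr; have jr' : (j < r.+1)%N by [].
by rewrite /gauge_sum (bigD1 (Ordinal jr'))//= lerDl sumr_ge0// => i _; exact: powR_ge0.
Qed.

Lemma gauge_sum_ge0 x : 0 <= gauge_sum x.
Proof. by apply: sumr_ge0 => i _; exact: powR_ge0. Qed.

Lemma source_weight_ge0 x : 0 <= source_weight x.
Proof. by apply: sumr_ge0 => i _; exact: sqr_ge0. Qed.

Lemma gauge_le_tail i j x : (j <= i <= r)%N -> gauge i x <= gauge_tail j x.
Proof.
move=> /andP[ji ir]; rewrite /gauge_tail.
have g0 k : 0 <= gauge k x by exact: ltW (gauge_gt0 _ _).
rewrite (bigD1_seq i) ?iota_uniq ?mem_index_iota ?ji//=.
rewrite addrCA lerDl addr_ge0 ?sumr_ge0//.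
by rewrite ltW// bracket_gt0.
Qed.

Lemma gauge_tail_ge0 j x : 0 <= gauge_tail j x.
Proof.
rewrite addr_ge0 ?sumr_ge0// => [|i _]; first by rewrite ltW// bracket_gt0.
by rewrite ltW// gauge_gt0.
Qed.

Lemma gauge_tailS j x : (j <= r)%N -> gauge_tail j x = gauge j x + gauge_tail j.+1 x.
Proof. by move=> jr; rewrite /gauge_tail big_ltn// addrCA. Qed.

Lemma bracket_le_tail j x : bracket x <= gauge_tail j x.
Proof.
by rewrite /gauge_tail lerDl sumr_ge0// => i _; rewrite ltW// gauge_gt0.
Qed.

(** By concavity each increment is at least the last one, 1 - nu_r >= 0. *)
Lemma nu_incr j : (j <= r)%N -> nu j <= nu j.+1.
Proof.
move=> jr; rewrite -subr_ge0 (le_trans _ (@nu_concave r j _)) ?jr ?leqnn//.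
by rewrite nu_r1 subr_ge0.
Qed.

Lemma ge1_ge0 (a : R) : 1 <= a -> 0 <= a.
Proof. exact: le_trans. Qed.

Lemma powR_mono (a b c : R) : 0 <= c -> 0 <= a -> a <= b -> a `^ c <= b `^ c.
Proof. by move=> c0 a0 ab; rewrite ge0_ler_powR ?nnegrE// (le_trans a0). Qed.

(** In this region <A_i> <= K P^(nu_i) for i from j + 1 to r + 1, where P = P_(j+1), and X raises
    the index at a cost of at most P^d, d = nu_(j+1) - nu_j. The factor 2 is there because the
    cutoff [chi] vanishes only from 2 on. *)
Lemma local_bounds j kap : (j < r)%N -> 1 <= kap ->
  exists K Th XS, [/\ 1 <= K, 0 <= Th, wX (gauge_tail j.+1) XS & forall x,
    gauge_tail j.+1 x <= 2 * kap * gauge j.+1 x ->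
    kbracket j.+2 x <= K * gauge j.+1 x `^ (nu j.+1 - nu j) * kbracket j.+1 x /\
    `|XS x| <= Th * gauge j.+1 x `^ (nu j.+1 - nu j) * gauge j.+1 x].
Proof.
move=> jr kap1.
have [C1 C11 kC1] := kbracket_le_bracket.
have [C2 C21 [D wD DC]] := bracket_drift.
have k20 : 1 <= 2 * kap by rewrite mulr_ege1// ler1n.
(* [2 * kap] compares the gauges and <xi> with P, and [C1] compares <A_(r+1)> with <xi>. *)
pose K := 2 * kap * C1; have K1 : 1 <= K by rewrite mulr_ege1.
have K0 : 0 < K by exact: lt_le_trans K1.
pose th i := (nu i)^-1.
have th1 i : 1 <= th i by rewrite invf_ge1.
pose Th := C2 * (2 * kap) + \sum_(j.+1 <= i < r.+1) th i * K `^ th i.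
exists K, Th, (fun x => D x + \sum_(j.+1 <= i < r.+1) th i * kbracket i x `^ (th i - 2) * kdot i x).
split => //.
- apply: addr_ge0; first by rewrite mulr_ge0 ?(ge1_ge0 C21) ?(ge1_ge0 k20).
  by apply: sumr_ge0 => i _; rewrite mulr_ge0 ?powR_ge0// (ge1_ge0 (th1 i)).
- by apply: wXD => //; apply: wX_sum => i; exact: wX_kbracket.
move=> x; have PE := kbracketE j.+1 x.
have P1 := gauge_ge1 j.+1 x; have P0 := gauge_gt0 j.+1 x.
move: PE P1 P0; move: (gauge j.+1 x) => P PE P1 P0 tl; set d := nu j.+1 - nu j.
have d0 : 0 <= d by rewrite subr_ge0 nu_incr// ltnW.
have kb i : (j.+1 <= i <= r.+1)%N -> kbracket i x <= K * P `^ nu i.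
  move=> /andP[ji]; rewrite leq_eqVlt => /orP[/eqP->|].
    rewrite nu_r1 powRr1 ?(ltW P0)// (le_trans (kC1 _ x (leqnn _)))//.
    rewrite /K [2 * kap * C1]mulrC -mulrA ler_wpM2l ?(ge1_ge0 C11)//.
    exact: le_trans (bracket_le_tail j.+1 x) tl.
  rewrite ltnS => ir; rewrite kbracketE.
  have gl : gauge i x <= 2 * kap * P by apply: (le_trans _ tl); apply: gauge_le_tail; rewrite ji.
  have h : gauge i x `^ nu i <= (2 * kap * P) `^ nu i.
    exact: (powR_mono (ltW (nu_gt0 i)) (ltW (gauge_gt0 i x)) gl).
  rewrite (le_trans h)// powRM ?(ge1_ge0 k20) ?(ltW P0)//.
  apply: ler_wpM2r; first exact: powR_ge0.
  apply: (@le_trans _ _ (2 * kap)); first exact: ler1_powR.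
  by rewrite /K ler_peMr// (ge1_ge0 k20).
(* Concavity: from j on, no increment of nu exceeds d. *)
have inc i : (j <= i <= r)%N -> P `^ nu i.+1 <= P `^ (nu i + d).
  by move=> h; rewrite ler_powR// -lerBlDl nu_concave.
split.
  have h : kbracket j.+2 x <= K * P `^ nu j.+2 by apply: kb; rewrite leqnSn.
  rewrite (le_trans h)// PE -[leRHS]mulrA ler_wpM2l ?(ltW K0)//.
  rewrite -powRD; last by rewrite (lt0r_neq0 P0) implybT.
  by rewrite addrC inc// leqnSn.
rewrite (le_trans (ler_normD _ _))// /Th -[leRHS]mulrA mulrDl; apply: lerD.
  rewrite (le_trans (DC x))// -mulrA ler_wpM2l ?(ge1_ge0 C21)//.
  rewrite (le_trans (bracket_le_tail j.+1 x))// (le_trans tl)//.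
  apply: ler_wpM2l; first exact: ge1_ge0.
  by rewrite ler_peMl ?(ltW P0)// powR_ge1.
rewrite (le_trans (ler_norm_sum _ _ _))// mulr_suml.
rewrite !big_nat; apply: ler_sum => i /andP[ji ir].
have a0 := kbracket_gt0 i x.
have ai : kbracket i x <= K * P `^ nu i by apply: kb; rewrite ji ltnW.
have ai1 : kbracket i.+1 x <= K * P `^ nu i.+1 by apply: kb; rewrite ir (leq_trans ji).
rewrite !normrM [`|th i|]ger0_norm ?(ge1_ge0 (th1 i))//.
rewrite -!mulrA ler_wpM2l ?(ge1_ge0 (th1 i))//.
rewrite ger0_norm ?powR_ge0// powR_sub2//.
have E : kbracket i x `^ th i / kbracket i x ^+ 2 * `|kdot i x| <=
    kbracket i x `^ (th i - 1) * kbracket i.+1 x.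
  rewrite -[leRHS](_ : kbracket i x `^ th i / kbracket i x ^+ 2 * (kbracket i x * kbracket i.+1 x) = _).
    by rewrite ler_wpM2l ?kdot_le// divr_ge0 ?powR_ge0// sqr_ge0.
  rewrite powRB ?(lt0r_neq0 a0) ?implybT// powRr1 ?(ltW a0)//.
  by field; rewrite lt0r_neq0.
rewrite (le_trans E)//.
have t10 : 0 <= th i - 1 by rewrite subr_ge0.
have E2 : kbracket i x `^ (th i - 1) <= K `^ (th i - 1) * P `^ (1 - nu i).
  apply: (@le_trans _ _ ((K * P `^ nu i) `^ (th i - 1))).
    exact: (powR_mono t10 (ltW a0) ai).
  rewrite powRM ?powR_ge0 ?(ltW K0)// -powRrM mulrBr mulr1 /th mulfV ?lt0r_neq0//.
have E3 : kbracket i x `^ (th i - 1) * kbracket i.+1 x <=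
    K `^ (th i - 1) * P `^ (1 - nu i) * (K * P `^ nu i.+1).
  by apply: ler_pM => //; [exact: powR_ge0|exact: ltW (kbracket_gt0 _ _)].
rewrite (le_trans E3)//.
(* The powers of K combine to K^(th_i), those of P to an exponent 1 - nu_i + nu_(i+1), which is at
   most 1 + d. *)
have -> : K `^ (th i - 1) * P `^ (1 - nu i) * (K * P `^ nu i.+1) =
  (K * K `^ (th i - 1)) * (P `^ (1 - nu i) * P `^ nu i.+1) by ring.
rewrite mulr_powRB1 ?(ltW K0)//; last exact: lt_le_trans (th1 i).
apply: ler_wpM2l; first exact: powR_ge0.
have -> : P `^ d * P = P `^ (1 - nu i) * P `^ (nu i + d).
  rewrite -powRD ?(lt0r_neq0 P0) ?implybT//.
  have -> : 1 - nu i + (nu i + d) = d + 1 by ring.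
  by rewrite [RHS]powRD ?(lt0r_neq0 P0) ?implybT// [X in _ = _ * X]powRr1// ltW.
by rewrite ler_wpM2l ?powR_ge0// inc// (ltnW ji).
Qed.

Lemma wX_chi t Xt : wX t Xt -> wX (fun x => chi (t x)) (fun x => dchi (t x) * Xt x).
Proof.
move=> w; apply: (wX_comp w (fun x => is_derive_chi (t x)) (fun x => @continuous_dchi R (t x))).
- apply: (@poly_bounded_le _ _ _ (fun=> 1)) => [|x]; first exact: poly_bounded_cst.
  by rewrite normr1 ger0_norm ?chi_ge0 ?chi_le1.
- apply: (@poly_bounded_le _ _ _ (fun=> 4)) => [|x]; first exact: poly_bounded_cst.
  by rewrite [`|4|]ger0_norm// dchi_le4.
Qed.

Lemma source_weight_ge j x : (j < r)%N ->
  (kbracket j x `^ q j * bracket x `^ s j) ^+ 2 <= source_weight x.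
Proof.
move=> jr; rewrite /source_weight (bigD1 (Ordinal jr))//= lerDl.
by apply: sumr_ge0 => i _; exact: sqr_ge0.
Qed.

Opaque powR kbracket gauge_tail chi dchi bracket kdot gauge_sum source_weight.

(** The cutoff variables are t1 = P_j / (eps P_(j+1)) and t2, the tail from j + 1 on divided by kap
    P_(j+1). Where t2 <= 2 and t1 >= 1, P_j is itself dominant, with 1 + 2 kap / eps in place of
    kap; this is where the last term of the bound comes from. The constants [c1] and [c2] come
    before [eps], so that the factor of [gauge_sum] can be made small afterwards. *)
Lemma multiplier_step j kap : (j < r)%N -> 1 <= kap ->
  exists c1 c2, [/\ 0 <= c1, 0 <= c2 & forall eps, 0 < eps -> 2 * eps <= 1 ->
  exists C m Xm, [/\ 0 <= C, wX m Xm & forall x,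
    [/\ dominant j.+1 kap x <= Xm x + (2 * eps) `^ nu j * c1 * gauge_sum x +
          c2 * eps^-1 `^ (2 * lam) * dominant j (1 + 2 * kap / eps) x,
        `|m x| <= (2 * eps) `^ nu j * gauge_sum x &
        m x ^+ 2 <= C * gauge_sum x * source_weight x]]].
Proof.
move=> jr kap1.
have [K [Th [XS [K1 Th0 wS H]]]] := local_bounds jr kap1.
have [Ck Ck1 kC] := kbracket_le_bracket.
pose th0 := (nu j)^-1; pose th1 := (nu j.+1)^-1.
have th00 : 0 <= th0 by rewrite invr_ge0 ltW.
have th10 : 0 <= th1 by rewrite invr_ge0 ltW.
(* In the application lam th1 is lam_(j+1); this exponent makes w <A_(j+1)>^2 equal to P_(j+1)^(2
   lam). *)
pose c := 2 * lam * th1 - 2.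
pose c1 := 1 + K + `|c| * K + 16 * th1 * K + 4 * Th.
have K0 : 0 <= K := ge1_ge0 K1.
have c10 : 0 <= c1 by rewrite !addr_ge0// !mulr_ge0.
have c20 : 0 <= 1 + 8 * th0 by rewrite addr_ge0// mulr_ge0.
exists c1, (1 + 8 * th0); split => // eps eps0 eps1.
set del := (2 * eps) `^ nu j.
have e2 : 0 <= 2 * eps by rewrite mulr_ge0// ltW.
have del0 : 0 <= del by exact: powR_ge0.
have del1 : del <= 1.
  by have := powR_mono (ltW (nu_gt0 j)) e2 eps1; rewrite powR1.
pose t1 x := eps^-1 * (kbracket j x `^ th0 * kbracket j.+1 x `^ (- th1)).
pose t2 x := kap^-1 * (gauge_tail j.+1 x * kbracket j.+1 x `^ (- th1)).
pose Xt1 x := eps^-1 * (th0 * kbracket j x `^ (th0 - 2) * kdot j x * kbracket j.+1 x `^ (- th1)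
   + kbracket j x `^ th0 * (- th1 * kbracket j.+1 x `^ (- th1 - 2) * kdot j.+1 x)).
pose Xt2 x := kap^-1 * (XS x * kbracket j.+1 x `^ (- th1)
   + gauge_tail j.+1 x * (- th1 * kbracket j.+1 x `^ (- th1 - 2) * kdot j.+1 x)).
have wt1 : wX t1 Xt1 by apply/wXZ/wXM; exact: wX_kbracket.
have wt2 : wX t2 Xt2 by apply/wXZ/wXM => //; exact: wX_kbracket.
pose De x := dotv (kalman_row j *m x) (kalman_row j.+2 *m x).
pose w x := kbracket j.+1 x `^ c.
pose m x := kdot j x * w x * (chi (t1 x) * chi (t2 x)).
pose Xm x := ((kbracket j.+1 x ^+ 2 - 1 + De x) * w x +
    kdot j x * (c * kbracket j.+1 x `^ (c - 2) * kdot j.+1 x)) * (chi (t1 x) * chi (t2 x)) +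
    kdot j x * w x * (dchi (t1 x) * Xt1 x * chi (t2 x) + chi (t1 x) * (dchi (t2 x) * Xt2 x)).
have wm : wX m Xm.
  apply: wXM; first by apply: wXM; [exact: wX_kdot|exact: wX_kbracket].
  by apply: wXM; exact: wX_chi.
(* The constant replaces <A_(j+1)>^(s_j) by <xi>^(s_j) in the square of m. *)
exists (Ck `^ s j * Ck `^ s j), m, Xm; split => //; first by rewrite mulr_ge0// powR_ge0.
move=> x.
have Hx := H x.
have t1D : t1 x = eps^-1 * (kbracket j x `^ th0 * kbracket j.+1 x `^ (- th1)) := erefl.
have t2D : t2 x = kap^-1 * (gauge_tail j.+1 x * kbracket j.+1 x `^ (- th1)) := erefl.
have Xt1D : Xt1 x = eps^-1 * (th0 * kbracket j x `^ (th0 - 2) * kdot j x * kbracket j.+1 x `^ (- th1)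
   + kbracket j x `^ th0 * (- th1 * kbracket j.+1 x `^ (- th1 - 2) * kdot j.+1 x)) := erefl.
have Xt2D : Xt2 x = kap^-1 * (XS x * kbracket j.+1 x `^ (- th1)
   + gauge_tail j.+1 x * (- th1 * kbracket j.+1 x `^ (- th1 - 2) * kdot j.+1 x)) := erefl.
have De_le : `|De x| <= kbracket j x * kbracket j.+2 x := dotv_le_bracket _ _.
have wD : w x = kbracket j.+1 x `^ c := erefl.
have mD : m x = kdot j x * w x * (chi (t1 x) * chi (t2 x)) := erefl.
have XmD : Xm x = ((kbracket j.+1 x ^+ 2 - 1 + De x) * w x +
    kdot j x * (c * kbracket j.+1 x `^ (c - 2) * kdot j.+1 x)) * (chi (t1 x) * chi (t2 x)) +
    kdot j x * w x * (dchi (t1 x) * Xt1 x * chi (t2 x) + chi (t1 x) * (dchi (t2 x) * Xt2 x)) := erefl.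
have cD : c = 2 * lam * th1 - 2 := erefl.
have c1D : c1 = 1 + K + `|c| * K + 16 * th1 * K + 4 * Th := erefl.
have delD : del = (2 * eps) `^ nu j := erefl.
have PE : kbracket j.+1 x `^ th1 = gauge j.+1 x := erefl.
have PjE : kbracket j x `^ th0 = gauge j x := erefl.
clear H wS wm wt1 wt2.
clearbody t1 t2 Xt1 Xt2 De w m Xm; clearbody del c1; clearbody c; clearbody th0 th1.
have b_le := kdot_le j x.
have D1_le := kdot_le j.+1 x.
have ka0 := kbracket_ge1 j x; have ka1 := kbracket_ge1 j.+1 x.
have kE0 := kbracketE j x; have kE1 := kbracketE j.+1 x.
have kC1 : kbracket j.+1 x <= Ck * bracket x by apply: kC; rewrite leqW.
have sw_ge := source_weight_ge x jr.
move: t1D t2D Xt1D Xt2D De_le wD mD XmD PE PjE Hx b_le D1_le ka0 ka1 kE0 kE1 kC1 sw_ge.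
move: (kbracket j x) (kbracket j.+1 x) => a0 a1.
move=> t1D t2D Xt1D Xt2D De_le wD mD XmD PE PjE Hx b_le D1_le a01 a11 a0E a1E kC1 sw_ge.
have a0p : 0 < a0 by exact: lt_le_trans a01.
have a1p : 0 < a1 by exact: lt_le_trans a11.
have tl0 := gauge_tail_ge0 j.+1 x.
have tlE := gauge_tailS x (ltnW jr).
have WG := gauge_sum_ge x jr.
have P1 := gauge_ge1 j.+1 x; have P0 := gauge_gt0 j.+1 x; have Pj0 := gauge_gt0 j x.
have G0 := gauge_sum_ge0 x; have sw0 := source_weight_ge0 x.
have W0 := powR_ge0 (gauge j.+1 x) (2 * lam).
have domE := erefl (dominant j (1 + 2 * kap / eps) x).
have domSE := erefl (dominant j.+1 kap x).
rewrite [RHS]/dominant in domE; rewrite [RHS]/dominant in domSE.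
have E0 := powR_ge0 eps^-1 (2 * lam).
have bx1 := bracket_ge1 x.
move: domE domSE t2D Xt1D Xt2D De_le wD mD XmD PE PjE Hx b_le D1_le a0E a1E kC1 sw_ge tl0 tlE WG P1 P0 Pj0 G0 sw0 W0 bx1.
move: (dominant j (1 + 2 * kap / eps) x) (dominant j.+1 kap x) => dj dj1.
move: (kbracket j.+2 x) (gauge_tail j.+1 x) (gauge_tail j x) (gauge j x) (gauge j.+1 x) => a2 tl1 tl Pj P.
move: (gauge_sum x) (source_weight x) (kdot j x) (kdot j.+1 x) (bracket x) (XS x) => G SW b D1 bx XSx.
move: (t1 x) (t2 x) t1D => t1x t2x t1D.
move: (Xt1 x) (Xt2 x) (De x) (w x) (m x) (Xm x) => Xt1x Xt2x Dex wx mx Xmx.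
move=> domE domSE t2D Xt1D Xt2D De_le wD mD XmD PE PjE Hx b_le D1_le a0E a1E kC1 sw_ge tl0 tlE WG P1 P0 Pj0 G0 sw0 W0 bx1.
have [W WE] : exists W, W = P `^ (2 * lam) by exists (P `^ (2 * lam)).
have [E EE] : exists E, E = eps^-1 `^ (2 * lam) by exists (eps^-1 `^ (2 * lam)).
rewrite -WE in W0 WG domSE; rewrite -EE in E0; rewrite -EE.
have epsP0 : 0 < eps * P by exact: mulr_gt0.
have kap0 : 0 < kap by exact: lt_le_trans kap1.
have kapP0 : 0 < kap * P by exact: mulr_gt0.
have t1E : t1x = Pj / (eps * P) by rewrite t1D powRN PE PjE invfM; ring.
have t2E : t2x = tl1 / (kap * P) by rewrite t2D powRN PE invfM; ring.
have t10 : 0 <= t1x by rewrite t1E; exact: divr_ge0 (ltW Pj0) (ltW epsP0).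
have t20 : 0 <= t2x by rewrite t2E; exact: divr_ge0 tl0 (ltW kapP0).
(* If P_j is not small relatively to P_(j+1), then j is dominant itself. *)
have dom_j : t2x <= 2 -> 1 <= t1x ->
    W <= E * dj.
  rewrite t2E t1E (ler_pdivrMr _ _ kapP0) (ler_pdivlMr _ _ epsP0) mul1r => h2 h1.
  have h3 : P <= eps^-1 * Pj by rewrite ler_pdivlMl.
  rewrite domE ifT; last first.
    rewrite tlE mulrDl mul1r lerD2l (le_trans h2)// mulrA.
    by rewrite -[leRHS]mulrA ler_wpM2l// mulr_ge0// ltW.
  have ei0 : 0 <= eps^-1 by rewrite invr_ge0 ltW.
  rewrite EE WE -(powRM _ ei0 (ltW Pj0)).
  have l0 : 0 <= 2 * lam by rewrite mulr_ge0// ltW.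
  exact: powR_mono l0 (ltW P0) h3.
have dj0 : 0 <= dj by rewrite domE; case: ifP => // _; exact: powR_ge0.
have D0 : 0 <= (1 + 8 * th0) * E * dj.
  by rewrite mulr_ge0 ?mulr_ge0.
have dW : dj1 <= W by rewrite domSE; case: ifP.
have e0 : 0 <= del * c1 * G by rewrite mulr_ge0 ?mulr_ge0.
(* Outside the support m and X m both vanish, since [dchi] is 0 from 2 on. If P_(j+1) is dominant
   there, then t2 <= 1, hence t1 >= 2 and P_j takes over. *)
have [sig|nsig] := boolP ((t1x < 2) && (t2x < 2)); last first.
  have m0 : mx = 0.
    rewrite mD; move: nsig; rewrite negb_and -!leNgt => /orP[] h.
      by rewrite (chi_eq0 h) mul0r mulr0.
    by rewrite (chi_eq0 h) !mulr0.
  have Xm0 : Xmx = 0.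
    rewrite XmD; move: nsig; rewrite negb_and -!leNgt => /orP[] h.
      by rewrite (chi_eq0 h) dchi_eq0 ?h ?orbT// !(mul0r, mulr0, addr0).
    by rewrite (chi_eq0 h) [dchi (t2x)]dchi_eq0 ?h ?orbT// !(mul0r, mulr0, addr0).
  have C0 : 0 <= Ck `^ s j * Ck `^ s j by rewrite mulr_ge0 ?powR_ge0.
  rewrite m0 Xm0 normr0 add0r expr0n /=; split; [|exact: mulr_ge0|exact: mulr_ge0 (mulr_ge0 C0 G0) sw0].
  rewrite domSE; case: ifPn => [h|_]; last by rewrite addr_ge0.
  have h2 : t2x <= 1 by rewrite t2E (ler_pdivrMr _ _ kapP0) mul1r.
  have h1 : 1 <= t1x.
    move: nsig; rewrite negb_and -!leNgt => /orP[] h3; first by rewrite (le_trans _ h3)// ler1n.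
    by have := le_trans h3 h2; rewrite leNgt ltr1n.
  rewrite -[leLHS]add0r; apply: lerD => //.
  rewrite (le_trans (dom_j (le_trans h2 _) h1))// ?ler1n//.
  by rewrite -mulrA ler_peMl ?mulr_ge0// lerDl mulr_ge0.
move/andP: sig => [t12 t22].
have [a2l XSl] : a2 <= K * P `^ (nu j.+1 - nu j) * a1 /\
    `|XSx| <= Th * P `^ (nu j.+1 - nu j) * P.
  by apply: Hx; move: (ltW t22); rewrite t2E (ler_pdivrMr _ _ kapP0) mulrA.
set z := P `^ (nu j.+1 - nu j) in a2l XSl.
have z1 : 1 <= z by rewrite powR_ge1// subr_ge0 nu_incr// ltnW.
have z0 : 0 < z by exact: lt_le_trans z1.
have wW : wx * a1 ^+ 2 = W.
  rewrite wD cD powR_sub2// mulfVK ?expf_neq0 ?lt0r_neq0//.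
  by rewrite mulrC powRrM PE WE.
have w0 : 0 <= wx by rewrite wD powR_ge0.
have Pjl : Pj <= 2 * eps * P.
  by move: (ltW t12); rewrite t1E (ler_pdivrMr _ _ epsP0) mulrA.
have a0P : a0 <= del * P `^ nu j.
  rewrite a0E delD -powRM ?(ltW P0)//.
  exact: (powR_mono (ltW (nu_gt0 j)) (ltW Pj0) Pjl).
(* The exponents nu_j and nu_(j+1) - nu_j of P add up to that of <A_(j+1)>. *)
have az : a0 * z <= del * a1.
  apply: (@le_trans _ _ (del * P `^ nu j * z)); first by rewrite ler_wpM2r// ltW.
  rewrite -mulrA ler_wpM2l// a1E /z -powRD ?(lt0r_neq0 P0) ?implybT//.
  by rewrite addrC subrK.
have bw : `|b * wx| <= del * W.
  rewrite normrM [`|wx|]ger0_norm// -wW [wx * _]mulrC mulrA ler_wpM2r//.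
  rewrite (le_trans b_le)// expr2 mulrA ler_wpM2r ?(ltW a1p)//.
  by rewrite (le_trans _ az)// ler_peMr// ltW.
have XmE : Xmx =
  ((a1 ^+ 2 - 1 + Dex) * wx + b * (c * wx * (D1 / a1 ^+ 2))) * (chi (t1x) * chi (t2x))
    + b * wx * (dchi (t1x) * (th0 * t1x * (b / a0 ^+ 2) - th1 * t1x * (D1 / a1 ^+ 2)) * chi (t2x)
             + chi (t1x) * (dchi (t2x) * (XSx / (kap * P) - th1 * t2x * (D1 / a1 ^+ 2)))).
  have E1 : Xt1x = th0 * t1x * (b / a0 ^+ 2) - th1 * t1x * (D1 / a1 ^+ 2).
    by rewrite Xt1D t1D !powR_sub2//; ring.
  have E2 : Xt2x = XSx / (kap * P) - th1 * t2x * (D1 / a1 ^+ 2).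
    have PiE : a1 `^ (- th1) = P^-1 by rewrite powRN PE.
    by rewrite Xt2D t2D !powR_sub2// PiE (invfM kap P); ring.
  rewrite -E1 -E2 XmD [a1 `^ (c - 2)]powR_sub2// wD; congr (_ * _ + _).
  by ring.
have num := @numeric_step R a0 a1 (a2) (b) c (D1) (Dex) (XSx)
  W (wx) z (P) del K Th th0 th1 kap (t1x) (t2x)
  a01 a11 z0 P0 w0 kap1 th00 th10 K0 Th0 (introT andP (conj del0 del1)) z1 wW b_le az De_le a2l D1_le XSl
  (introT andP (conj t10 (ltW t12))) (introT andP (conj t20 (ltW t22))).
rewrite -XmE -c1D in num.
have cc0 : 0 <= chi (t1x) * chi (t2x) by rewrite mulr_ge0 ?chi_ge0.
have cc1 : chi (t1x) * chi (t2x) <= 1 by rewrite mulr_ile1 ?chi_ge0 ?chi_le1.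
have cW : del * c1 * W <= del * c1 * G by rewrite ler_wpM2l// mulr_ge0.
have mb : `|mx| <= `|b * wx|.
  by rewrite mD normrM [`|chi _ * _|]ger0_norm// ler_piMr.
split.
(* For t1 >= 1, both W and the edge error 8 th0 W are charged to P_j. For t1 < 1 the edge error is
   absent, and where P_(j+1) is dominant both cutoffs equal 1, so W appears in full. *)
- have [h1|h1] := leP 1 (t1x).
    rewrite h1 in num.
    have := dom_j (ltW t22) h1; rewrite -[(1 + 8 * th0) * E * dj]mulrA; move: (E * dj) => Y hY.
    rewrite (le_trans dW)//.
    have hW : W <= Y + (Xmx + del * c1 * W + 8 * th0 * W).
      have WX : 0 <= W * (chi (t1x) * chi (t2x)) by rewrite mulr_ge0.
      by rewrite -[leLHS]addr0; apply: lerD => //; exact: le_trans WX num.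
    have h8 : 8 * th0 * W <= 8 * th0 * Y by rewrite ler_wpM2l// mulr_ge0.
    have -> : Xmx + del * c1 * G + (1 + 8 * th0) * Y =
      Y + (Xmx + del * c1 * G + 8 * th0 * Y) by ring.
    by rewrite (le_trans hW)// lerD2l; apply: lerD => //; rewrite lerD2l.
  rewrite (lt_geF h1) /= ?mulr0 ?addr0 in num.
  rewrite -[leLHS]addr0; apply: lerD => //.
  rewrite domSE; case: ifPn => [h|_]; last first.
    have WX : 0 <= W * (chi (t1x) * chi (t2x)) by rewrite mulr_ge0.
    by rewrite (le_trans WX)// (le_trans num)// lerD2l.
  have h2 : t2x <= 1 by rewrite t2E (ler_pdivrMr _ _ kapP0) mul1r.
  rewrite (chi_eq1 (ltW h1)) (chi_eq1 h2) !mulr1 in num.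
  by rewrite (le_trans num)// lerD2l.
- by rewrite (le_trans mb)// (le_trans bw)// ler_wpM2l.
- have /andP[q0 q1] := q01 jr; have sj0 := s_ge0 jr.
  (* The recursion enters here, as the equality of the exponents nu_j (1 - q_j) + 2 lam - nu_(j+1)
     and lam + nu_(j+1) s_j of P. *)
  have key : `|b * wx| <= P `^ lam * (a0 `^ q j * a1 `^ s j).
    apply: (@le_trans _ _ (a0 * a1 * wx)).
      by rewrite normrM [`|wx|]ger0_norm// ler_wpM2r.
    have F : a0 * a1 * wx = a0 `^ q j * (a0 `^ (1 - q j) * (P `^ (2 * lam - nu j.+1))).
      have -> : a0 * a1 * wx = a0 * (wx * a1 ^+ 2 / a1) by field; rewrite lt0r_neq0.
      rewrite wW [RHS]mulrA; congr (_ * _).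
        by rewrite -powRD ?(lt0r_neq0 a0p) ?implybT// addrC subrK powRr1// ltW.
      by rewrite a1E WE powRB ?(lt0r_neq0 P0) ?implybT.
    rewrite F [leRHS]mulrCA ler_wpM2l ?powR_ge0//.
    have a0P' : a0 <= P `^ nu j.
      by rewrite (le_trans a0P)// ler_piMl// powR_ge0.
    have h1 : 0 <= 1 - q j by rewrite subr_ge0.
    apply: (@le_trans _ _ (P `^ (nu j * (1 - q j)) * P `^ (2 * lam - nu j.+1))).
      rewrite ler_wpM2r ?powR_ge0// powRrM.
      exact: (powR_mono h1 (ltW a0p) a0P').
    rewrite -powRD ?(lt0r_neq0 P0) ?implybT//.
    rewrite a1E -powRrM -powRD ?(lt0r_neq0 P0) ?implybT//.
    rewrite ler_powR//.
    have -> : nu j * (1 - q j) = nu j.+1 * (1 + s j) - lam by rewrite -(nu_rec jr) addrK.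
    by rewrite le_eqVlt; apply/orP; left; apply/eqP; ring.
  have key2 : a1 `^ s j <= Ck `^ s j * bx `^ s j.
    rewrite -powRM ?(ge1_ge0 Ck1) ?(ge1_ge0 bx1)//.
    exact: (powR_mono sj0 (ltW a1p) kC1).
  have key3 : `|mx| <= Ck `^ s j * (P `^ lam * (a0 `^ q j * bx `^ s j)).
    rewrite (le_trans mb)// (le_trans key)//.
    have -> : Ck `^ s j * (P `^ lam * (a0 `^ q j * bx `^ s j)) =
      P `^ lam * (a0 `^ q j * (Ck `^ s j * bx `^ s j)) by ring.
    by rewrite ler_wpM2l ?powR_ge0// ler_wpM2l ?powR_ge0.
  rewrite -[mx ^+ 2]real_normK ?num_real//.
  apply: (@le_trans _ _ ((Ck `^ s j * (P `^ lam * (a0 `^ q j * bx `^ s j))) ^+ 2)).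
    by rewrite lerXn2r ?nnegrE ?(le_trans (normr_ge0 _) key3).
  have -> : (Ck `^ s j * (P `^ lam * (a0 `^ q j * bx `^ s j))) ^+ 2 =
    Ck `^ s j * Ck `^ s j * (P `^ lam) ^+ 2 * (a0 `^ q j * bx `^ s j) ^+ 2 by ring.
  apply: ler_pM.
  + by rewrite !mulr_ge0 ?powR_ge0 ?sqr_ge0.
  + exact: sqr_ge0.
  + rewrite ler_wpM2l ?mulr_ge0 ?powR_ge0// (le_trans _ WG)// WE mulrC powRrM.
    by rewrite powR_mulrn// powR_ge0.
  + exact: sw_ge.
Qed.

Transparent gauge_tail gauge_sum.

(** The order of the choices matters. First eps is fixed in terms of eta; this determines the
    coefficient c3 of the previous level, which grows as eps decreases, and the new kap. Only then
    is the previous level called, with eta divided by 2 (c3 + 1). *)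
Lemma dominated_by_multiplierP j : (j <= r)%N -> dominated_by_multiplier j.
Proof.
elim: j => [_|j IH jr] kap eta kap1 eta0.
  exists 1, (fun=> 0), (fun=> 0); split => //; first exact: wX_cst.
  move=> x; have G0 := gauge_sum_ge0 x; have S0 := source_weight_ge0 x.
  rewrite normr0 expr0n /= addr0 mul1r; split.
  - rewrite /dominant; case: ifP => _; first by rewrite lerDr mulr_ge0// ltW.
    by rewrite addr_ge0 ?powR_ge0// mulr_ge0// ltW.
  - by rewrite mulr_ge0// ltW.
  - by rewrite mul1r mulr_ge0.
have [c1 [c2 [c10 c20 H]]] := multiplier_step jr kap1.
have c1p : 0 < 2 * (c1 + 1) by rewrite mulr_gt0// ltr_wpDl.
(* The bound del0 (c1 + 1) <= eta / 2 serves both the error del0 c1 and the bound del0 on m; eps is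
   then solved from (2 eps)^(nu_j) = del0. *)
pose del0 := Num.min 1 (eta / (2 * (c1 + 1))).
have del0p : 0 < del0 by rewrite lt_min ltr01 divr_gt0.
pose eps := del0 `^ (nu j)^-1 / 2.
have eps0 : 0 < eps by rewrite divr_gt0// powR_gt0.
have e2E : 2 * eps = del0 `^ (nu j)^-1 by rewrite /eps mulrC divfK.
have eps1 : 2 * eps <= 1.
  have h : 0 <= (nu j)^-1 by rewrite invr_ge0 ltW.
  have d1 : del0 <= 1 by rewrite ge_min lexx.
  by have := powR_mono h (ltW del0p) d1; rewrite powR1 e2E.
have delE : (2 * eps) `^ nu j = del0.
  by rewrite e2E -powRrM mulVf ?lt0r_neq0// powRr1// ltW.
have [C [m [Xm [C0 wm Hm]]]] := H _ eps0 eps1; rewrite delE in Hm.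
pose c3 := c2 * eps^-1 `^ (2 * lam).
have c30 : 0 <= c3 by rewrite mulr_ge0 ?powR_ge0.
have c3p : 0 < 2 * (c3 + 1) by rewrite mulr_gt0// ltr_wpDl.
have kap'1 : 1 <= 1 + 2 * kap / eps.
  by rewrite lerDl divr_ge0 ?(ltW eps0)// mulr_ge0// (ge1_ge0 kap1).
have eta'0 : 0 < eta / (2 * (c3 + 1)) by rewrite divr_gt0.
have [C' [m' [Xm' [C'0 wm' Hm']]]] := IH (ltnW jr) _ _ kap'1 eta'0.
(* The terms 2 C and 2 c3^2 C' come from the square of the sum of the two multipliers, c3 C' from
   the term in [gauge 0]. *)
exists (2 * C + (2 * c3 ^+ 2 + c3) * C'), (fun x => m x + c3 * m' x), (fun x => Xm x + c3 * Xm' x).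
have D0 : 0 <= c3 ^+ 2 by exact: sqr_ge0.
split; first by rewrite addr_ge0// mulr_ge0// addr_ge0// mulr_ge0.
  by apply: wXD => //; exact: wXZ.
have eta_del : del0 * (c1 + 1) <= eta / 2.
  apply: (@le_trans _ _ (eta / (2 * (c1 + 1)) * (c1 + 1))).
    by rewrite ler_wpM2r ?addr_ge0// ge_min lexx orbT.
  by rewrite invfM mulrA divfK// lt0r_neq0// ltr_wpDl.
have eta_c3 : (c3 + 1) * (eta / (2 * (c3 + 1))) = eta / 2.
  by field; rewrite lt0r_neq0// ltr_wpDl.
move=> x; have [h1 h2 h3] := Hm x; have [h1' h2' h3'] := Hm' x.
have G0 := gauge_sum_ge0 x; have S0 := source_weight_ge0 x.
have g0 : 0 <= gauge 0 x `^ (2 * lam) by exact: powR_ge0.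
rewrite -/c3 in h1; move: h1 h2 h3 h1' h2' h3' G0 S0 g0.
move: (dominant j.+1 kap x) (dominant j _ x) (m x) (Xm x) (m' x) (Xm' x) => a b u v u' v'.
move: (gauge_sum x) (source_weight x) (gauge 0 x `^ _) => G SW g h1 h2 h3 h1' h2' h3' G0 S0 g0.
move: eta_del eta_c3 eta'0 h1' h2'; move: (eta / (2 * (c3 + 1))) => eta' eta_del eta_c3 eta'0 h1' h2'.
have k1 : c3 * b <= c3 * (eta' * G + C' * g + v') by rewrite ler_wpM2l.
have k2 : (del0 * (c1 + 1)) * G <= eta / 2 * G by rewrite ler_wpM2r.
have k3' : c3 * eta' * G <= eta / 2 * G.
  by rewrite -eta_c3 ler_wpM2r// ler_wpM2r ?(ltW eta'0)// lerDl.
have k4 : 0 <= del0 * G by rewrite mulr_ge0// ltW.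
have etaE : eta * G = eta / 2 * G + eta / 2 * G by rewrite -mulrDl -splitr.
have CgE : c3 * C' * g <= (2 * C + (2 * c3 ^+ 2 + c3) * C') * g.
  rewrite ler_wpM2r//.
  rewrite -subr_ge0.
  have -> : 2 * C + (2 * c3 ^+ 2 + c3) * C' - c3 * C' = 2 * C + 2 * c3 ^+ 2 * C' by ring.
  by rewrite addr_ge0// mulr_ge0// mulr_ge0.
split.
- apply: (le_trans h1).
  have -> : v + del0 * c1 * G + c3 * b = (del0 * (c1 + 1) * G - del0 * G) + (v + c3 * b) by ring.
  apply: (@le_trans _ _ (eta / 2 * G + (v + (c3 * (eta' * G + C' * g + v'))))).
    apply: lerD; last by rewrite lerD2l.
    by rewrite (le_trans _ k2)// gerBl.
  have -> : eta / 2 * G + (v + c3 * (eta' * G + C' * g + v')) =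
    (eta / 2 * G + c3 * eta' * G) + c3 * C' * g + (v + c3 * v') by ring.
  by rewrite lerD2r etaE; apply: lerD => //; rewrite lerD2l.
- rewrite (le_trans (ler_normD _ _))// etaE; apply: lerD.
    rewrite (le_trans h2)// (le_trans _ k2)//.
    by rewrite ler_wpM2r// ler_peMr ?(ltW del0p)// lerDr.
  rewrite normrM [`|c3|]ger0_norm// (le_trans _ k3')// -mulrA.
  by rewrite ler_wpM2l.
- have k6 : (u + c3 * u') ^+ 2 <= 2 * u ^+ 2 + 2 * c3 ^+ 2 * u' ^+ 2.
    rewrite -subr_ge0.
    have -> : 2 * u ^+ 2 + 2 * c3 ^+ 2 * u' ^+ 2 - (u + c3 * u') ^+ 2 = (u - c3 * u') ^+ 2 by ring.
    exact: sqr_ge0.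
  apply: (le_trans k6).
  have -> : (2 * C + (2 * c3 ^+ 2 + c3) * C') * G * SW =
    2 * (C * G * SW) + (2 * c3 ^+ 2 * (C' * G * SW) + c3 * (C' * G * SW)) by ring.
  apply: lerD; first by rewrite ler_wpM2l.
  apply: (@le_trans _ _ (2 * c3 ^+ 2 * (C' * G * SW))).
    by rewrite ler_wpM2l// mulr_ge0.
  by rewrite lerDl mulr_ge0// (le_trans _ h3')// sqr_ge0.
Qed.

(** Since nu_i <= 1 and gauges are at least 1, <A_i> is at most the i-th gauge, hence at most the
    largest one; coercivity then bounds <xi>. *)
Lemma bracket_le_gauge : exists2 C, 1 <= C & forall x j,
  (forall i, (i < r.+1)%N -> gauge i x <= gauge j x) -> bracket x <= C * gauge j x.
Proof.
have [C C1 H] := coercive; exists (C * r.+1%:R).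
  by rewrite mulr_ege1// ler1n.
move=> x j hj; rewrite (le_trans (H x))// -mulrA.
apply: ler_wpM2l; first exact: ge1_ge0.
apply: (@le_trans _ _ (\sum_(i < r.+1) gauge j x)).
  apply: ler_sum => i _; rewrite (le_trans _ (hj i (ltn_ord i)))// kbracketE.
  by apply: ler1_powR; [exact: gauge_ge1|exact: nu_le1].
by rewrite sumr_const card_ord mulr_natl.
Qed.

Lemma argmax_ord (k : nat) (g : nat -> R) :
  exists2 j, (j <= k)%N & forall i, (i <= k)%N -> g i <= g j.
Proof.
elim: k => [|k [j jk IH]]; first by exists 0%N => // i; rewrite leqn0 => /eqP->.
have [h|h] := leP (g k.+1) (g j).
  exists j => [|i]; first exact: leqW.
  by rewrite leq_eqVlt ltnS => /orP[/eqP->|/IH].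
exists k.+1 => // i; rewrite leq_eqVlt ltnS => /orP[/eqP->//|/IH].
by move=> /le_trans; apply; exact: ltW.
Qed.

Lemma sum_le_const (k j : nat) (g : nat -> R) (M : R) : 0 <= M ->
  (forall i, (i <= k)%N -> g i <= M) -> \sum_(j <= i < k.+1) g i <= k.+1%:R * M.
Proof.
move=> M0 gM; rewrite big_nat.
apply: (@le_trans _ _ (\sum_(j <= i < k.+1) M)).
  by rewrite [leRHS]big_nat; apply: ler_sum => i /andP[_ ik]; apply: gM; rewrite -ltnS.
rewrite sumr_const_nat -[leLHS]mulr_natl; apply: ler_wpM2r => //.
by rewrite ler_nat leq_subr.
Qed.

(** At each point the largest gauge is dominant for one fixed [kap], so the sum of the multipliers
    of all levels works whichever level is the largest. *)
Theorem multiplier eta : 0 < eta ->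
  exists C m Xm, [/\ 0 <= C, wX m Xm & forall x,
    [/\ gauge_sum x <= C * gauge 0 x `^ (2 * lam) + Xm x,
        `|m x| <= eta * gauge_sum x &
        m x ^+ 2 <= C * gauge_sum x * source_weight x]].
Proof.
move=> eta0.
have [C0 C01 HC0] := bracket_le_gauge.
(* Relative to the largest gauge, [C0] bounds <xi> and r + 1 the sum of the gauges. *)
pose kap := C0 + r.+1%:R.
have kap1 : 1 <= kap by rewrite (le_trans C01)// lerDl.
pose N : R := r.+1%:R ^+ 2.
have N1 : 1 <= N by rewrite exprn_ege1// ler1n.
pose eta1 := Num.min 1 eta.
have eta10 : 0 < eta1 by rewrite lt_min ltr01.
(* Summed over the levels and multiplied by r + 1, the error in the first bound is eta1 / 2 times
   [gauge_sum], absorbed on the left because eta1 <= 1. The resulting factor k = 2 (r + 1) leaves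
   eta1 in the bound on m. *)
pose eta' := eta1 / (2 * N).
have N0 : 0 < N by exact: lt_le_trans N1.
have eta'0 : 0 < eta' by rewrite divr_gt0// mulr_gt0.
have /choice[T HT] : forall j : 'I_r.+1, exists T : R * (V -> R) * (V -> R),
    [/\ 0 <= T.1.1, wX T.1.2 T.2 & forall x,
    [/\ dominant j kap x <= eta' * gauge_sum x + T.1.1 * gauge 0 x `^ (2 * lam) + T.2 x,
        `|T.1.2 x| <= eta' * gauge_sum x &
        T.1.2 x ^+ 2 <= T.1.1 * gauge_sum x * source_weight x]].
  move=> j; have jr : (j <= r)%N by rewrite -ltnS.
  by have [C [m [Xm H]]] := dominated_by_multiplierP jr kap1 eta'0; exists (C, m, Xm).
pose k : R := 2 * r.+1%:R.
have k0 : 0 <= k by rewrite mulr_ge0.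
pose D := \sum_(j < r.+1) Num.sqrt (T j).1.1.
pose E := \sum_(j < r.+1) (T j).1.1.
have C0j j : 0 <= (T j).1.1 by have [] := HT j.
have D0 : 0 <= D by apply: sumr_ge0 => j _; exact: sqrtr_ge0.
have E0 : 0 <= E by exact: sumr_ge0.
(* [k * E] serves the first bound; [(k * D) ^+ 2] serves the last one, where the triangle inequality
   is applied to the square roots of the bounds. *)
exists (k * E + (k * D) ^+ 2), (fun x => k * \sum_(j < r.+1) (T j).1.2 x),
  (fun x => k * \sum_(j < r.+1) (T j).2 x); split.
- by rewrite addr_ge0 ?sqr_ge0// mulr_ge0.
- by apply/wXZ/wX_sum => j; have [] := HT j.
move=> x; have G0 := gauge_sum_ge0 x; have S0 := source_weight_ge0 x.
have [j0 j0r jmax] := argmax_ord r (fun i => gauge i x).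
have dom0 : gauge_sum x <= r.+1%:R * dominant j0 kap x.
  rewrite /dominant ifT; last first.
    rewrite /gauge_tail mulrDl; apply: lerD; first exact: HC0.
    exact: sum_le_const (ltW (gauge_gt0 _ _)) jmax.
  rewrite mulr_natl; apply: (@le_trans _ _ (\sum_(i < r.+1) gauge j0 x `^ (2 * lam))).
    apply: ler_sum => i _; apply: powR_mono; [|exact: ltW (gauge_gt0 _ _)|by apply: jmax; rewrite -ltnS].
    by rewrite mulr_ge0// ltW.
  by rewrite sumr_const card_ord.
have domE : gauge_sum x <= r.+1%:R * \sum_(j < r.+1) dominant j kap x.
  have j0r' : (j0 < r.+1)%N by [].
  rewrite (le_trans dom0)// ler_wpM2l// (bigD1 (Ordinal j0r'))//= lerDl.
  by apply: sumr_ge0 => j _; rewrite /dominant; case: ifP => // _; exact: powR_ge0.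
have Hx (j : 'I_r.+1) : [/\ dominant j kap x <= eta' * gauge_sum x + (T j).1.1 * gauge 0 x `^ (2 * lam) + (T j).2 x,
        `|(T j).1.2 x| <= eta' * gauge_sum x &
        (T j).1.2 x ^+ 2 <= (T j).1.1 * gauge_sum x * source_weight x].
  by have [_ _ h] := HT j; exact: h.
clear dom0 jmax HC0 HT.
have g0 : 0 <= gauge 0 x `^ (2 * lam) by exact: powR_ge0.
move: G0 S0 g0 domE Hx.
move: (gauge_sum x) (source_weight x) (gauge 0 x `^ (2 * lam)) => G SW g G0 S0 g0 domE Hx.
have S1 : \sum_(j < r.+1) dominant j kap x <= r.+1%:R * (eta' * G) + E * g + \sum_(j < r.+1) (T j).2 x.
  apply: (@le_trans _ _ (\sum_(j < r.+1) (eta' * G + (T j).1.1 * g + (T j).2 x))).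
    by apply: ler_sum => j _; have [] := Hx j.
  by rewrite !big_split/= sumr_const card_ord mulr_natl /E mulr_suml.
have eN : r.+1%:R * (r.+1%:R * (eta' * G)) = eta1 / 2 * G.
  rewrite /eta' /N; have : r.+1%:R != 0 :> R by rewrite pnatr_eq0.
  by move: (r.+1%:R : R) => y y0; field.
have ee1 : eta1 <= 1 by rewrite ge_min lexx.
have ee2 : eta1 <= eta by rewrite ge_min lexx orbT.
have KD0 : 0 <= (k * D) ^+ 2 by exact: sqr_ge0.
split.
- have S2 : G <= eta1 / 2 * G + r.+1%:R * (E * g + \sum_(j < r.+1) (T j).2 x).
    rewrite (le_trans domE)// -eN -mulrDr addrA; apply: ler_wpM2l => //.
  have S3 : eta1 / 2 * G <= G / 2 by rewrite mulrAC ler_wpM2r// ler_piMl.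
  have S4 : G / 2 <= r.+1%:R * (E * g + \sum_(j < r.+1) (T j).2 x).
    rewrite -(lerD2l (G / 2)) -splitr (le_trans S2)// lerD2r//.
  have S5 : G <= k * (E * g + \sum_(j < r.+1) (T j).2 x).
    by rewrite /k -mulrA -ler_pdivrMl// mulrC.
  rewrite (le_trans S5)// mulrDr mulrA mulrDl -addrA lerD2l lerDr mulr_ge0//.
- rewrite normrM [`|k|]ger0_norm//.
  apply: (@le_trans _ _ (k * (r.+1%:R * (eta' * G)))).
    rewrite ler_wpM2l// (le_trans (ler_norm_sum _ _ _))//.
    apply: (@le_trans _ _ (\sum_(j < r.+1) (eta' * G))).
      by apply: ler_sum => j _; have [] := Hx j.
    by rewrite sumr_const card_ord mulr_natl.
  rewrite /k -mulrA eN mulrA ler_wpM2r// mulrC divfK//.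
- have S6 : `|\sum_(j < r.+1) (T j).1.2 x| <= D * Num.sqrt (G * SW).
    rewrite (le_trans (ler_norm_sum _ _ _))// /D mulr_suml.
    apply: ler_sum => j _; rewrite -sqrtrM// -sqrtr_sqr ler_wsqrtr// mulrA.
    by have [] := Hx j.
  rewrite exprMn -[X in k ^+ 2 * X]real_normK ?num_real//.
  apply: (@le_trans _ _ (k ^+ 2 * (D * Num.sqrt (G * SW)) ^+ 2)).
    rewrite ler_wpM2l ?sqr_ge0// lerXn2r ?nnegrE//.
    by rewrite mulr_ge0// sqrtr_ge0.
  rewrite [(D * _) ^+ 2]exprMn sqr_sqrtr ?mulr_ge0// mulrA -exprMn -mulrA.
  rewrite ler_wpM2r ?mulr_ge0// lerDr mulr_ge0//.
Qed.

Lemma bracket_pow_le_gauge_sum : exists2 C, 1 <= C & forall x,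
  bracket x `^ (2 * lam) <= C * gauge_sum x.
Proof.
have [C C1 H] := bracket_le_gauge; have l0 : 0 <= 2 * lam by rewrite mulr_ge0// ltW.
exists (C `^ (2 * lam)) => [|x]; first exact: powR_ge1.
have [j jr jmax] := argmax_ord r (fun i => gauge i x).
rewrite (le_trans (powR_mono l0 (ltW (bracket_gt0 x)) (H x j _)))//.
rewrite powRM ?(ge1_ge0 C1) ?(ltW (gauge_gt0 _ _))//.
by rewrite ler_wpM2l ?powR_ge0// gauge_sum_ge.
Qed.

End multiplier.

(** * The multiplier under the kernel condition *)

Section kalman_multiplier.
Context (R : realType) (n : nat).
Local Notation V := 'cV[R]_n.
Implicit Types (x y : V).

Lemma bracketD x y : bracket (x + y) <= bracket x + bracket y.
Proof.
have b0 (z : V) : 0 <= bracket z by exact: ltW (bracket_gt0 z).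
have H : bracket (x + y) ^+ 2 <= (bracket x + bracket y) ^+ 2; last first.
  by move: H; rewrite ler_sqr// nnegrE ?addr_ge0.
rewrite [leRHS]sqrrD !bracket_sqr dotvDl !dotvDr.
have := dotv_le_bracket x y; rewrite ler_norml => /andP[_].
rewrite [dotv y x]dotvC -subr_ge0 => h.
rewrite -subr_ge0.
have -> : 1 + dotv x x + bracket x * bracket y *+ 2 + (1 + dotv y y) -
    (1 + (dotv x x + dotv x y + (dotv x y + dotv y y))) =
    1 + 2 * (bracket x * bracket y - dotv x y) by ring.
by rewrite addr_ge0// mulr_ge0.
Qed.

Lemma bracket_sum (k : nat) (f : 'I_k.+1 -> V) :
  bracket (\sum_i f i) <= \sum_i bracket (f i).
Proof.
elim: k f => [|k IH] f; first by rewrite !big_ord1.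
by rewrite !(big_ord_recl k.+1) (le_trans (bracketD _ _))// lerD2l IH.
Qed.

Variables (B Q : 'M[R]_n) (r : nat).
Local Notation A := (kalman_row B Q).

(** The quadratic form of this Gram matrix is the sum of the |A_k x|^2, so a vector in its kernel is
    killed by every A_k. *)
Lemma kernel_cond_unitmx : kernel_cond B Q r ->
  \sum_(k < r.+1) (A k)^T *m A k \in unitmx.
Proof.
move=> HK; rewrite -row_free_unit; apply: inj_row_free => v vG.
pose x := v^T.
have Gx : (\sum_(k < r.+1) (A k)^T *m A k) *m x = 0.
  apply: trmx_inj; rewrite trmx_mul trmx0 /x trmxK -[RHS]vG; congr (_ *m _).
  by rewrite raddf_sum; apply: eq_bigr => k _; rewrite /= trmx_mul trmxK.
have D : \sum_(k < r.+1) dotv (A k *m x) (A k *m x) = 0.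
  transitivity (dotv x ((\sum_(k < r.+1) (A k)^T *m A k) *m x)).
    rewrite mulmx_suml dotvE mulmx_sumr summxE.
    by apply: eq_bigr => k _; rewrite dotv_mulmxl dotvE -mulmxA.
  by rewrite Gx dotvE mulmx0 mxE.
have A0 (k : 'I_r.+1) : A k *m x = 0.
  have : dotv (A k *m x) (A k *m x) == 0.
    by move/eqP: D; rewrite psumr_eq0 => [/allP/(_ k)|i _]; [apply; exact: mem_index_enum|exact: dotvv_ge0].
  rewrite /dotv psumr_eq0 => [/allP h|i _]; last by rewrite -expr2 sqr_ge0.
  apply/matrixP => i j; rewrite ord1 [RHS]mxE.
  by have := h i (mem_index_enum _); rewrite /= -expr2 sqrf_eq0 => /eqP.
have : [set 0 : V] x.
  rewrite -HK => k /= kr; have kr' : (k < r.+1)%N by [].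
  exact: A0 (Ordinal kr').
by move=> /= /(congr1 trmx); rewrite /x trmxK trmx0.
Qed.

(** With G the Gram matrix, xi is recovered as the inverse of G applied to the sum of the A_k^T A_k
    xi. *)
Lemma kernel_cond_coercive : kernel_cond B Q r ->
  exists2 C, 1 <= C & forall x, bracket x <= C * \sum_(i < r.+1) kbracket B Q i x.
Proof.
move=> /kernel_cond_unitmx Gu; set G := \sum_(_ < _) _ in Gu.
have [C1 C11 H1] := bracket_mulmx_le (invmx G).
have /choice[C2 H2] : forall k, exists C, 1 <= C /\ forall x, bracket ((A k)^T *m x) <= C * bracket x.
  by move=> k; have [C C1' h] := bracket_mulmx_le (A k)^T; exists C.
have C20 k : 0 <= C2 k by exact: ge1_ge0 (H2 k).1.
pose C3 := \sum_(k < r.+1) C2 k.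
have C31 : 1 <= C3.
  by rewrite /C3 big_ord_recl (le_trans (H2 0%N).1)// lerDl sumr_ge0.
exists (C1 * C3) => [|x]; first by rewrite mulr_ege1.
rewrite -[in leLHS](mulKmx Gu x) (le_trans (H1 _))// -mulrA.
rewrite ler_wpM2l ?(ge1_ge0 C11)// /G mulmx_suml (le_trans (bracket_sum _))//.
rewrite mulr_sumr; apply: ler_sum => k _; rewrite -mulmxA (le_trans ((H2 k).2 _))//.
rewrite ler_wpM2r ?(ltW (bracket_gt0 _))// /C3 (bigD1 k)//= lerDl.
by apply: sumr_ge0.
Qed.

Variables (lam q s : nat -> R).

(** Past r the value is the exponent 1 of <xi>, which bounds A_(r+1). As nu_r = 1, this extension
    keeps the sequence concave. *)
Definition scale_exponent i := if (i <= r)%N then lam r / lam i else 1.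
Local Notation nu := scale_exponent.
Local Notation NN := (gauge_sum B Q r nu (lam r)).
Local Notation SW := (source_weight B Q r q s).

Hypothesis HK : kernel_cond B Q r.
Hypothesis lam0_gt0 : 0 < lam 0%N.
Hypothesis q01 : forall j, (j < r)%N -> 0 <= q j <= 1.
Hypothesis s_ge0 : forall j, (j < r)%N -> 0 <= s j.
Hypothesis hlam : forall j : nat, (j < r)%N ->
  lam j.+1 * ((1 - q j) / lam j + 1) = 1 + s j.
Hypothesis lam_decr : forall j : nat, (j < r)%N -> lam j.+1 < lam j.
Hypothesis lam_conv : forall j : nat, (2 <= j <= r)%N ->
  lam (j - 1)%N / lam (j - 2)%N + lam (j - 1)%N / lam j <= 2.

Lemma lam_gt0 i : (i <= r)%N -> 0 < lam i.
Proof.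
elim: i => [//|i IH ir]; have li := IH (ltnW ir).
have /andP[q0 q1] := q01 ir.
have p : 0 < (1 - q i) / lam i + 1 by rewrite ltr_wpDl// divr_ge0 ?subr_ge0// ltW.
rewrite -(pmulr_lgt0 _ p) hlam// ltr_wpDr// s_ge0//.
Qed.

Lemma lam_noninc i : (i <= r)%N -> lam r <= lam i.
Proof.
move=> ir; have H k : (i + k <= r)%N -> lam (i + k)%N <= lam i.
  elim: k => [|k IH]; rewrite ?addn0// addnS => kr.
  by rewrite (le_trans _ (IH (ltnW kr)))// ltW// lam_decr.
by rewrite -(subnKC ir) H// subnKC.
Qed.

Lemma nu_gt0 i : 0 < nu i.
Proof. by rewrite /nu; case: ifP => // ir; rewrite divr_gt0 ?lam_gt0. Qed.

Lemma nu_le1 i : nu i <= 1.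
Proof.
rewrite /nu; case: ifP => // ir.
by rewrite ler_pdivrMr ?lam_gt0// mul1r lam_noninc.
Qed.

(** Multiplied by lam_r / lam_(k+1), the assumption on three consecutive lam's becomes nu_k +
    nu_(k+2) <= 2 nu_(k+1). At k + 1 = r the new increment is 0 and the preceding one is
    nonnegative. *)
Lemma nu_concave i j : (j <= i <= r)%N -> nu i.+1 - nu i <= nu j.+1 - nu j.
Proof.
have one k : (k.+1 <= r)%N -> nu k.+2 - nu k.+1 <= nu k.+1 - nu k.
  move=> kr; rewrite /nu kr (ltnW kr); case: ltnP => kr2.
    have h := @lam_conv k.+2 kr2; rewrite subn1 subn2 /= in h.
    have l0 := lam_gt0 (ltnW kr); have l1 := lam_gt0 kr; have l2 := lam_gt0 kr2.
    have lr := lam_gt0 (leqnn r).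
    have : lam r / lam k.+1 * (lam k.+1 / lam k + lam k.+1 / lam k.+2) <= lam r / lam k.+1 * 2.
      by rewrite ler_wpM2l// divr_ge0 ?ltW.
    have -> : lam r / lam k.+1 * (lam k.+1 / lam k + lam k.+1 / lam k.+2) =
      lam r / lam k + lam r / lam k.+2 by field; rewrite !lt0r_neq0.
    move: (lam r / lam k) (lam r / lam k.+1) (lam r / lam k.+2) => a b c; lra.
  have -> : k.+1 = r by apply/eqP; rewrite eqn_leq kr.
  rewrite divff ?lt0r_neq0 ?lam_gt0// subrr subr_ge0.
  by rewrite ler_pdivrMr ?mul1r ?lam_noninc ?lam_gt0// ltnW.
elim: i => [|i IH]; first by rewrite leqn0 => /andP[/eqP->].
rewrite leq_eqVlt ltnS => /andP[/orP[/eqP->//|ji] ir].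
by rewrite (le_trans (one _ ir))// IH// ji ltnW.
Qed.

Lemma nu_rec j : (j < r)%N -> nu j * (1 - q j) + lam r = nu j.+1 * (1 + s j).
Proof.
move=> jr; rewrite /nu jr (ltnW jr) -hlam//.
by field; rewrite !lt0r_neq0// lam_gt0// ltnW.
Qed.

Theorem kalman_multiplier eta : 0 < eta ->
  exists C m Xm, [/\ 0 <= C, drift_weight B m Xm & forall x,
    [/\ NN x <= C * (bracket (Q *m x) `^ lam 0%N) ^+ 2 + Xm x,
        `|m x| <= eta * NN x &
        m x ^+ 2 <= C * NN x * SW x]].
Proof.
move=> eta0; have lr := lam_gt0 (leqnn r).
have nu1 : nu r.+1 = 1 by rewrite /nu ltnn.
have [C [m [Xm [C0 wm H]]]] := multiplier lr nu_gt0 nu_le1 nu1 nu_concave nu_rec q01 s_ge0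
  (kernel_cond_coercive HK) eta0.
exists C, m, Xm; split => // x; have [h1 h2 h3] := H x; split => //.
(* As nu_0 = lam_r / lam_0, the power 2 lam_r of the gauge of index 0 is <Q xi>^(2 lam_0). *)
rewrite (le_trans h1)// lerD2r ler_wpM2l// /gauge -powRrM.
rewrite /kbracket /kalman_row expr0 mulmx1 /nu /= invf_div -powR_mulrn ?powR_ge0//.
rewrite -powRrM le_eqVlt; apply/orP; left; apply/eqP; congr (_ `^ _).
by field; rewrite lt0r_neq0.
Qed.

Theorem bracket_pow_le : exists2 C, 1 <= C & forall x,
  (bracket x `^ lam r) ^+ 2 <= C * NN x.
Proof.
have lr := lam_gt0 (leqnn r).
have [C C1 H] := bracket_pow_le_gauge_sum lr nu_gt0 nu_le1 (kernel_cond_coercive HK).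
exists C => // x; rewrite (le_trans _ (H x))//.
by rewrite -powR_mulrn ?powR_ge0// -powRrM mulrC.
Qed.

End kalman_multiplier.

(** * Energy estimate *)

Section energy.
Context (R : realType) (n : nat).
Local Notation V := 'cV[R]_n.
Local Notation e i := (delta_mx i 0 : V).
Implicit Types (f g v : R -> V -> R) (x xi : V) (t : R).
Variable B : 'M[R]_n.
Local Notation wX := (drift_weight B).

Lemma wX_continuous m Xm : wX m Xm -> continuous m /\ continuous Xm.
Proof.
move=> [dm [cm cd _ _ _] /funext->]; split => //.
by apply: continuous_sum => i; apply: continuousTM; [exact: continuous_linear_form|exact: cd].
Qed.

Lemma wX_poly m Xm : wX m Xm -> poly_bounded m /\ poly_bounded Xm.
Proof.
move=> [dm [_ _ _ pm pd] /funext->]; split => //.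
by apply: poly_bounded_sum => i; apply: poly_boundedM; [exact: poly_bounded_linear|exact: pd].
Qed.

Definition xdrift f t x := \sum_i (B^T *m x) i 0 * pderiv i f t x.

Definition xtransport v t x :=
  \sum_i \sum_j B i j * x j 0 * pderiv i v t x.

Lemma sw_xdrift f : sw f -> sw (xdrift f).
Proof.
move=> sf; apply: (@sw_sum R n _ _ (fun i t x => (B^T *m x) i 0 * pderiv i f t x)) => [|i].
  exact: sw0.
exact/sw_linear/sw_pderiv.
Qed.

Lemma sw_xtransport v : sw v -> sw (xtransport v).
Proof.
move=> sv; apply: (@sw_sum R n _ _ (fun i t x => \sum_j B i j * x j 0 * pderiv i v t x)) => [|i].
  exact: sw0.
apply: (@sw_sum R n _ _ (fun j t x => B i j * x j 0 * pderiv i v t x)) => [|j]; first exact: sw0.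
have := swZ (B i j) (sw_xmul j (sw_pderiv i sv)).
by congr sw; apply/funext => t; apply/funext => x; rewrite /xmul mulrA.
Qed.

Lemma dom_poly_sw2 h f g t : continuous h -> poly_bounded h -> sw f -> sw g ->
  dom (fun x => h x * f t x * g t x).
Proof.
move=> ch ph sf sg; have [M fM] := sw_bounded sf.
have := domM (@sw_continuous _ _ f t sf) (fM t) (dom_poly_sw t ch ph sg).
by congr dom; apply/funext => x; ring.
Qed.

(** Multiplication by x_j and the derivative along e_i each reflect the variable, and their factors
    2 pi cancel up to sign: x_j d_i becomes - d_j xi_i, whose Leibniz expansion contains the
    diagonal term. *)
Lemma hartley_xmul_pderiv v i j t xi : sw v ->
  hartley (xmul j (pderiv i v) t) xi =
  - (i == j)%:R * hartley (v t) xi - xi i 0 * pderiv j (fun t => hartley (v t)) t xi.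
Proof.
move=> sv; have sd := sw_pderiv i sv; have sH := sw_hartley sv.
rewrite -[xi]opprK; move: (- xi) => z.
have h1 := hartley_is_pderive z (sw_dom t sd) (sw_dom t (sw_xmul j sd))
  (sw_dom t (sw_xmul j (sw_xmul j sd))).
have HE : hartley (pderiv i v t) =
    (fun z => - (2 * pi) * (z i 0 * hartley (v t) (- z))).
  apply/funext => y.
  have := @hartley_deriv R n (v t) (pderiv i v t) i y (sw_dom t sv) (sw_dom t sd)
    (sw_is_pderive sv i t).
  by move=> /= ->; rewrite -mulNr mulrA.
have h2 : is_derive z (e j) (fun z => hartley (v t) (- z)) (- pderiv j (fun t => hartley (v t)) t (- z)).
  pose L (w : V) (s : R) := s *: w - z.
  have E1 (h : R) : - (h *: e j + z) = h *: (- e j) + - z by rewrite opprD scalerN.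
  apply: (is_derive_affine (phi := fun z => - z) E1).
  exact/is_derive_Nv/sw_is_pderive.
have h3 : is_derive z (e j) (fun z : V => z i 0) ((i == j)%:R).
  have := @is_derive_linear R n 1%:M i j z.
  by under eq_fun do rewrite mul1mx; rewrite mxE.
have h4 := is_deriveZ (- (2 * pi)) (is_deriveM h3 h2).
case: h1 => _; rewrite HE; case: h4 => _.
have -> : (- (2 * pi) \*: ((fun z0 : V => z0 i 0) * (fun z0 => hartley (v t) (- z0)))) =
   (fun z0 => - (2 * pi) * (z0 i 0 * hartley (v t) (- z0))) by [].
move=> -> /esym/eqP.
have p0 : 2 * pi != 0 :> R by rewrite mulf_neq0// lt0r_neq0// pi_gt0.
move=> /eqP E; apply: (mulfI p0); rewrite [LHS]E [(- z) i 0]mxE.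
rewrite /GRing.scale /=; ring.
Qed.

Lemma hartley_xtransport v t xi : sw v ->
  hartley (xtransport v t) xi =
  - xdrift (fun t => hartley (v t)) t xi - \tr B * hartley (v t) xi.
Proof.
move=> sv; have sd i := sw_pderiv i sv.
have E : xtransport v t = fun x => \sum_i \sum_j B i j * xmul j (pderiv i v) t x.
  by apply/funext => x; apply: eq_bigr => i _; apply: eq_bigr => j _; rewrite /xmul mulrA.
have d i j : dom (fun x => B i j * xmul j (pderiv i v) t x) by exact/domZ/sw_dom/sw_xmul.
rewrite E hartley_sum => [|i]; last exact: dom_sum.
have -> : \tr B * hartley (v t) xi = \sum_i \sum_j B i j * ((i == j)%:R * hartley (v t) xi).
  rewrite mulr_suml; apply: eq_bigr => i _; rewrite (bigD1 i)//= big1 => [|j ji].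
    by rewrite eqxx mul1r addr0.
  by rewrite eq_sym (negbTE ji) mul0r mulr0.
have -> : xdrift (fun t => hartley (v t)) t xi =
    \sum_i \sum_j B i j * (xi i 0 * pderiv j (fun t => hartley (v t)) t xi).
  rewrite exchange_big; apply: eq_bigr => j _; rewrite mxE mulr_suml.
  by apply: eq_bigr => i _; rewrite mxE mulrA.
rewrite -opprD -big_split/= -sumrN; apply: eq_bigr => i _.
rewrite hartley_sum// -big_split/= -sumrN; apply: eq_bigr => j _.
rewrite hartleyZ ?hartley_xmul_pderiv//; last exact/sw_dom/sw_xmul.
by ring.
Qed.

(** The field m f^2 (B^T x) has divergence (tr B) m f^2 + (X m) f^2 + 2 m f (X f), and each of its
    partial derivatives integrates to zero. *)
Lemma energy_identity m Xm f t : wX m Xm -> sw f ->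
  J (fun x => Xm x * f t x * f t x) =
  J (fun x => - (2 * m x) * f t x * xdrift f t x - \tr B * m x * f t x * f t x).
Proof.
move=> wm sf; have [cm cX] := wX_continuous wm; have [pm pX] := wX_poly wm.
case: wm => dm [_ cd D _ pd] XE.
pose L i x := (B^T *m x) i 0.
have cL i : continuous (L i) by exact: continuous_linear_form.
have pL i : poly_bounded (L i) by exact: poly_bounded_linear.
pose G i x := L i x * m x * f t x * f t x.
pose dG i x := B i i * m x * f t x * f t x + L i x * dm i x * f t x * f t x
  + 2 * (m x * f t x * (L i x * pderiv i f t x)).
have sL i : sw (fun t x => L i x * pderiv i f t x) by exact/sw_linear/sw_pderiv.
have dom1 i : dom (fun x => B i i * m x * f t x * f t x).
  by apply: dom_poly_sw2 => //; [exact: continuousTZ|apply: poly_boundedM => //; exact: poly_bounded_cst].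
have dom2 i : dom (fun x => L i x * dm i x * f t x * f t x).
  by apply: dom_poly_sw2 => //; [exact: continuousTM|exact: poly_boundedM].
have dom3 i : dom (fun x => 2 * (m x * f t x * (L i x * pderiv i f t x))).
  exact/domZ/(dom_poly_sw2 t cm pm sf (sL i)).
have dG0 i : J (dG i) = 0.
  apply: (@J_deriv0 _ _ i (G i)).
  - move=> x; have h1 := is_deriveM (@is_derive_linear R n B^T i i x) (D i x).
    have h2 := is_deriveM (is_deriveM h1 (sw_is_pderive sf i t x)) (sw_is_pderive sf i t x).
    by move: h2; congr is_derive; rewrite /dG /L /GRing.scale /= ?fctE [_^T _ _]mxE; ring.
  - by apply: dom_poly_sw2 => //; [exact: continuousTM|exact: poly_boundedM].
  - by apply: domD => //; exact: domD.
have domG i : dom (dG i) by apply: domD => //; exact: domD.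
have : J (fun x => \sum_i dG i x) = 0 by rewrite J_sum// big1.
have d1 : dom (fun x => Xm x * f t x * f t x) by exact: dom_poly_sw2.
have d2 : dom (fun x => - (2 * m x) * f t x * xdrift f t x - \tr B * m x * f t x * f t x).
  apply: domD.
    apply: dom_poly_sw2 => //; last exact: sw_xdrift.
      by under eq_fun do rewrite -mulNr; exact: continuousTZ.
    by under eq_fun do rewrite -mulNr; apply: poly_boundedM => //; exact: poly_bounded_cst.
  by apply/domN/dom_poly_sw2 => //; [exact: continuousTZ|apply: poly_boundedM => //; exact: poly_bounded_cst].
move=> S0; apply/eqP; rewrite -subr_eq0 -JB//; apply/eqP; rewrite -[RHS]S0.
congr J; apply/funext => x; rewrite /dG XE /drift /xdrift /mxtrace.
rewrite !big_split/= -!mulr_suml -!mulr_sumr.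
by ring.
Qed.

End energy.

(** * Integration in time and space together *)

Section joint_functions.
Context (R : realType) (n : nat).
Local Notation V := 'cV[R]_n.
Implicit Types (f g v : R -> V -> R) (x xi : V) (t : R).

Definition tail (y : 'cV[R]_n.+1) : V := \col_i y (lift ord0 i) 0.

(* Joint functions of time and space live on R^(n+1), where the time integral is
   one more coordinate integral. *)
Definition joint f (y : 'cV[R]_n.+1) := f (y ord0 0) (tail y).

(** Membership in [sw] is uniform in t but gives no decay in t. That the product with 1 + t^2 is
    also in [sw] provides the integrable factor in time. *)
Definition time_weight f : R -> V -> R := fun t x => (1 + t ^+ 2) * f t x.

Lemma tail_cons a (x : V) : tail (consv a x) = x.
Proof. by apply/colP => i; rewrite mxE consvS. Qed.

Lemma cons_tail (y : 'cV[R]_n.+1) : consv (y ord0 0) (tail y) = y.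
Proof. by apply/colP => i; rewrite !mxE; case: unliftP => [j ->|->] //; rewrite mxE. Qed.

Lemma joint_cons f t x : joint f (consv t x) = f t x.
Proof. by rewrite /joint consv0 tail_cons. Qed.

Lemma continuous_tail : continuous tail.
Proof.
apply: continuous_cV => i; under eq_fun do rewrite mxE.
exact: continuous_coord.
Qed.

Lemma dom_joint W f g : continuous W -> poly_bounded W -> sw f -> sw g ->
  sw (time_weight g) -> dom (joint (fun t x => W x * f t x * g t x)).
Proof.
move=> cW pW sf sg swg; split.
  have cf h : sw h -> continuous (joint h).
    move=> sh; apply: (sw_continuous2 sh) continuous_tail.
    exact: continuous_coord.
  apply: continuousTM; last exact: cf.
  apply: continuousTM; last exact: cf.
  exact: continuous_compT continuous_tail cW.
have [M fM] := sw_bounded sf; have [D WD] := poly_bounded_sw pW swg.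
exists (M * D) => y; rewrite -(cons_tail y) joint_cons Wt_cons.
move: (y ord0 0) (tail y) => t x.
have -> : W x * f t x * g t x =
    f t x * ((1 + t ^+ 2)^-1 * (W x * time_weight g t x)).
  by rewrite /time_weight; field; rewrite lt0r_neq0 ?oneDsqr_gt0.
have t0 : 0 <= (1 + t ^+ 2)^-1 by rewrite invr_ge0 ltW ?oneDsqr_gt0.
rewrite normrM -!mulrA ler_pM// normrM [`|_^-1|]ger0_norm//.
by rewrite [leRHS]mulrCA; apply: ler_wpM2l.
Qed.

Lemma sw_time_weight_hartley v : sw v -> sw (time_weight v) ->
  sw (time_weight (fun t => hartley (v t))).
Proof.
move=> sv /sw_hartley; congr sw; apply/funext => t; apply/funext => xi.
by rewrite /time_weight hartleyZ//; exact: sw_dom.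
Qed.

(** The integrand is half of the time derivative of W f^2, and time is one coordinate of R^(n+1). *)
Lemma J_joint_tderiv W f : continuous W -> poly_bounded W -> sw f ->
  sw (time_weight f) -> J (joint (fun t x => W x * tderiv f t x * f t x)) = 0.
Proof.
move=> cW pW sf swf.
have d1 : dom (joint (fun t x => W x * f t x * f t x)) by exact: dom_joint.
have d2 : dom (joint (fun t x => W x * tderiv f t x * f t x)).
  by apply: dom_joint => //; exact: sw_tderiv.
have : J (fun y => 2 * joint (fun t x => W x * tderiv f t x * f t x) y) = 0.
  apply: (@J_deriv0 _ _ ord0 (joint (fun t x => W x * f t x * f t x))) => //; last exact: domZ.
  move=> y; rewrite -(cons_tail y) joint_cons; move: (y ord0 0) (tail y) => t x.
  apply: (is_derive_affine_inv (phi := fun a => consv a x) (w := (1 : R))).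
    by move=> h; exact: consv_affine0.
  under eq_fun do rewrite joint_cons.
  have h1 := is_deriveZ (W x) (is_deriveM (sw_is_tderive sf t x) (sw_is_tderive sf t x)).
  move: h1; congr is_derive; last by rewrite /GRing.scale /=; ring.
  by apply/funext => s; exact: mulrA.
by rewrite JZ// => /eqP; rewrite mulf_eq0 pnatr_eq0 /= => /eqP.
Qed.

End joint_functions.

(** * The energy estimate for a given multiplier *)

Section estimate.
Context (R : realType) (n : nat).
Local Notation V := 'cV[R]_n.
Implicit Types (f g v : R -> V -> R) (x xi : V) (t : R).
Variables (B : 'M[R]_n) (N G g0 m Xm : V -> R) (C : R).

Hypothesis cN : continuous N.
Hypothesis cG : continuous G.
Hypothesis cg0 : continuous g0.
Hypothesis pN : poly_bounded N.
Hypothesis pG : poly_bounded G.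
Hypothesis pg0 : poly_bounded g0.
Hypothesis N0 : forall x, 0 <= N x.
Hypothesis G0 : forall x, 0 <= G x.
Hypothesis C0 : 0 <= C.
Hypothesis wm : drift_weight B m Xm.
Hypothesis NX : forall x, N x <= C * g0 x + Xm x.
Hypothesis mN : forall x, `|\tr B| * `|m x| <= N x / 4.
Hypothesis mG : forall x, m x ^+ 2 <= C * N x * G x.

Definition field v t x := tderiv v t x + xtransport B v t x.

Lemma sw_field v : sw v -> sw (field v).
Proof. by move=> sv; apply: swD; [exact: sw_tderiv|exact: sw_xtransport]. Qed.

Lemma hartley_field v t xi : sw v ->
  hartley (field v t) xi = tderiv (fun t => hartley (v t)) t xi
    - xdrift B (fun t => hartley (v t)) t xi - \tr B * hartley (v t) xi.
Proof.
move=> sv; rewrite hartleyD; [|exact/sw_dom/sw_tderiv|exact/sw_dom/sw_xtransport].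
rewrite hartley_xtransport// addrA; congr (_ + _ + _).
by have [_ <-] := hartley_is_tderive t xi sv.
Qed.

(** With y = N a^2 / 4 and z = 4 C G b^2, the bound m^2 <= C N G gives (2 m a b)^2 <= 4 y z <= (y +
    z)^2. The trace term takes another quarter of N a^2. *)
Lemma multiplier_am_gm x (a b : R) :
  2 * m x * a * b + \tr B * m x * a * a <= N x * a * a / 2 + 4 * C * (G x * b * b).
Proof.
have h1 : \tr B * m x * a * a <= N x * a * a / 4.
  have -> : \tr B * m x * a * a = \tr B * m x * a ^+ 2 by ring.
  have -> : N x * a * a / 4 = N x / 4 * a ^+ 2 by ring.
  rewrite ler_wpM2r ?sqr_ge0// (le_trans _ (mN x))//.
  by rewrite (le_trans (ler_norm _))// normrM.
have h2 : 2 * m x * a * b <= N x * a * a / 4 + 4 * C * (G x * b * b).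
  have p1 : 0 <= N x * a * a / 4 by rewrite divr_ge0// -mulrA mulr_ge0// -expr2 sqr_ge0.
  have p2 : 0 <= 4 * C * (G x * b * b).
    apply: mulr_ge0; first exact: mulr_ge0.
    by rewrite -mulrA mulr_ge0// -expr2 sqr_ge0.
  rewrite (le_trans (ler_norm _))// -(ger0_norm (addr_ge0 p1 p2)).
  rewrite -ler_sqr ?nnegrE// !real_normK ?num_real//.
  apply: (@le_trans _ _ (4 * (N x * a * a / 4) * (4 * C * (G x * b * b)))).
    have -> : (2 * m x * a * b) ^+ 2 = 4 * (m x ^+ 2 * (a * b) ^+ 2) by ring.
    have -> : 4 * (N x * a * a / 4) * (4 * C * (G x * b * b)) =
      4 * (C * N x * G x * (a * b) ^+ 2) by field.
    by rewrite ler_wpM2l// ler_wpM2r ?sqr_ge0.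
  move: (N x * a * a / 4) (4 * C * _) => y z; rewrite -subr_ge0.
  have -> : (y + z) ^+ 2 - 4 * y * z = (y - z) ^+ 2 by ring.
  exact: sqr_ge0.
have -> : N x * a * a / 2 + 4 * C * (G x * b * b) =
  N x * a * a / 4 + 4 * C * (G x * b * b) + N x * a * a / 4 by field.
exact: lerD.
Qed.

Section instant.
Variable v : R -> V -> R.
Hypothesis sv : sw v.
Let f t := hartley (v t).
Let h t := hartley (field v t).

(** Half of the N term is absorbed on the left. The term in [tderiv] is kept: it vanishes for
    constant families and its integral in time is zero, so both operators are served. *)
Lemma instant_estimate t :
  J (fun x => N x * f t x * f t x) <=
  2 * C * J (fun x => g0 x * f t x * f t x) + 8 * C * J (fun x => G x * h t x * h t x)
    - 4 * J (fun x => m x * tderiv f t x * f t x).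
Proof.
have sf : sw f by exact: sw_hartley.
have sh : sw h by exact/sw_hartley/sw_field.
have [cm cX] := wX_continuous wm; have [pm pX] := wX_poly wm.
have dN : dom (fun x => N x * f t x * f t x) by exact: dom_poly_sw2.
have dg0 : dom (fun x => g0 x * f t x * f t x) by exact: dom_poly_sw2.
have dG : dom (fun x => G x * h t x * h t x) by exact: dom_poly_sw2.
have dX : dom (fun x => Xm x * f t x * f t x) by exact: dom_poly_sw2.
have sdf := sw_tderiv sf.
have dm : dom (fun x => m x * tderiv f t x * f t x) by exact: dom_poly_sw2.
have dmf : dom (fun x => m x * f t x * f t x) by exact: dom_poly_sw2.
have dmh : dom (fun x => m x * f t x * h t x) by exact: dom_poly_sw2.
have E : J (fun x => Xm x * f t x * f t x) <=
    J (fun x => - 2 * (m x * tderiv f t x * f t x) +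
      (2^-1 * (N x * f t x * f t x) + 4 * C * (G x * h t x * h t x))).
  rewrite (energy_identity t wm sf); apply: J_le.
  - have : dom (fun x => - 2 * (m x * tderiv f t x * f t x) +
      (2 * (m x * f t x * h t x) + \tr B * (m x * f t x * f t x))).
      by apply: domD; [exact: domZ|apply: domD; exact: domZ].
    congr dom; apply/funext => x.
    by rewrite /h hartley_field// -/(f t x); ring.
  - by apply: domD; [exact: domZ|apply: domD; exact: domZ].
  move=> x; have := multiplier_am_gm x (f t x) (h t x).
  rewrite -(lerD2l (- 2 * (m x * tderiv f t x * f t x))); congr (_ <= _).
    by rewrite /h hartley_field// -/(f t x); ring.
  by ring.
rewrite JD ?JD ?JZ// in E; try (by exact: domZ); last by apply: domD; exact: domZ.
have F : J (fun x => N x * f t x * f t x) <=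
    J (fun x => C * (g0 x * f t x * f t x) + Xm x * f t x * f t x).
  apply: J_le => //; first by apply: domD => //; exact: domZ.
  move=> x; rewrite !mulrA -mulrDl -mulrDl -!mulrA ler_wpM2r//.
  by rewrite -expr2 sqr_ge0.
rewrite JD ?JZ// in F; last exact: domZ.
move: E F; rewrite -!mulrA.
have key (jN jX jm jg jh : R) : jX <= - 2 * jm + (2^-1 * jN + 4 * jh) ->
  jN <= jg + jX -> jN <= 2 * jg + 8 * jh - 4 * jm by lra.
exact: key.
Qed.

Lemma static_estimate t : (forall s, v s = v 0) ->
  J (fun x => N x * f t x * f t x) <=
  2 * C * J (fun x => g0 x * f t x * f t x) + 8 * C * J (fun x => G x * h t x * h t x).
Proof.
move=> vE; have := instant_estimate t.
have -> : tderiv f t = fun=> 0.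
  apply/funext => x; rewrite /tderiv; under eq_fun do rewrite /f vE.
  by rewrite derive_cst.
rewrite (_ : J (fun x => m x * 0 * _) = 0) ?mulr0 ?subr0//.
by apply: Rintegral_eq0 => y; rewrite mulr0 mul0r.
Qed.

Lemma joint_estimate : sw (time_weight v) -> sw (time_weight (field v)) ->
  J (joint (fun t x => N x * f t x * f t x)) <=
  2 * C * J (joint (fun t x => g0 x * f t x * f t x)) +
  8 * C * J (joint (fun t x => G x * h t x * h t x)).
Proof.
move=> wv wg.
have sf : sw f by exact: sw_hartley.
have sh : sw h by exact/sw_hartley/sw_field.
have wf : sw (time_weight f) by exact: sw_time_weight_hartley.
have wh : sw (time_weight h) by apply: sw_time_weight_hartley => //; exact: sw_field.
have [cm _] := wX_continuous wm; have [pm _] := wX_poly wm.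
have sdf := sw_tderiv sf.
have dN := dom_joint cN pN sf sf wf.
have dg0 := dom_joint cg0 pg0 sf sf wf.
have dG := dom_joint cG pG sh sh wh.
have dm := dom_joint cm pm sdf sf wf.
have m0 := J_joint_tderiv cm pm sf wf.
(* The right side minus the left side of the estimate at one instant. Its integral over each time
   slice is nonnegative, and over R^(n+1) its term in [tderiv] drops out. *)
pose K (y : 'cV[R]_n.+1) := 2 * C * joint (fun t x => g0 x * f t x * f t x) y +
  8 * C * joint (fun t x => G x * h t x * h t x) y
  - 4 * joint (fun t x => m x * tderiv f t x * f t x) y
  - joint (fun t x => N x * f t x * f t x) y.
have dK1 : dom (fun y => 2 * C * joint (fun t x => g0 x * f t x * f t x) y +
  8 * C * joint (fun t x => G x * h t x * h t x) y).
  by apply: domD; exact: domZ.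
have dm4 := domZ 4 dm.
have dK2 := domD dK1 (domN dm4).
have dK : dom K by apply: domD => //; exact: domN.
have JK : J K = 2 * C * J (joint (fun t x => g0 x * f t x * f t x)) +
  8 * C * J (joint (fun t x => G x * h t x * h t x))
  - J (joint (fun t x => N x * f t x * f t x)).
  rewrite /K JB// JB// JD//; [|exact: domZ|exact: domZ].
  by rewrite !JZ// m0 mulr0 subr0.
rewrite -subr_ge0 -JK J_cons//; apply: Rintegral_ge0 => // a _.
have d1 : dom (fun x => N x * f a x * f a x) by exact: dom_poly_sw2.
have d2 : dom (fun x => g0 x * f a x * f a x) by exact: dom_poly_sw2.
have d3 : dom (fun x => G x * h a x * h a x) by exact: dom_poly_sw2.
have d4 : dom (fun x => m x * tderiv f a x * f a x) by exact: dom_poly_sw2.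
under eq_fun do rewrite /K !joint_cons.
have d5 : dom (fun x => 2 * C * (g0 x * f a x * f a x) + 8 * C * (G x * h a x * h a x)).
  by apply: domD; exact: domZ.
have d6 := domD d5 (domN (domZ 4 d4)).
rewrite JB// JB//; last exact: domZ.
rewrite JD//; [|exact: domZ|exact: domZ].
rewrite !JZ// subr_ge0.
exact: instant_estimate.
Qed.

End instant.

End estimate.

(** * Fourier multipliers and Schwartz functions *)

Section fourier_hartley.
Context (R : realType) (n : nat).
Local Notation V := 'cV[R]_n.
Implicit Types (v w g h F : V -> R) (x xi : V).
Local Open Scope complex_scope.

Lemma cos_cas (a : R) : cos a = (cas a + cas (- a)) / 2.
Proof. by rewrite casN /cas; field. Qed.

Lemma sin_cas (a : R) : sin a = (cas a - cas (- a)) / 2.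
Proof. by rewrite casN /cas; field. Qed.

(** Applied to a Hartley transform, the even and odd parts are the cosine and sine transforms, from
    which the Fourier transform is assembled. *)
Definition even_part g x := (g x + g (- x)) / 2.
Definition odd_part g x := (g x - g (- x)) / 2.

Lemma even_partN g x : even_part g (- x) = even_part g x.
Proof. by rewrite /even_part opprK addrC. Qed.

Lemma odd_partN g x : odd_part g (- x) = - odd_part g x.
Proof. by rewrite /odd_part opprK -mulNr opprB. Qed.

Lemma continuous_trig (k : R -> R) xi : continuous k ->
  continuous (fun x : V => k (2 * pi * dotv x xi)).
Proof.
move=> ck; apply: (continuous_compT (f := fun x => 2 * pi * dotv x xi)) => //.
by apply: continuousTZ; exact: continuous_dotvl.
Qed.

Lemma dom_cos g xi : dom g -> dom (fun x => cos (2 * pi * dotv x xi) * g x).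
Proof.
apply: (domM (C := 1)) => [|x]; first exact/continuous_trig/continuous_cos.
by rewrite ler_norml cos_geN1 cos_le1.
Qed.

Lemma dom_sin g xi : dom g -> dom (fun x => sin (2 * pi * dotv x xi) * g x).
Proof.
apply: (domM (C := 1)) => [|x]; first exact/continuous_trig/continuous_sin.
by rewrite ler_norml sin_geN1 sin_le1.
Qed.

Lemma J_cos g xi : dom g ->
  J (fun x => cos (2 * pi * dotv x xi) * g x) = even_part (hartley g) xi.
Proof.
move=> dg; rewrite /even_part /hartley -JD; try exact: dom_cas.
rewrite [RHS]mulrC -JZ; last by apply: domD; exact: dom_cas.
congr J; apply/funext => x; rewrite dotvNr mulrN cos_cas.
by ring.
Qed.

Lemma J_sin g xi : dom g ->
  J (fun x => sin (2 * pi * dotv x xi) * g x) = odd_part (hartley g) xi.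
Proof.
move=> dg; rewrite /odd_part /hartley -JB; try exact: dom_cas.
rewrite [RHS]mulrC -JZ; last by apply: domD; [|apply: domN]; exact: dom_cas.
congr J; apply/funext => x; rewrite dotvNr mulrN sin_cas.
by ring.
Qed.

Lemma integralcE (u : V -> R[i]) :
  integralc u = J (fun x => complex.Re (u x)) +i* J (fun x => complex.Im (u x)).
Proof. by []. Qed.

Lemma fourier_hartley (u : V -> R[i]) v w xi : dom v -> dom w ->
  (forall x, u x = v x +i* w x) ->
  fourier u xi = (even_part (hartley v) xi + odd_part (hartley w) xi) +i*
                 (even_part (hartley w) xi - odd_part (hartley v) xi).
Proof.
move=> dv dw uE; rewrite -!J_cos// -!J_sin//.
rewrite -JD; [|exact: dom_cos|exact: dom_sin].
rewrite -JB; [|exact: dom_cos|exact: dom_sin].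
rewrite /fourier integralcE; congr (_ +i* _); congr J; apply/funext => x;
  rewrite uE /expi cosN sinN /=; ring.
Qed.

(** As F is even, the integrands of the Fourier and Hartley expressions differ by an odd function of
    xi, so the integrals agree without any Fourier inversion. *)
Lemma fourier_mult_hartley F (u : V -> R[i]) v w :
  (forall x, u x = v x +i* w x) -> dom v -> dom w ->
  (forall x, F (- x) = F x) ->
  dom (fun x => F x * hartley v x) -> dom (fun x => F x * hartley w x) ->
  forall x, fourier_mult (fun x => (F x)%:C) u x =
    hartley (fun x => F x * hartley v x) x +i* hartley (fun x => F x * hartley w x) x.
Proof.
move=> uE dv dw FN dFv dFw x.
pose FE g xi := F xi * even_part (hartley g) xi.
pose FO g xi := F xi * odd_part (hartley g) xi.
have dE g : dom (fun x => F x * hartley g x) -> dom (FE g).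
  move=> dg; have := domZ 2^-1 (domD dg (domVN dg)).
  by congr dom; apply/funext => xi; rewrite FN /FE /even_part; ring.
have dO g : dom (fun x => F x * hartley g x) -> dom (FO g).
  move=> dg; have := domZ 2^-1 (domD dg (domN (domVN dg))).
  by congr dom; apply/funext => xi; rewrite FN /FO /odd_part; ring.
have FEO g xi : F xi * hartley g xi = FE g xi + FO g xi.
  by rewrite /FE /FO /even_part /odd_part; field.
pose c xi : R := cos (2 * pi * dotv x xi); pose s xi : R := sin (2 * pi * dotv x xi).
have cN xi : c (- xi) = c xi by rewrite /c dotvNr mulrN cosN.
have sN xi : s (- xi) = - s xi by rewrite /s dotvNr mulrN sinN.
have dc g : dom g -> dom (fun xi => c xi * g xi).
  by move=> dg; have := dom_cos x dg; congr dom; apply/funext => xi; rewrite dotvC.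
have ds g : dom g -> dom (fun xi => s xi * g xi).
  by move=> dg; have := dom_sin x dg; congr dom; apply/funext => xi; rewrite dotvC.
have eqJ (g h : V -> R) : dom g -> dom h -> (forall xi, g (- xi) - h (- xi) = - (g xi - h xi)) ->
    J g = J h.
  by move=> dg dh o; apply/eqP; rewrite -subr_eq0 -JB// J_odd//; apply: domD => //; exact: domN.
have HE g xi : cas (2 * pi * dotv xi x) * (F xi * hartley g xi) =
    c xi * FE g xi + s xi * FE g xi + (c xi * FO g xi + s xi * FO g xi).
  by rewrite FEO /cas dotvC -/(c xi) -/(s xi); ring.
have dH g : dom (fun x => F x * hartley g x) -> dom (fun xi => cas (2 * pi * dotv xi x) * (F xi * hartley g xi)).
  by move=> dg; exact: dom_cas.
have HD g : hartley g x = J (fun xi => cas (2 * pi * dotv xi x) * g xi) by [].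
rewrite /fourier_mult /inv_fourier integralcE; congr (_ +i* _); rewrite HD.
- apply: (@eqJ (fun xi => complex.Re (expi (2 * pi * dotv x xi) * ((F xi)%:C * fourier u xi)))) => [||xi].
  + have : dom (fun xi => c xi * FE v xi + c xi * FO w xi - (s xi * FE w xi - s xi * FO v xi)).
      exact: domD (domD (dc _ (dE _ dFv)) (dc _ (dO _ dFw))) (domN (domD (ds _ (dE _ dFw)) (domN (ds _ (dO _ dFv))))).
    congr dom; apply/funext => xi; rewrite (fourier_hartley xi dv dw uE) /= /FE /FO /c /s.
    by ring.
  + exact: dH.
  + rewrite !HE !(fourier_hartley _ dv dw uE) /= -!/(c _) -!/(s _).
    rewrite !cN !sN /FE /FO !FN !even_partN !odd_partN.
    by rewrite /c /s; ring.
- apply: (@eqJ (fun xi => complex.Im (expi (2 * pi * dotv x xi) * ((F xi)%:C * fourier u xi)))) => [||xi].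
  + have : dom (fun xi => c xi * FE w xi - c xi * FO v xi + (s xi * FE v xi + s xi * FO w xi)).
      exact: domD (domD (dc _ (dE _ dFw)) (domN (dc _ (dO _ dFv)))) (domD (ds _ (dE _ dFv)) (ds _ (dO _ dFw))).
    congr dom; apply/funext => xi; rewrite (fourier_hartley xi dv dw uE) /= /FE /FO /c /s.
    by ring.
  + exact: dH.
  + rewrite !HE !(fourier_hartley _ dv dw uE) /= -!/(c _) -!/(s _).
    rewrite !cN !sN /FE /FO !FN !even_partN !odd_partN.
    by rewrite /c /s; ring.
Qed.

End fourier_hartley.

Section L2.
Context (R : realType).
Local Open Scope complex_scope.

Lemma Lnorm2_EFin d (T : measurableType d) (mu : {measure set T -> \bar R})
    (F h : T -> R) (c : R) :
  (forall x, F x ^+ 2 = h x) -> (\int[mu]_x (h x)%:E = c%:E)%E -> 0 <= c ->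
  'N[mu]_2%:E[EFin \o F]%E = (Num.sqrt c)%:E.
Proof.
move=> Fh hc c0; rewrite unlock /Lnorm.
rewrite (eq_integral (fun x => (h x)%:E)) => [|x _].
  by rewrite hc poweR_EFin powR12_sqrt.
by rewrite /= powR_mulrn// -Fh real_normK// num_real.
Qed.

Lemma sqr_normc (a b : R) : ComplexField.Normc.normc (a +i* b) ^+ 2 = a ^+ 2 + b ^+ 2.
Proof. by rewrite /= sqr_sqrtr// addr_ge0 ?sqr_ge0. Qed.

Lemma L2norm_J n (u : 'cV[R]_n -> R[i]) a b : (forall x, u x = a x +i* b x) ->
  dom (fun x => a x ^+ 2) -> dom (fun x => b x ^+ 2) ->
  L2norm u = (Num.sqrt (J (fun x => a x ^+ 2) + J (fun x => b x ^+ 2)))%:E.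
Proof.
move=> uE da db; have dab := domD da db.
apply: (Lnorm2_EFin (h := fun y => a (vec y) ^+ 2 + b (vec y) ^+ 2)) => [y||].
- by rewrite uE sqr_normc.
- by rewrite -JD// EFin_J.
- by rewrite addr_ge0// J_ge0// => x; exact: sqr_ge0.
Qed.

Lemma L2norm_t_J n (u : R * 'cV[R]_n -> R[i]) a b :
  (forall p, u p = a p.1 p.2 +i* b p.1 p.2) ->
  dom (joint (fun t x => a t x ^+ 2)) -> dom (joint (fun t x => b t x ^+ 2)) ->
  L2norm_t u = (Num.sqrt (J (joint (fun t x => a t x ^+ 2)) +
                          J (joint (fun t x => b t x ^+ 2))))%:E.
Proof.
move=> uE da db; have dab := domD da db.
pose F (p : measurableTypeR R * n.-tuple (measurableTypeR R)) :=
  ComplexField.Normc.normc (u (p.1, vec p.2)).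
pose h (p : measurableTypeR R * n.-tuple (measurableTypeR R)) :=
  a p.1 (vec p.2) ^+ 2 + b p.1 (vec p.2) ^+ 2.
apply: (@Lnorm2_EFin _ _ (lebesgue_measure \x lebesgue_tuple R n)%E F h) => [y||].
- by rewrite /F uE sqr_normc.
- rewrite -JD// J_cons_prod// /Rintegral fineK.
    by apply: eq_integral => p _; rewrite !joint_cons.
  exact: integrable_fin_num (integrable_cons dab).
- by rewrite addr_ge0// J_ge0// => x; exact: sqr_ge0.
Qed.

End L2.

(** * Norms of multipliers on the Hartley side *)

Section weighted_norms.
Context (R : realType) (n : nat).
Local Notation V := 'cV[R]_n.
Implicit Types (f g v w : R -> V -> R) (x xi : V) (t : R) (M : 'M[R]_n) (c : R).
Local Open Scope complex_scope.

Definition weighted M c f : R -> V -> R := fun t x => bracket (M *m x) `^ c * f t x.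

Definition hmult M c v : R -> V -> R := fun t => hartley (weighted M c (fun t => hartley (v t)) t).

Definition tsw f := sw f /\ sw (time_weight f).

Lemma sw_weighted M c f : sw f -> sw (weighted M c f).
Proof. exact: sw_bracket_pow. Qed.

Lemma sw_hmult M c v : sw v -> sw (hmult M c v).
Proof. by move=> sv; apply/sw_hartley/sw_weighted/sw_hartley. Qed.

Lemma tsw_hartley v : tsw v -> tsw (fun t => hartley (v t)).
Proof. by move=> [sv wv]; split; [exact: sw_hartley|exact: sw_time_weight_hartley]. Qed.

Lemma tsw_weighted M c v : tsw v -> tsw (weighted M c v).
Proof.
move=> [sv wv]; split; first exact: sw_weighted.
have := sw_weighted M c wv; congr sw; apply/funext => t; apply/funext => x.
by rewrite /weighted /time_weight mulrCA.
Qed.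

Lemma tsw_hmult M c v : tsw v -> tsw (hmult M c v).
Proof. by move=> sv; apply/tsw_hartley/tsw_weighted/tsw_hartley. Qed.

Lemma hartley_hmult M c v t : sw v ->
  hartley (hmult M c v t) = weighted M c (fun t => hartley (v t)) t.
Proof. by move=> sv; apply: hartleyK; exact/sw_weighted/sw_hartley. Qed.

Lemma dom_sqr f t : sw f -> dom (fun x => f t x ^+ 2).
Proof.
move=> sf; have := dom_poly_sw2 t (@cst_continuous _ _ (1 : R)) (@poly_bounded_cst R n 1) sf sf.
by congr dom; apply/funext => x; rewrite mul1r expr2.
Qed.

Lemma dom_joint_sqr f : tsw f -> dom (joint (fun t x => f t x ^+ 2)).
Proof.
move=> [sf wf]; have := dom_joint (@cst_continuous _ _ (1 : R)) (@poly_bounded_cst R n 1) sf sf wf.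
by congr dom; apply/funext => y; rewrite /joint mul1r expr2.
Qed.

Lemma fourier_mult_hmult M c v w (u : V -> R[i]) t : sw v -> sw w ->
  (forall x, u x = v t x +i* w t x) ->
  forall x, fourier_mult (bracket_pow M c) u x = hmult M c v t x +i* hmult M c w t x.
Proof.
move=> sv sw' uE.
have d v' : sw v' -> dom (fun x => bracket (M *m x) `^ c * hartley (v' t) x).
  by move=> sv'; exact: (sw_dom t (sw_weighted M c (sw_hartley sv'))).
apply: (fourier_mult_hartley (F := fun x => bracket (M *m x) `^ c)).
- exact: uE.
- exact: sw_dom.
- exact: sw_dom.
- by move=> x; rewrite mulmxN bracketN.
- exact: d.
- exact: d.
Qed.

Lemma J_hmult_sqr M c v t : sw v ->
  J (fun x => hmult M c v t x ^+ 2) = J (fun x => weighted M c (fun t => hartley (v t)) t x ^+ 2).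
Proof. by move=> sv; apply: hartley_plancherel; exact/sw_weighted/sw_hartley. Qed.

(** The multiplier acts in x only, so Plancherel is applied slice by slice in time. *)
Lemma J_joint_hmult_sqr M c v : tsw v ->
  J (joint (fun t x => hmult M c v t x ^+ 2)) =
  J (joint (fun t x => weighted M c (fun t => hartley (v t)) t x ^+ 2)).
Proof.
move=> sv; have sv1 := sv.1.
rewrite !J_cons; [|exact/dom_joint_sqr/tsw_weighted/tsw_hartley|exact/dom_joint_sqr/tsw_hmult].
apply: eq_Rintegral => a _.
have -> : (fun x => joint (fun t x => hmult M c v t x ^+ 2) (consv a x)) =
    (fun x => hmult M c v a x ^+ 2) by apply/funext => x; exact: joint_cons.
rewrite (J_hmult_sqr M c a sv1); congr J; apply/funext => x.
by rewrite joint_cons.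
Qed.

Lemma L2norm_fourier_mult M c v w (u : V -> R[i]) t : sw v -> sw w ->
  (forall x, u x = v t x +i* w t x) ->
  L2norm (fourier_mult (bracket_pow M c) u) =
  (Num.sqrt (J (fun x => weighted M c (fun t => hartley (v t)) t x ^+ 2) +
             J (fun x => weighted M c (fun t => hartley (w t)) t x ^+ 2)))%:E.
Proof.
move=> sv sw' uE; rewrite (L2norm_J (fourier_mult_hmult M c sv sw' uE)).
- by rewrite (J_hmult_sqr M c t sv) (J_hmult_sqr M c t sw').
- exact/dom_sqr/sw_hmult.
- exact/dom_sqr/sw_hmult.
Qed.

Lemma L2norm_t_fourier_mult M c v w (u : R * V -> R[i]) : tsw v -> tsw w ->
  (forall p, u p = v p.1 p.2 +i* w p.1 p.2) ->
  L2norm_t (fourier_mult_t (bracket_pow M c) u) =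
  (Num.sqrt (J (joint (fun t x => weighted M c (fun t => hartley (v t)) t x ^+ 2)) +
             J (joint (fun t x => weighted M c (fun t => hartley (w t)) t x ^+ 2))))%:E.
Proof.
move=> sv sw' uE; rewrite (@L2norm_t_J _ _ _ (hmult M c v) (hmult M c w)).
- by rewrite (J_joint_hmult_sqr M c sv) (J_joint_hmult_sqr M c sw').
- by move=> [t x]; apply: (fourier_mult_hmult M c sv.1 sw'.1) => y; exact: uE.
- exact/dom_joint_sqr/tsw_hmult.
- exact/dom_joint_sqr/tsw_hmult.
Qed.

(** The Hartley side of <D>^s <M D>^c v. *)
Definition source_field M c s v : R -> V -> R :=
  fun t => weighted 1%:M s (weighted M c (fun t => hartley (v t))) t.

Lemma source_fieldE M c s v : sw v ->
  source_field M c s v = weighted 1%:M s (fun t => hartley (hmult M c v t)).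
Proof.
move=> sv; apply/funext => t; apply/funext => x.
by rewrite /source_field /weighted hartley_hmult.
Qed.

Lemma Hnorm_fourier_mult M c s v w (u : V -> R[i]) t : sw v -> sw w ->
  (forall x, u x = v t x +i* w t x) ->
  Hnorm s (fourier_mult (bracket_pow M c) u) =
  (Num.sqrt (J (fun x => source_field M c s v t x ^+ 2) +
             J (fun x => source_field M c s w t x ^+ 2)))%:E.
Proof.
move=> sv sw' uE; rewrite /Hnorm (@L2norm_fourier_mult _ _ (hmult M c v) (hmult M c w) _ t).
- by rewrite (source_fieldE M c s sv) (source_fieldE M c s sw').
- exact: sw_hmult.
- exact: sw_hmult.
- exact: fourier_mult_hmult.
Qed.

Lemma Hnorm_t_fourier_mult M c s v w (u : R * V -> R[i]) : tsw v -> tsw w ->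
  (forall p, u p = v p.1 p.2 +i* w p.1 p.2) ->
  Hnorm_t s (fourier_mult_t (bracket_pow M c) u) =
  (Num.sqrt (J (joint (fun t x => source_field M c s v t x ^+ 2)) +
             J (joint (fun t x => source_field M c s w t x ^+ 2))))%:E.
Proof.
move=> sv sw' uE; rewrite /Hnorm_t (@L2norm_t_fourier_mult _ _ (hmult M c v) (hmult M c w)).
- by rewrite (source_fieldE M c s sv.1) (source_fieldE M c s sw'.1).
- exact: tsw_hmult.
- exact: tsw_hmult.
- by move=> [t x]; apply: (fourier_mult_hmult M c sv.1 sw'.1) => y; exact: uE.
Qed.

End weighted_norms.

(** * From Schwartz functions to Schwartz families *)

Section schwartz_generated.
Context (R : realType) (V : normedModType R) (I : Type).
Variables (coord : I -> V -> R).
Hypothesis coord_le : forall i x, `|coord i x| <= `|x|.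
Hypothesis coord_affine : forall i x v (h : R), coord i (h *: v + x) = h * coord i v + coord i x.

(* By the Leibniz rule this class is closed under differentiation, which spares
   the computation of the iterated derivatives of a product. *)
Inductive generated (phi : V -> R) : (V -> R) -> Prop :=
| generated_derive vs : generated phi (iter_derive vs phi)
| generated_coord i g : generated phi g -> generated phi (fun x => coord i x * g x)
| generated_add g h : generated phi g -> generated phi h -> generated phi (fun x => g x + h x)
| generated_scale c g : generated phi g -> generated phi (fun x => c * g x).

(** Multiplication by a coordinate costs one power of |x|. *)
Lemma generated_rapid phi g : schwartz_real phi -> generated phi g -> rapidly_decreasing g.
Proof.
move=> sphi; elim => {g} [vs|i g _ IH|g h _ IHg _ IHh|c g _ IH].
- by have [] := sphi vs.
- move=> k; have [C HC] := IH k.+1; exists C => x.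
  rewrite (le_trans _ (HC x))// exprSr -mulrA ler_wpM2l ?exprn_ge0// normrM.
  by rewrite ler_wpM2r.
- move=> k; have [C HC] := IHg k; have [D HD] := IHh k; exists (C + D) => x.
  rewrite (le_trans _ (lerD (HC x) (HD x)))// -mulrDr ler_wpM2l ?exprn_ge0//.
  exact: ler_normD.
- move=> k; have [C HC] := IH k; exists (`|c| * C) => x.
  by rewrite normrM mulrCA ler_wpM2l.
Qed.

Lemma generated_bounded phi g : schwartz_real phi -> generated phi g ->
  exists C, forall x, `|g x| <= C.
Proof.
move=> sphi gg; have [C HC] := generated_rapid sphi gg 0%N.
by exists C => x; rewrite (le_trans _ (HC x))// expr0 mul1r.
Qed.

Lemma is_derive_coord i x v : is_derive x v (coord i) (coord i v).
Proof.
apply: (@is_derive_quadratic _ _ _ _ _ _ 0) => h.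
by rewrite mul0r coord_affine addrK subrr normr0.
Qed.

Lemma generated_is_derive phi g v : schwartz_real phi -> generated phi g ->
  exists2 dg, generated phi dg & forall x, is_derive x v g (dg x).
Proof.
move=> sphi; elim => {g} [vs|i g gg [dg ggd gd]|g h _ [dg ggd gd] _ [dh hhd hd]|c g _ [dg ggd gd]].
- exists (iter_derive (v :: vs) phi); first exact: generated_derive.
  by move=> x; apply/derivableP/diff_derivable; have [] := sphi vs.
- exists (fun x => coord i x * dg x + coord i v * g x).
    by apply: generated_add; [exact: generated_coord|exact: generated_scale].
  move=> x; have := is_deriveM (is_derive_coord i x v) (gd x).
  by congr is_derive; rewrite /GRing.scale /=; ring.
- by exists (fun x => dg x + dh x) => [|x]; [exact: generated_add|exact: is_deriveD].
- by exists (fun x => c * dg x) => [|x]; [exact: generated_scale|exact: is_deriveZ].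
Qed.

Lemma generated_self phi : generated phi phi.
Proof. exact: (generated_derive phi [::]). Qed.

Lemma generated_sum phi (J : Type) (r : seq J) (g : J -> V -> R) :
  (forall j, generated phi (g j)) -> generated phi (fun x => \sum_(j <- r) g j x).
Proof.
move=> gg; elim: r => [|j r IH].
  have := generated_scale 0 (generated_self phi); congr generated.
  by apply/funext => x; rewrite big_nil mul0r.
by under eq_fun do rewrite big_cons; exact: generated_add.
Qed.

End schwartz_generated.

Section schwartz_families.
Context (R : realType) (n : nat).
Local Notation V := 'cV[R]_n.
Local Notation e i := (delta_mx i 0 : V).

Lemma coord_le_norm (x : V) i : `|x i 0| <= `|x|.
Proof.
rewrite [leRHS]/Num.norm /= mx_normrE; apply/bigmax_geP; right => /=.
by exists (i, 0).
Qed.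

Definition coord0 (i : 'I_n) (x : V) := x i 0.

Definition coord1 (i : option 'I_n) (p : R * V) := if i is Some j then p.2 j 0 else p.1.

Lemma coord0_le i x : `|coord0 i x| <= `|x|.
Proof. exact: coord_le_norm. Qed.

Lemma coord0_affine i x v (h : R) : coord0 i (h *: v + x) = h * coord0 i v + coord0 i x.
Proof. by rewrite /coord0 !mxE. Qed.

Lemma coord1_le i p : `|coord1 i p| <= `|p|.
Proof.
case: i => [j|] /=; rewrite prod_normE le_max; last by rewrite lexx.
by rewrite coord_le_norm orbT.
Qed.

Lemma coord1_affine i p v (h : R) : coord1 i (h *: v + p) = h * coord1 i v + coord1 i p.
Proof. by case: i => [j|] //=; rewrite !mxE. Qed.

Lemma sw_generated0 phi g : schwartz_real phi -> generated coord0 phi g ->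
  sw (fun=> g : V -> R).
Proof.
move=> sphi gg; apply: (@sw_ind _ _ (fun f => exists2 g, generated coord0 phi g & f = fun=> g)); last by exists g.
move=> {g gg}_ [g gg ->]; split.
- by have [C HC] := generated_bounded coord0_le sphi gg; exists C.
(* The zero time derivative is written as a multiple of [g], which keeps it in the generated
   class. *)
- exists (fun _ x => 0 * g x); last by move=> t x; rewrite mul0r; exact: is_derive_cst.
  by exists (fun x => 0 * g x) => //; exact: generated_scale.
- move=> i; have [dg ggd gd] := generated_is_derive coord0_affine (e i) sphi gg.
  by exists (fun=> dg) => //; exists dg.
- by move=> i; exists (fun x : V => coord0 i x * g x) => //; exact: (generated_coord i gg).
Qed.

Lemma is_derive_slice_time (g : R * V -> R) t x d :
  is_derive (t, x) ((1, 0) : R * V) g d -> is_derive t (1 : R) (fun s => g (s, x)) d.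
Proof.
move=> gd; apply: (is_derive_affine (phi := fun s : R => (s, x)) (v := (1, 0))) => // h.
by congr (_, _); rewrite /= scaler0 add0r.
Qed.

Lemma is_derive_slice_space (g : R * V -> R) t x v d :
  is_derive (t, x) ((0, v) : R * V) g d -> is_derive x v (fun y => g (t, y)) d.
Proof.
move=> gd; apply: (is_derive_affine (phi := fun y : V => (t, y)) (v := (0, v))) => // h.
by congr (_, _); rewrite /= scaler0 add0r.
Qed.

Definition slice (g : R * V -> R) : R -> V -> R := fun t x => g (t, x).

Lemma sw_generated1 phi g : schwartz_real phi -> generated coord1 phi g -> sw (slice g).
Proof.
move=> sphi gg; apply: (@sw_ind _ _ (fun f => exists2 g, generated coord1 phi g & f = slice g)); last by exists g.
move=> {g gg}_ [g gg ->]; split.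
- by have [C HC] := generated_bounded coord1_le sphi gg; exists C => t x; exact: HC.
- have [dg ggd gd] := generated_is_derive coord1_affine (1, 0) sphi gg.
  by exists (slice dg); [exists dg|move=> t x; exact: is_derive_slice_time].
- move=> i; have [dg ggd gd] := generated_is_derive coord1_affine (0, e i) sphi gg.
  by exists (slice dg); [exists dg|move=> t x; exact: is_derive_slice_space].
- by move=> i; exists (fun p : R * V => coord1 (Some i) p * g p) => //; exact: (generated_coord (Some i) gg).
Qed.

(** The factor 1 + t^2 is generated by two multiplications by the time coordinate [None]. *)
Lemma tsw_generated1 phi g : schwartz_real phi -> generated coord1 phi g -> tsw (slice g).
Proof.
move=> sphi gg; split; first exact: sw_generated1 gg.
have := sw_generated1 sphi (generated_add gg (generated_coord None (generated_coord None gg))).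
by congr sw; apply/funext => t; apply/funext => x; rewrite /slice /time_weight /=; ring.
Qed.

Variable B : 'M[R]_n.

(** The coefficients of the transport operator are constants and coordinates, so it preserves the
    generated class; L u thus inherits the decay in time of u. *)
Lemma field_generated1 phi g : schwartz_real phi -> generated coord1 phi g ->
  exists2 h, generated coord1 phi h & field B (slice g) = slice h.
Proof.
move=> sphi gg.
have [dt gdt gt] := generated_is_derive coord1_affine (1, 0) sphi gg.
have /choice[dx gdx] : forall i, exists dg, generated coord1 phi dg /\
    forall p, is_derive p ((0, e i) : R * V) g (dg p).
  by move=> i; have [dg ggd gd] := generated_is_derive coord1_affine (0, e i) sphi gg; exists dg.
exists (fun p => dt p + \sum_i \sum_j B i j * (p.2 j 0 * dx i p)).
  apply: generated_add => //; apply: generated_sum => i; apply: generated_sum => j.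
  by apply/generated_scale/(generated_coord (Some j)); have [] := gdx i.
apply/funext => t; apply/funext => x; rewrite /field /slice; congr (_ + _).
  by rewrite /tderiv; have [_ <-] := is_derive_slice_time (gt (t, x)).
apply: eq_bigr => i _; apply: eq_bigr => j _; rewrite -mulrA; congr (_ * (_ * _)).
by rewrite /pderiv; have [_ <-] := is_derive_slice_space ((gdx i).2 (t, x)).
Qed.

Local Open Scope complex_scope.

Lemma sum_complex (J : Type) (r : seq J) (a b : J -> R) :
  \sum_(j <- r) (a j +i* b j) = (\sum_(j <- r) a j) +i* (\sum_(j <- r) b j) :> R[i].
Proof.
elim: r => [|j r IH]; first by rewrite !big_nil.
by rewrite !big_cons IH.
Qed.

Lemma sum_scale_complex (c : 'I_n -> 'I_n -> R) (a b : 'I_n -> R) :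
  \sum_i \sum_j (c i j)%:C * (a i +i* b i) =
  (\sum_i \sum_j c i j * a i) +i* (\sum_i \sum_j c i j * b i) :> R[i].
Proof.
rewrite -sum_complex; apply: eq_bigr => i _.
rewrite -sum_complex; apply: eq_bigr => j _.
by rewrite /GRing.mul /= !mul0r subr0 addr0.
Qed.

Lemma transport_tE (u : R * V -> R[i]) p : schwartz u ->
  transport_t B u p =
  field B (slice (fun p => complex.Re (u p))) p.1 p.2 +i*
  field B (slice (fun p => complex.Im (u p))) p.1 p.2.
Proof.
case: p => t x [sv sw'] /=.
have E phi : schwartz_real phi -> field B (slice phi) t x =
    'D_((1, 0) : R * V) phi (t, x) +
    \sum_i \sum_j B i j * x j 0 * 'D_((0, e i) : R * V) phi (t, x).
  move=> sphi; have [dphi _] := sphi [::].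
  have D v : is_derive (t, x) v phi ('D_v phi (t, x)).
    by apply/derivableP/diff_derivable.
  rewrite /field; congr (_ + _).
    by have [_ <-] := is_derive_slice_time (D (1, 0)).
  apply: eq_bigr => i _; apply: eq_bigr => j _; congr (_ * _).
  by have [_ <-] := is_derive_slice_space (D (0, e i)).
rewrite (E _ sv) (E _ sw') /transport_t.
by rewrite /derivec sum_scale_complex.
Qed.

Lemma transportE (u : V -> R[i]) x : schwartz u ->
  transport B u x =
  field B (fun _ x => complex.Re (u x)) 0 x +i* field B (fun _ x => complex.Im (u x)) 0 x.
Proof.
move=> [sv sw'].
have E phi : field B (fun _ => phi) 0 x = \sum_i \sum_j B i j * x j 0 * 'D_(e i) phi x.
  by rewrite /field /tderiv derive_cst add0r.
by rewrite !E /transport /derivec sum_scale_complex.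
Qed.

End schwartz_families.

Section sqrt_bounds.
Context (R : realType).

Lemma sqrtrD_le (x y : R) : 0 <= x -> 0 <= y -> Num.sqrt (x + y) <= Num.sqrt x + Num.sqrt y.
Proof.
move=> x0 y0; have s0 : 0 <= Num.sqrt x + Num.sqrt y by rewrite addr_ge0 ?sqrtr_ge0.
rewrite -[leRHS](ger0_norm s0) -sqrtr_sqr ler_wsqrtr// sqrrD !sqr_sqrtr//.
by rewrite addrAC lerDl mulrn_wge0// mulr_ge0 ?sqrtr_ge0.
Qed.

Lemma sqrtr_sum_le (k : nat) (a : 'I_k -> R) : (forall j, 0 <= a j) ->
  Num.sqrt (\sum_j a j) <= \sum_j Num.sqrt (a j).
Proof.
elim: k a => [|k IH] a a0; first by rewrite !big_ord0 sqrtr0.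
rewrite !big_ord_recl (le_trans (sqrtrD_le _ _))// ?sumr_ge0//.
by rewrite lerD2l IH.
Qed.

(** The passage from squared norms to norms. The summand 1 keeps the constant positive when K =
    0. *)
Lemma sqrt_bound (k : nat) (K l a0 : R) (a : 'I_k -> R) : 0 <= K -> 0 <= a0 ->
  (forall j, 0 <= a j) -> l <= K * (a0 + \sum_j a j) ->
  ((Num.sqrt l)%:E <= (Num.sqrt K + 1)%:E * ((Num.sqrt a0)%:E + \sum_(j < k) (Num.sqrt (a j))%:E))%E.
Proof.
move=> K0 a00 aj0 H; rewrite sumEFin -EFinD -EFinM lee_fin.
have S0 : 0 <= \sum_j a j by exact: sumr_ge0.
have s0 : 0 <= Num.sqrt a0 + \sum_j Num.sqrt (a j).
  by rewrite addr_ge0 ?sqrtr_ge0// sumr_ge0// => j _; exact: sqrtr_ge0.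
rewrite (le_trans (ler_wsqrtr H))// sqrtrM// mulrDl mul1r.
apply: (@le_trans _ _ (Num.sqrt K * (Num.sqrt a0 + \sum_j Num.sqrt (a j)))).
  rewrite ler_wpM2l ?sqrtr_ge0// (le_trans (sqrtrD_le _ _))// lerD2l.
  exact: sqrtr_sum_le.
by rewrite lerDl.
Qed.

End sqrt_bounds.

(** * The estimates for the two operators *)

Section hypoelliptic_estimate.
Context (R : realType) (n : nat).
Local Notation V := 'cV[R]_n.
Implicit Types (f h v w : R -> V -> R) (x xi : V) (t : R) (M : 'M[R]_n).
Variables (B Q : 'M[R]_n) (r : nat) (lam q s : nat -> R).

Hypothesis HK : kernel_cond B Q r.
Hypothesis lam0_gt0 : 0 < lam 0%N.
Hypothesis q01 : forall j, (j < r)%N -> 0 <= q j <= 1.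
Hypothesis s_ge0 : forall j, (j < r)%N -> 0 <= s j.
Hypothesis hlam : forall j : nat, (j < r)%N ->
  lam j.+1 * ((1 - q j) / lam j + 1) = 1 + s j.
Hypothesis lam_decr : forall j : nat, (j < r)%N -> lam j.+1 < lam j.
Hypothesis lam_conv : forall j : nat, (2 <= j <= r)%N ->
  lam (j - 1)%N / lam (j - 2)%N + lam (j - 1)%N / lam j <= 2.

Local Notation NN := (gauge_sum B Q r (scale_exponent r lam) (lam r)).
Local Notation SW := (source_weight B Q r q s).
Local Notation g0 := (fun x => (bracket (Q *m x) `^ lam 0%N) ^+ 2).
Local Notation source j h :=
  (weighted 1%:M (s j) (weighted (Q *m B^T ^+ j) (q j) h)).

Lemma continuous_bracket_powM M c M' c' :
  continuous (fun x : V => (bracket (M *m x) `^ c * bracket (M' *m x) `^ c') ^+ 2).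
Proof.
under eq_fun do rewrite expr2.
by do !apply: continuousTM; exact: continuous_bracket_pow.
Qed.

Lemma poly_bounded_bracket_powM M c M' c' :
  poly_bounded (fun x : V => (bracket (M *m x) `^ c * bracket (M' *m x) `^ c') ^+ 2).
Proof.
under eq_fun do rewrite expr2.
by do !apply: poly_boundedM; exact: poly_bounded_bracket_pow.
Qed.

Lemma source_weight_regular : continuous SW /\ poly_bounded SW.
Proof.
split.
  apply: continuous_sum => j; have := @continuous_bracket_powM (kalman_row B Q j) (q j) 1%:M (s j).
  by under eq_fun do rewrite mul1mx.
apply: poly_bounded_sum => j; have := @poly_bounded_bracket_powM (kalman_row B Q j) (q j) 1%:M (s j).
by under eq_fun do rewrite mul1mx.
Qed.

Lemma gauge_sum_regular : continuous NN /\ poly_bounded NN.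
Proof.
have E i x : gauge B Q (scale_exponent r lam) i x `^ (2 * lam r) =
    bracket (kalman_row B Q i *m x) `^ ((scale_exponent r lam i)^-1 * (2 * lam r)).
  by rewrite [RHS]powRrM.
split.
  apply: continuous_sum => j; under eq_fun do rewrite E; exact: continuous_bracket_pow.
apply: poly_bounded_sum => j; under eq_fun do rewrite E; exact: poly_bounded_bracket_pow.
Qed.

Lemma initial_weight_regular : continuous g0 /\ poly_bounded g0.
Proof.
split; under eq_fun do rewrite expr2.
  by apply: continuousTM; exact: continuous_bracket_pow.
by apply: poly_boundedM; exact: poly_bounded_bracket_pow.
Qed.

(** [tau] and [p] read time and space off the integration variable: time is frozen in the static
    case and is the first coordinate in the joint case. The weighted integrals become squared norms,
    and 10 = 2 + 8 merges the two constants. *)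
Lemma weights_realized m (tau : 'cV[R]_m -> R) (p : 'cV[R]_m -> V) f h C :
  let re F y := F (tau y) (p y) in
  0 <= C ->
  dom (re (fun t x => NN x * f t x * f t x)) ->
  dom (re (fun t x => weighted 1%:M (lam r) f t x ^+ 2)) ->
  (forall j, dom (re (fun t x => source j h t x ^+ 2))) ->
  J (re (fun t x => NN x * f t x * f t x)) <=
    2 * C * J (re (fun t x => g0 x * f t x * f t x)) +
    8 * C * J (re (fun t x => SW x * h t x * h t x)) ->
  forall C1, (forall x, (bracket x `^ lam r) ^+ 2 <= C1 * NN x) -> 0 <= C1 ->
  J (re (fun t x => weighted 1%:M (lam r) f t x ^+ 2)) <=
    10 * C * C1 * (J (re (fun t x => weighted Q (lam 0%N) f t x ^+ 2)) +
    \sum_(j < r) J (re (fun t x => source j h t x ^+ 2))).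
Proof.
move=> re C0 dN dr dS H C1 HC1 C10.
have E0 : re (fun t x => g0 x * f t x * f t x) = re (fun t x => weighted Q (lam 0%N) f t x ^+ 2).
  by apply/funext => y; rewrite /re /weighted exprMn -mulrA -expr2.
have ES : re (fun t x => SW x * h t x * h t x) =
    fun y => \sum_(j < r) re (fun t x => source j h t x ^+ 2) y.
  apply/funext => y; rewrite /re /source_weight -mulrA -expr2 mulr_suml.
  apply: eq_bigr => j _; rewrite /weighted mul1mx -exprMn; congr (_ ^+ 2).
  by rewrite /kbracket /kalman_row [RHS]mulrCA [RHS]mulrA.
rewrite E0 ES J_sum// in H.
have L : J (re (fun t x => weighted 1%:M (lam r) f t x ^+ 2)) <=
    C1 * J (re (fun t x => NN x * f t x * f t x)).
  rewrite -JZ//; apply: J_le => //; first exact: domZ.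
  move=> y; rewrite /re /weighted mul1mx exprMn -[NN _ * _ * _]mulrA -[f _ _ * _]expr2 mulrA.
  by rewrite ler_wpM2r ?sqr_ge0.
apply: (le_trans L).
have a0 : 0 <= J (re (fun t x => weighted Q (lam 0%N) f t x ^+ 2)).
  by apply: J_ge0 => y; exact: sqr_ge0.
have b0 : 0 <= \sum_(j < r) J (re (fun t x => source j h t x ^+ 2)).
  by apply: sumr_ge0 => j _; apply: J_ge0 => y; exact: sqr_ge0.
move: H a0 b0; clear L.
move: (J (re (fun t x => NN x * f t x * f t x))) (\sum_(_ < _) _) => jN b.
move: (J _) => a H a0 b0.
have -> : 10 * C * C1 * (a + b) = C1 * (2 * C * a + 8 * C * b + (8 * C * a + 2 * C * b)) by ring.
rewrite ler_wpM2l// (le_trans H)// lerDl.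
by rewrite addr_ge0// mulr_ge0// mulr_ge0.
Qed.

Lemma small_multiplier : exists C m Xm, [/\ 0 <= C, drift_weight B m Xm &
  [/\ forall x, NN x <= C * g0 x + Xm x,
      forall x, `|\tr B| * `|m x| <= NN x / 4 &
      forall x, m x ^+ 2 <= C * NN x * SW x]].
Proof.
(* This smallness gives |tr B| |m| <= N / 4; the summand 1 avoids a division by zero when tr B =
   0. *)
have eta0 : 0 < (4 * (`|\tr B| + 1))^-1 by rewrite invr_gt0.
have [C [m [Xm [C0 wm Hm]]]] :=
  kalman_multiplier HK lam0_gt0 q01 s_ge0 hlam lam_decr lam_conv eta0.
exists C, m, Xm; split => //; split => x; have [h1 h2 h3] := Hm x => //.
apply: (@le_trans _ _ (`|\tr B| * ((4 * (`|\tr B| + 1))^-1 * NN x))).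
  by rewrite ler_wpM2l.
have N0 := gauge_sum_ge0 B Q r (scale_exponent r lam) (lam r) x.
rewrite invfM mulrA mulrA [`|_| / 4]mulrC -2!mulrA [NN x / 4]mulrC ler_wpM2l// mulrA.
rewrite ler_piMl// ler_pdivrMr; last by rewrite ltr_wpDl.
by rewrite mul1r lerDl.
Qed.

Lemma estimate_static_real : exists2 K, 0 <= K & forall v, sw v -> (forall t, v t = v 0) ->
  J (fun x => weighted 1%:M (lam r) (fun t => hartley (v t)) 0 x ^+ 2) <=
    K * (J (fun x => weighted Q (lam 0%N) (fun t => hartley (v t)) 0 x ^+ 2) +
    \sum_(j < r) J (fun x => source_field (Q *m B^T ^+ j) (q j) (s j) (field B v) 0 x ^+ 2)).
Proof.
have [C [m [Xm [C0 wm [NX mN mG]]]]] := small_multiplier.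
have [C1 C11 HC1] := bracket_pow_le HK lam0_gt0 q01 s_ge0 hlam lam_decr.
have [cN pN] := gauge_sum_regular; have [cS pS] := source_weight_regular.
have [cg pg] := initial_weight_regular.
exists (10 * C * C1) => [|v sv vE]; first by rewrite !mulr_ge0// ge1_ge0.
have sf := sw_hartley sv; have sh := sw_hartley (sw_field B sv).
have H := static_estimate cN cS cg pN pS pg (gauge_sum_ge0 _ _ _ _ _)
  (source_weight_ge0 _ _ _ _ _) C0 wm NX mN mG sv 0 vE.
apply: (@weights_realized n (fun=> 0) id (fun t => hartley (v t))
  (fun t => hartley (field B v t)) C C0 _ _ _ H C1 HC1 (ge1_ge0 C11)).
- exact: (dom_poly_sw2 0 cN pN sf sf).
- exact: (dom_sqr 0 (sw_weighted _ _ sf)).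
- by move=> j; exact: (dom_sqr 0 (sw_weighted _ _ (sw_weighted _ _ sh))).
Qed.

Lemma estimate_joint_real : exists2 K, 0 <= K & forall v, tsw v -> tsw (field B v) ->
  J (joint (fun t x => weighted 1%:M (lam r) (fun t => hartley (v t)) t x ^+ 2)) <=
    K * (J (joint (fun t x => weighted Q (lam 0%N) (fun t => hartley (v t)) t x ^+ 2)) +
    \sum_(j < r) J (joint (fun t x => source_field (Q *m B^T ^+ j) (q j) (s j) (field B v) t x ^+ 2))).
Proof.
have [C [m [Xm [C0 wm [NX mN mG]]]]] := small_multiplier.
have [C1 C11 HC1] := bracket_pow_le HK lam0_gt0 q01 s_ge0 hlam lam_decr.
have [cN pN] := gauge_sum_regular; have [cS pS] := source_weight_regular.
have [cg pg] := initial_weight_regular.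
exists (10 * C * C1) => [|v sv sg]; first by rewrite !mulr_ge0// ge1_ge0.
have sf := tsw_hartley sv; have sh := tsw_hartley sg.
have H := joint_estimate cN cS cg pN pS pg (gauge_sum_ge0 _ _ _ _ _)
  (source_weight_ge0 _ _ _ _ _) C0 wm NX mN mG sv.1 sv.2 sg.2.
apply: (@weights_realized n.+1 (fun y => y ord0 0) (@tail R n) (fun t => hartley (v t))
  (fun t => hartley (field B v t)) C C0 _ _ _ H C1 HC1 (ge1_ge0 C11)).
- exact: (dom_joint cN pN sf.1 sf.1 sf.2).
- exact: (dom_joint_sqr (tsw_weighted _ _ sf)).
- by move=> j; exact: (dom_joint_sqr (tsw_weighted _ _ (tsw_weighted _ _ sh))).
Qed.

Theorem hypoelliptic_static : exists2 c : R, 0 < c & forall u : V -> R[i], schwartz u ->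
  (Hnorm (lam r) u <= c%:E *
     (L2norm (fourier_mult (bracket_pow Q (lam 0%N)) u) +
      \sum_(j < r) Hnorm (s j)
         (fourier_mult (bracket_pow (Q *m B^T ^+ j) (q j)) (transport B u))))%E.
Proof.
have [K K0 H] := estimate_static_real.
exists (Num.sqrt K + 1) => [|u su]; first by rewrite ltr_wpDl// sqrtr_ge0.
pose v : R -> V -> R := fun _ x => complex.Re (u x); pose w : R -> V -> R := fun _ x => complex.Im (u x).
have sv : sw v := sw_generated0 su.1 (generated_self _ _).
have sw' : sw w := sw_generated0 su.2 (generated_self _ _).
have uE x : u x = Complex (v 0 x) (w 0 x) by rewrite /v /w; case: (u x).
have tE x : transport B u x = Complex (field B v 0 x) (field B w 0 x) by exact: transportE.
have E1 : Hnorm (lam r) u = _ := L2norm_fourier_mult 1%:M (lam r) sv sw' uE.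
have E2 := L2norm_fourier_mult Q (lam 0%N) sv sw' uE.
have E3 (j : nat) := Hnorm_fourier_mult (Q *m B^T ^+ j) (q j) (s j) (sw_field B sv) (sw_field B sw') tE.
rewrite E1 E2; under eq_bigr do rewrite E3.
apply: sqrt_bound => //.
- by rewrite addr_ge0// J_ge0// => x; exact: sqr_ge0.
- by move=> j; rewrite addr_ge0// J_ge0// => x; exact: sqr_ge0.
(* The operator is real, so the real and imaginary parts of u satisfy the estimate separately, and
   squared norms add up. *)
rewrite big_split/= addrACA mulrDr; apply: lerD; exact: H.
Qed.

Theorem hypoelliptic_joint : exists2 c : R, 0 < c & forall u : R * V -> R[i], schwartz u ->
  (Hnorm_t (lam r) u <= c%:E *
     (L2norm_t (fourier_mult_t (bracket_pow Q (lam 0%N)) u) +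
      \sum_(j < r) Hnorm_t (s j)
         (fourier_mult_t (bracket_pow (Q *m B^T ^+ j) (q j)) (transport_t B u))))%E.
Proof.
have [K K0 H] := estimate_joint_real.
exists (Num.sqrt K + 1) => [|u su]; first by rewrite ltr_wpDl// sqrtr_ge0.
have [sv sw'] := su.
pose v := slice (fun p => complex.Re (u p)); pose w := slice (fun p => complex.Im (u p)).
have field_tsw phi : schwartz_real phi -> tsw (field B (slice phi)).
  move=> sphi; have [g gg ->] := field_generated1 B sphi (generated_self _ _).
  exact: tsw_generated1 gg.
have tv : tsw v := tsw_generated1 sv (generated_self _ _).
have tw : tsw w := tsw_generated1 sw' (generated_self _ _).
have uE p : u p = Complex (v p.1 p.2) (w p.1 p.2).
  by case: p => t x; rewrite /v /w /slice /=; case: (u _).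
have tE p : transport_t B u p = Complex (field B v p.1 p.2) (field B w p.1 p.2).
  exact: transport_tE.
have E1 : Hnorm_t (lam r) u = _ := L2norm_t_fourier_mult 1%:M (lam r) tv tw uE.
have E2 := L2norm_t_fourier_mult Q (lam 0%N) tv tw uE.
have E3 (j : nat) := Hnorm_t_fourier_mult (Q *m B^T ^+ j) (q j) (s j) (field_tsw _ sv) (field_tsw _ sw') tE.
rewrite E1 E2; under eq_bigr do rewrite E3.
apply: sqrt_bound => //.
- by rewrite addr_ge0// J_ge0// => x; exact: sqr_ge0.
- by move=> j; rewrite addr_ge0// J_ge0// => x; exact: sqr_ge0.
rewrite big_split/= addrACA mulrDr; apply: lerD; apply: H => //; exact: field_tsw.
Qed.

End hypoelliptic_estimate.

Theorem theorem2p1 (R : realType) (n : nat) (B Q : 'M[R]_n) (r : nat)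
    (lam q s : nat -> R)
    (hQ : sym_psd Q)
    (hK : \rank (kalman_mx B Q) = n)
    (hr : smallest_kernel_index B Q r)
    (r_gt0 : (0 < r)%N)
    (lam0_gt0 : 0 < lam 0%N)
    (hq1 : 0 <= q (r - 1)%N <= 1)
    (hs1 : 0 <= s (r - 1)%N)
    (hq2 : (2 <= r)%N -> 0 <= q (r - 2)%N <= q (r - 1)%N)
    (hs2 : (2 <= r)%N -> 0 <= s (r - 2)%N <= s (r - 1)%N)
    (hqs0 : forall j : nat, (j + 3 <= r)%N -> q j = 0 /\ s j = 0)
    (hlam : forall j : nat, (j < r)%N ->
       lam j.+1 * ((1 - q j) / lam j + 1) = 1 + s j)
    (lam_decr : forall j : nat, (j < r)%N -> lam j.+1 < lam j)
    (lam_conv : forall j : nat, (2 <= j <= r)%N ->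
       lam (j - 1)%N / lam (j - 2)%N + lam (j - 1)%N / lam j <= 2) :
  (* L = d/dt + Bx.grad on R^(n+1) *)
  (exists2 c : R, 0 < c & forall u : R * 'cV[R]_n -> R[i], schwartz u ->
     (Hnorm_t (lam r) u <= c%:E *
        (L2norm_t (fourier_mult_t (bracket_pow Q (lam 0%N)) u) +
         \sum_(j < r) Hnorm_t (s j)
            (fourier_mult_t (bracket_pow (Q *m B^T ^+ j) (q j))
               (transport_t B u))))%E)
  /\
  (* L = Bx.grad on R^n *)
  (exists2 c : R, 0 < c & forall u : 'cV[R]_n -> R[i], schwartz u ->
     (Hnorm (lam r) u <= c%:E *
        (L2norm (fourier_mult (bracket_pow Q (lam 0%N)) u) +
         \sum_(j < r) Hnorm (s j)
            (fourier_mult (bracket_pow (Q *m B^T ^+ j) (q j))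
               (transport B u))))%E).
Proof.
(* The bounds on q_j and s_j are given separately at r - 1, at r - 2 when r >= 2, and up to r - 3;
   the guard 2 <= r protects the truncated subtraction. *)
have split_index j : (j < r)%N -> [\/ j = (r - 1)%N, (2 <= r)%N /\ j = (r - 2)%N | (j + 3 <= r)%N].
  move=> jr; have : (j.+1 == r) || ((j.+2 == r) || (j + 3 <= r)%N).
    by rewrite addn3 -(leq_eqVlt j.+2) -(leq_eqVlt j.+1).
  by case/or3P => [/eqP<-|/eqP<-|h]; [apply: Or31|apply: Or32|apply: Or33]; rewrite ?subn1 ?subn2.
have q01 j : (j < r)%N -> 0 <= q j <= 1.
  move=> /split_index[->//|[r2 ->]|/hqs0[-> _]]; last by rewrite lexx ler01.
  by have /andP[-> h] := hq2 r2; case/andP: hq1 => _; exact: le_trans.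
have s0 j : (j < r)%N -> 0 <= s j.
  move=> /split_index[->//|[r2 ->]|/hqs0[_ ->]//].
  by case/andP: (hs2 r2).
have [_ HK _] := hr.
split.
  exact: (hypoelliptic_joint HK lam0_gt0 q01 s0 hlam lam_decr lam_conv).
exact: (hypoelliptic_static HK lam0_gt0 q01 s0 hlam lam_decr lam_conv).
Qed.
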